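(* Let $Q$ be a smooth manifold, $L:TQ\times\mathbb{R}\to\mathbb{R}$ a smooth function, $q_0,q_1\in Q$ and $z_0\in\mathbb{R}$, and let $\Omega(q_0,q_1)$, $\mathcal{Z}$, $\mathcal{A}$, $\bar\Omega_N(q_0,q_1,z_0)$ and $\bar{\mathcal{A}}$ be as defined in the context. Then: 1. The map $\mathrm{Id}\times\mathcal{Z}:\Omega(q_0,q_1)\to\bar\Omega_N(q_0,q_1,z_0)$, $c\mapsto(c,\mathcal{Z}(c))$, is a bijection with inverse $(c,c_z)\mapsto c$, and $\bar{\mathcal{A}}\circ(\mathrm{Id}\times\mathcal{Z})=\mathcal{A}$. 2. A curve $\bar c=(c,c_z)\in\bar\Omega_N(q_0,q_1,z_0)$ is a critical point of the restriction $\bar{\mathcal{A}}|_{\bar\Omega_N(q_0,q_1,z_0)}$ if and only if $c$ is a critical point of $\mathcal{A}$. 3. Consequently, $\bar c=(c,c_z)\in\bar\Omega_N(q_0,q_1,z_0)$ is a critical point of $\bar{\mathcal{A}}|_{\bar\Omega_N(q_0,q_1,z_0)}$ if and only if $(c,\dot c,c_z)$ satisfies the Herglotz equations, i.e., in all local coordinates $(q^i)$ on $Q$, $$\frac{\mathrm{d}}{\mathrm{d}t}\frac{\partial L}{\partial\dot q^i}-\frac{\partial L}{\partial q^i}=\frac{\partial L}{\partial\dot q^i}\frac{\partial L}{\partial z},$$ where all derivatives of $L$ are evaluated along $(c(t),\dot c(t),c_z(t))$.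
   Context: All curves are smooth and defined on $[0,1]$. $\Omega(q_0,q_1)$ is the set of curves $c:[0,1]\to Q$ with $c(0)=q_0$, $c(1)=q_1$. For $c\in\Omega(q_0,q_1)$, $\mathcal{Z}(c):[0,1]\to\mathbb{R}$ is the solution of $$\frac{\mathrm{d}\mathcal{Z}(c)}{\mathrm{d}t}(t)=L(c(t),\dot c(t),\mathcal{Z}(c)(t)),\qquad \mathcal{Z}(c)(0)=z_0.$$ It is assumed that this solution exists on all of $[0,1]$ for every $c\in\Omega(q_0,q_1)$, so that $\mathcal{Z}$ is well defined. The contact action is $\mathcal{A}:\Omega(q_0,q_1)\to\mathbb{R}$, $\mathcal{A}(c)=\mathcal{Z}(c)(1)-\mathcal{Z}(c)(0)$. $\bar\Omega(q_0,q_1,z_0)$ is the set of curves $\bar c=(c,c_z):[0,1]\to Q\times\mathbb{R}$ with $c(0)=q_0$, $c(1)=q_1$, $c_z(0)=z_0$ ($c_z(1)$ is free), and $\bar{\mathcal{A}}(\bar c)=\int_0^1\dot c_z(t)\,\mathrm{d}t$. Let $N\subseteq T(Q\times\mathbb{R})$ be the hypersurface $\{\dot z=L(q,\dot q,z)\}$, and let $\bar\Omega_N(q_0,q_1,z_0)$ be the set of $\bar c\in\bar\Omega(q_0,q_1,z_0)$ with $\dot{\bar c}(t)\in N$ for all $t$, that is, $\dot c_z=L(c,\dot c,c_z)$. Critical points: an element $c$ of one of the curve spaces $\Omega(q_0,q_1)$ or $\bar\Omega_N(q_0,q_1,z_0)$ is a critical point of a functional $f$ on that space if $\frac{\mathrm{d}}{\mathrm{d}s}\big|_{s=0}f(c_s)=0$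 for every one-parameter family $(c_s)_{s\in(-\varepsilon,\varepsilon)}$ of elements of that space with $c_0=c$ for which $(s,t)\mapsto c_s(t)$ is smooth. *)

(* Defs.v *)
From HB Require Import structures.
From mathcomp Require Import all_boot all_order all_algebra.
From mathcomp Require Import all_classical all_reals all_analysis.

Set Implicit Arguments.
Unset Strict Implicit.
Unset Printing Implicit Defensive.

Import Order.TTheory GRing.Theory Num.Theory.
Import numFieldNormedType.Exports.

Local Open Scope classical_set_scope.
Local Open Scope ring_scope.

(* Directional derivative of [f] at [x] along [v], where the increments are
   only those that stay in [A]. It is the usual ['D_v f x] if [A] is a
   neighbourhood of [x], and the one-sided derivative at an end point of
   an interval. *)
Definition derivable_in (R : realType) (V W : normedModType R)
    (A : set V) (f : V -> W) (x v : V) : Prop :=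
  cvg ((fun h : R => h^-1 *: (f (h *: v + x) - f x))
         @ within [set h | A (h *: v + x)] 0^').

Definition derive_in (R : realType) (V W : normedModType R)
    (A : set V) (f : V -> W) (x v : V) : W :=
  lim ((fun h : R => h^-1 *: (f (h *: v + x) - f x))
         @ within [set h | A (h *: v + x)] 0^').

(* [f] is C^k on [A]. This is meant for finite-dimensional [V] and for sets
   [A] that are relatively open in a product of lines and intervals, such as
   open sets, [0,1] and ]-e,e[ x [0,1]; there it says that all partial
   derivatives of order at most k (one-sided at the boundary) exist and are
   continuous on [A]. *)
Fixpoint Ck_on (R : realType) (V W : normedModType R) (k : nat)
    (A : set V) (f : V -> W) : Prop :=
  {within A, continuous f} /\
  match k with
  | 0 => True
  | k'.+1 => forall v : V,
      (forall x, A x -> derivable_in A f x v) /\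
      Ck_on k' A (fun x => derive_in A f x v)
  end.

Definition smooth_on (R : realType) (V W : normedModType R)
    (A : set V) (f : V -> W) : Prop :=
  forall k, Ck_on k A f.

(* The functions [coord] and [point] are total; only their values on [dom]
   and on [coord @` dom] matter. *)
Record chart (R : realType) (n : nat) (Q : topologicalType) := Chart {
  dom : set Q;
  coord : Q -> 'rV[R]_n;
  point : 'rV[R]_n -> Q;
  dom_open : open dom;
  img_open : open (coord @` dom);
  coordK : forall q, dom q -> point (coord q) = q;
  coord_continuous : {within dom, continuous coord};
  point_continuous : {within coord @` dom, continuous point} }.

Definition img (R : realType) n (Q : topologicalType) (phi : chart R n Q) :
  set 'rV[R]_n := coord phi @` dom phi.

Definition transition (R : realType) n (Q : topologicalType)
    (phi psi : chart R n Q) : 'rV[R]_n -> 'rV[R]_n :=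
  fun x => coord psi (point phi x).

Definition compatible (R : realType) n (Q : topologicalType)
    (phi psi : chart R n Q) : Prop :=
  smooth_on (coord phi @` (dom phi `&` dom psi)) (transition phi psi) /\
  smooth_on (coord psi @` (dom phi `&` dom psi)) (transition psi phi).

Record manifold (R : realType) (n : nat) := Manifold {
  carrier :> topologicalType;
  atlas : set (chart R n carrier);
  manifold_hausdorff : hausdorff_space carrier;
  manifold_second_countable : @second_countable carrier;
  atlas_cover : forall q : carrier, exists2 phi, atlas phi & dom phi q;
  atlas_compatible : forall phi psi,
    atlas phi -> atlas psi -> compatible phi psi }.

Definition max_atlas (R : realType) n (Q : manifold R n) :
  set (chart R n Q) :=
  [set phi | forall psi, atlas psi -> compatible phi psi].

Lemma atlas_max (R : realType) n (Q : manifold R n) (phi : chart R n Q) :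
  atlas phi -> max_atlas phi.
Proof. by move=> aphi psi; exact: atlas_compatible. Qed.

Definition chart_at (R : realType) n (Q : manifold R n) (q : Q) :
  chart R n Q := sval (cid2 (atlas_cover q)).

Lemma chart_atP (R : realType) n (Q : manifold R n) (q : Q) :
  max_atlas (chart_at q) /\ dom (chart_at q) q.
Proof.
by rewrite /chart_at; case: cid2 => phi /= aphi phiq; split=> //;
  exact: atlas_max.
Qed.

Definition smooth_into (R : realType) n (Q : manifold R n)
    (V : normedModType R) (A : set V) (f : V -> Q) : Prop :=
  {within A, continuous f} /\
  forall phi, max_atlas phi ->
    smooth_on (A `&` f @^-1` dom phi) (fun x => coord phi (f x)).

(* A tangent vector at [q] is an equivalence class of pairs
   (chart at q, coordinate vector), two pairs being equivalent when the
   differential of the transition map sends one coordinate vector to the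
   other. [tclass phi q v] is the class of (phi, v). *)
Definition tclass (R : realType) n (Q : manifold R n)
    (phi : chart R n Q) (q : Q) (v : 'rV[R]_n) :
  set (chart R n Q * 'rV[R]_n) :=
  [set w | [/\ max_atlas w.1, dom w.1 q &
               w.2 = 'D_v (transition phi w.1) (coord phi q)]].

Record tangent (R : realType) n (Q : manifold R n) := Tangent {
  tbase : Q;
  tvector : set (chart R n Q * 'rV[R]_n);
  tangentP : exists phi v,
    [/\ max_atlas phi, dom phi tbase & tvector = tclass phi tbase v] }.

(* [chart_or phi q] is [phi] if this is a chart of [Q] at [q]; otherwise it is
   an arbitrary such chart. It only serves to make [tvec] total. *)
Definition chart_or (R : realType) n (Q : manifold R n)
    (phi : chart R n Q) (q : Q) : chart R n Q :=
  if `[< max_atlas phi /\ dom phi q >] then phi else chart_at q.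

Lemma chart_or_tangent (R : realType) n (Q : manifold R n)
    (phi : chart R n Q) (q : Q) (v : 'rV[R]_n) :
  exists psi w, [/\ max_atlas psi, dom psi q &
    tclass (chart_or phi q) q v = tclass psi q w].
Proof.
exists (chart_or phi q), v; rewrite /chart_or.
by case: asboolP => [[]|_] //; have [] := chart_atP q.
Qed.

(* The tangent vector \sum_i v^i d/dq^i at [q], in the coordinates [phi]. *)
Definition tvec (R : realType) n (Q : manifold R n)
    (phi : chart R n Q) (q : Q) (v : 'rV[R]_n) : tangent Q :=
  Tangent (chart_or_tangent phi q v).

(* The expression of a function L(q, qdot, z) in the bundle coordinates
   ((q^i, qdot^i), z) that [phi] induces on TQ x R. *)
Definition local_rep (R : realType) n (Q : manifold R n)
    (L : tangent Q -> R -> R) (phi : chart R n Q) :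
  'rV[R]_n * 'rV[R]_n * R -> R :=
  fun p => L (tvec phi (point phi p.1.1) p.1.2) p.2.

Definition smooth_lagrangian (R : realType) n (Q : manifold R n)
    (L : tangent Q -> R -> R) : Prop :=
  forall phi, max_atlas phi ->
    smooth_on [set p : 'rV[R]_n * 'rV[R]_n * R | img phi p.1.1]
              (local_rep L phi).

(* Curves are functions on the type of points of [0,1], so that equality of
   curves is equality on [0,1]. To speak of smoothness and of derivatives they
   are precomposed with the retraction [clamp] of the line onto [0,1]; values
   outside [0,1] are never used. *)
Definition unit_interval (R : realType) := {t : R | 0 <= t <= 1}.

Lemma clamp_subproof (R : realType) (t : R) :
  0 <= Num.max 0 (Num.min t 1) <= 1.
Proof. by rewrite le_max lexx /= ge_max ler01 ge_min lexx orbT. Qed.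

Definition clamp (R : realType) (t : R) : unit_interval R :=
  exist _ (Num.max 0 (Num.min t 1)) (clamp_subproof t).

Definition closed_unit (R : realType) : set R := [set t | 0 <= t <= 1].

Definition curve_derivable (R : realType) (W : normedModType R)
    (f : unit_interval R -> W) (t : unit_interval R) : Prop :=
  derivable_in (@closed_unit R) (fun u : R => f (clamp u)) (sval t) 1.

Definition curve_derive (R : realType) (W : normedModType R)
    (f : unit_interval R -> W) (t : unit_interval R) : W :=
  derive_in (@closed_unit R) (fun u : R => f (clamp u)) (sval t) 1.

Definition smooth_curve (R : realType) n (Q : manifold R n)
    (c : unit_interval R -> Q) : Prop :=
  smooth_into (@closed_unit R) (fun u : R => c (clamp u)).

Definition smooth_function (R : realType) (f : unit_interval R -> R) : Prop :=
  smooth_on (@closed_unit R) (fun u : R => f (clamp u)).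

Definition velocity (R : realType) n (Q : manifold R n)
    (c : unit_interval R -> Q) (t : unit_interval R) : tangent Q :=
  let phi := chart_at (c t) in
  tvec phi (c t) (curve_derive (fun u => coord phi (c u)) t).

Definition Omega (R : realType) n (Q : manifold R n) (q0 q1 : Q) :
  set (unit_interval R -> Q) :=
  [set c | [/\ smooth_curve c, c (clamp 0) = q0 & c (clamp 1) = q1]].

Definition is_solution (R : realType) n (Q : manifold R n)
    (L : tangent Q -> R -> R) (z0 : R)
    (c : unit_interval R -> Q) (z : unit_interval R -> R) : Prop :=
  z (clamp 0) = z0 /\
  forall t, curve_derivable z t /\ curve_derive z t = L (velocity c t) (z t).

(* Arbitrary if there is no solution. *)
Definition Zmap (R : realType) n (Q : manifold R n)
    (L : tangent Q -> R -> R) (z0 : R) (c : unit_interval R -> Q) :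
  unit_interval R -> R :=
  xget (fun=> 0) [set z | is_solution L z0 c z].

Definition contact_action (R : realType) n (Q : manifold R n)
    (L : tangent Q -> R -> R) (z0 : R) (c : unit_interval R -> Q) : R :=
  Zmap L z0 c (clamp 1) - Zmap L z0 c (clamp 0).

(* A curve in Q x R is given as the pair of its components. *)
Definition bar_curve (R : realType) n (Q : manifold R n) : Type :=
  ((unit_interval R -> Q) * (unit_interval R -> R))%type.

Definition Omega_bar (R : realType) n (Q : manifold R n) (q0 q1 : Q) (z0 : R) :
  set (bar_curve Q) :=
  [set cb | [/\ smooth_curve cb.1, smooth_function cb.2,
                cb.1 (clamp 0) = q0, cb.1 (clamp 1) = q1 &
                cb.2 (clamp 0) = z0]].

(* The hypersurface N, where T(Q x R) is identified with TQ x TR = TQ x R^2;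
   the point (xi, (z, zdot)) has velocity zdot in the R direction. *)
Definition hypersurface (R : realType) n (Q : manifold R n)
    (L : tangent Q -> R -> R) : set (tangent Q * (R * R)) :=
  [set p | p.2.2 = L p.1 p.2.1].

Definition bar_velocity (R : realType) n (Q : manifold R n)
    (cb : bar_curve Q) (t : unit_interval R) : tangent Q * (R * R) :=
  (velocity cb.1 t, (cb.2 t, curve_derive cb.2 t)).

Definition Omega_N (R : realType) n (Q : manifold R n)
    (L : tangent Q -> R -> R) (q0 q1 : Q) (z0 : R) : set (bar_curve Q) :=
  [set cb | Omega_bar q0 q1 z0 cb /\
            forall t, hypersurface L (bar_velocity cb t)].

Definition bar_action (R : realType) n (Q : manifold R n)
    (cb : bar_curve Q) : R :=
  \int[lebesgue_measure]_(t in @closed_unit R) curve_derive cb.2 (clamp t).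

Definition IdZ (R : realType) n (Q : manifold R n)
    (L : tangent Q -> R -> R) (z0 : R) (c : unit_interval R -> Q) :
  bar_curve Q := (c, Zmap L z0 c).

Definition strip (R : realType) (e : R) : set (R * R) :=
  [set p | - e < p.1 < e /\ closed_unit p.2].

Definition smooth_family (R : realType) n (Q : manifold R n) (e : R)
    (F : R -> unit_interval R -> Q) : Prop :=
  smooth_into (strip e) (fun p : R * R => F p.1 (clamp p.2)).

Definition smooth_bar_family (R : realType) n (Q : manifold R n) (e : R)
    (F : R -> bar_curve Q) : Prop :=
  smooth_family e (fun s => (F s).1) /\
  smooth_on (strip e) (fun p : R * R => (F p.1).2 (clamp p.2)).

(* [c] is a critical point of [f] on the space of curves [X]. The family [F] is
   indexed by all reals, but only its members for -e < s < e are used. *)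
Definition critical_point (R : realType) (C : Type) (X : set C)
    (smooth_fam : R -> (R -> C) -> Prop) (f : C -> R) (c : C) : Prop :=
  X c /\
  forall (e : R) (F : R -> C), 0 < e ->
    (forall s, - e < s < e -> X (F s)) -> F 0 = c -> smooth_fam e F ->
    is_derive (0 : R) (1 : R) (fun s : R => f (F s)) 0.

Definition herglotz (R : realType) n (Q : manifold R n)
    (L : tangent Q -> R -> R) (cb : bar_curve Q) : Prop :=
  forall (phi : chart R n Q), max_atlas phi ->
  forall t : unit_interval R, dom phi (cb.1 t) ->
  forall i : 'I_n,
  let Lphi := local_rep L phi in
  let along u := (coord phi (cb.1 u),
                  curve_derive (fun w => coord phi (cb.1 w)) u, cb.2 u) in
  let e_i : 'rV[R]_n := delta_mx ord0 i in
  let dL_dq u := 'D_(e_i, 0, 0) Lphi (along u) in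
  let dL_dqdot u := 'D_(0, e_i, 0) Lphi (along u) in
  let dL_dz u := 'D_(0, 0, 1) Lphi (along u) in
  curve_derive dL_dqdot t - dL_dq t = dL_dqdot t * dL_dz t.

(* Main.v *)
Require Import Defs.
From HB Require Import structures.
From mathcomp Require Import all_boot all_order all_algebra.
From mathcomp Require Import all_classical all_reals all_analysis.
From mathcomp Require Import ring lra.
Import Order.TTheory GRing.Theory Num.Theory.
Import numFieldNormedType.Exports.
Import Defs.

Set Implicit Arguments.
Unset Strict Implicit.
Unset Printing Implicit Defensive.
Local Open Scope classical_set_scope.
Local Open Scope ring_scope.

(** The map Z is computed by an ODE depending smoothly on parameters, so
    [Id x Z] and the projection [(c, c_z) |-> c] carry smooth families to smooth
    families, and critical points correspond to each other.

    Let [c_s] be a variation of [c] in [Omega q0 q1] with variation field [xi],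
    and let [w] be the derivative of [Z c_s] at [s = 0].  It solves the linear
    equation [w' = L_z w + <L_q, xi> + <L_qdot, xi'>], so that
    [y = w - <L_qdot, xi>] solves [y' = L_z y - <H, xi>], where [H] is the
    difference of the two sides of the Herglotz equations.  As [xi] vanishes at
    both ends, [y 0 = 0] and [y 1] is the derivative of the action.  If [H = 0],
    then [y = 0].  Conversely, if some component [H_i] does not vanish at some
    time, it keeps its sign on a small interval inside ]0, 1[ on which [c] stays
    in a chart; for the variation of [c] along the i-th coordinate by a bump
    function supported there, [<H, xi>] has constant sign, and an integrating
    factor shows that [y 1] cannot vanish. *)

(** * Derivatives within a set *)

Section basics.
Context {R : realType}.
Implicit Types V W : normedModType R.

(** Only directional derivatives are at hand, one-sided at the ends of [[0, 1]], so the calculus on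
    intervals and strips is rebuilt from them: the chain rule needs outer functions that are C^1 on
    open subsets of finite-dimensional spaces, and mixed partial derivatives must commute up to the
    boundary of the strip. Solutions of the nonlinear equation exist on all of [[0, 1]] by
    hypothesis. What remains is uniqueness and smoothness in the parameter; as [L] is not assumed
    globally Lipschitz in [z], both rest on an estimate in a tube around the graph of one given
    solution. Only linear equations have to be solved, and an integrating factor does this. A curve
    need not stay in one chart, while the equations for [w] and [y] live on all of [[0, 1]].
    Therefore [L_z], the [s]-derivative of [L] along the family and [<L_qdot, xi>] are defined as
    global functions of time, and charts serve only to verify identities near each time. *)

Definition has_derive V W (A : set V) (f : V -> W) (x v : V) (l : W) : Prop :=
  (fun h : R => h^-1 *: (f (h *: v + x) - f x))
    @ within [set h | A (h *: v + x)] 0^' --> l.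

(* On such sets [derive_in] is determined by [has_derive]. *)
Definition approachable V (A : set V) : Prop :=
  forall x v, A x -> ProperFilter (within [set h : R | A (h *: v + x)] 0^').

(** Relative openness, phrased with neighbourhood filters. Passing to such a subset alters no
    derivative, which makes all notions here local and allows working in one chart at a time. *)
Definition relopen V (A B : set V) : Prop :=
  B `<=` A /\ forall x, B x -> within A (nbhs x) B.

Lemma ray_cvg V (x v : V) : (fun h : R => h *: v + x) @ 0^' --> x.
Proof.
rewrite -[X in _ --> X]add0r -[X in _ --> X + _](scale0r v).
apply: cvgD; last exact: cvg_cst.
by apply: cvgZr_tmp; apply: cvg_within.
Qed.

(** A remainder estimate instead of a limit of quotients, so that estimates combine without dividing
    by [h]. *)
Lemma has_deriveP V W (A : set V) (f : V -> W) (x v : V) (l : W) :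
  has_derive A f x v l <->
  forall e, 0 < e -> exists2 d, 0 < d & forall h, h != 0 -> `|h| < d ->
    A (h *: v + x) -> `|f (h *: v + x) - f x - h *: l| <= e * `|h|.
Proof.
split.
  move=> /cvgrPdist_le H e e0; have /= := H _ e0.
  rewrite /within /= => -[d /= d0 Hd]; exists d => // h h0 hd Ah.
  have := Hd h; rewrite /ball_ /= sub0r normrN => /(_ hd h0 Ah) H1.
  have -> : f (h *: v + x) - f x - h *: l =
    - (h *: (l - h^-1 *: (f (h *: v + x) - f x))).
    by rewrite scalerBr scalerA divff // scale1r opprB.
  by rewrite normrN normrZ mulrC ler_wpM2r.
move=> H; apply/cvgrPdist_le => e e0; have [d d0 Hd] := H _ e0.
rewrite /within /=; exists d => //= h; rewrite /ball_ /= sub0r normrN => hd h0 Ah.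
have := Hd h h0 hd Ah.
have -> : f (h *: v + x) - f x - h *: l =
    - (h *: (l - h^-1 *: (f (h *: v + x) - f x))).
  by rewrite scalerBr scalerA divff // scale1r opprB.
by rewrite normrN normrZ mulrC ler_pM2r // normr_gt0.
Qed.

Lemma approachable_lim V W (A : set V) (f : V -> W) x v l :
  approachable A -> A x -> has_derive A f x v l -> derive_in A f x v = l.
Proof. by move=> gA Ax Hl; have := gA x v Ax => P; apply: cvg_lim. Qed.

Lemma derivable_in_has V W (A : set V) (f : V -> W) x v :
  derivable_in A f x v -> has_derive A f x v (derive_in A f x v).
Proof. by []. Qed.

Lemma has_derivable_in V W (A : set V) (f : V -> W) x v l :
  has_derive A f x v l -> derivable_in A f x v.
Proof. by move=> H; apply/cvg_ex; exists l. Qed.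

(** As [h] tends to 0, [h *: v + x] tends to [x]; hence small increments that stay in [A] also stay
    in [B]. *)
Lemma relopen_filter V (A B : set V) (x v : V) : relopen A B -> B x ->
  within [set h : R | B (h *: v + x)] 0^' =
  within [set h : R | A (h *: v + x)] 0^'.
Proof.
move=> [BA oB] Bx; have := oB _ Bx; rewrite /within /= => nB.
have rB : \forall h \near (0:R)^', A (h *: v + x) -> B (h *: v + x).
  exact: (@ray_cvg V x v _ nB).
apply/seteqP; split => P /=; rewrite /within /= => PP.
  near=> h => Ah.
  suff : B (h *: v + x) by near: h.
  by move: Ah; near: h.
near=> h => Bh.
have : A (h *: v + x) by exact: BA.
by near: h.
Unshelve. all: by end_near. Qed.

Lemma derivable_in_relopen V W (A B : set V) (f : V -> W) x v :
  relopen A B -> B x -> derivable_in B f x v = derivable_in A f x v.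
Proof. by move=> AB Bx; rewrite /derivable_in (relopen_filter _ AB Bx). Qed.

Lemma derive_in_relopen V W (A B : set V) (f : V -> W) x v :
  relopen A B -> B x -> derive_in B f x v = derive_in A f x v.
Proof. by move=> AB Bx; rewrite /derive_in (relopen_filter _ AB Bx). Qed.

Lemma has_derive_relopen V W (A B : set V) (f : V -> W) x v l :
  relopen A B -> B x -> has_derive B f x v l = has_derive A f x v l.
Proof. by move=> AB Bx; rewrite /has_derive (relopen_filter _ AB Bx). Qed.

Lemma has_derive_sub V W (A B : set V) (f : V -> W) x v l :
  B `<=` A -> has_derive A f x v l -> has_derive B f x v l.
Proof.
move=> BA /has_deriveP H; apply/has_deriveP => e /H[d d0 Hd].
by exists d => // h h0 hd Bh; apply: Hd => //; exact: BA.
Qed.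

Lemma approachable_relopen V (A B : set V) :
  relopen A B -> approachable A -> approachable B.
Proof.
move=> AB gA x v Bx; rewrite (relopen_filter _ AB Bx); apply: gA.
by case: AB => + _; exact.
Qed.

Lemma relopen_open V (A : set V) : relopen setT A <-> open A.
Proof.
split=> [[_ H]|oA].
  rewrite openE => x Ax; have := H _ Ax; rewrite /within /=.
  by apply: filterS => y; exact.
split=> // x Ax; rewrite /within /=; near=> y => _; near: y.
exact: open_nbhs_nbhs.
Unshelve. all: by end_near. Qed.

Lemma approachableT V : approachable (@setT V).
Proof.
move=> x v _; have -> : [set h : R | setT (h *: v + x)] = setT by apply/seteqP; split.
by rewrite withinET; exact: Proper_dnbhs_numFieldType.
Qed.

Lemma approachable_open V (A : set V) : open A -> approachable A.
Proof.
by move=> /relopen_open oA; apply: approachable_relopen oA (@approachableT V).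
Qed.

Lemma relopen_refl V (A : set V) : relopen A A.
Proof. by split=> // x Ax; exact: withinT. Qed.

Lemma relopen_sub V (A B C : set V) :
  relopen A C -> C `<=` B -> B `<=` A -> relopen B C.
Proof.
move=> [CA oC] CB BA; split=> // x Cx; have := oC _ Cx; rewrite /within /=.
by apply: filterS => y H /BA.
Qed.

Lemma relopen_trans V (A B C : set V) :
  relopen A B -> relopen B C -> relopen A C.
Proof.
move=> [BA oB] [CB oC]; split; first exact: (subset_trans CB).
move=> x Cx; have := oC _ Cx; have := oB _ (CB _ Cx); rewrite /within /=.
by apply: filterS2 => y H1 H2 /H1.
Qed.

Lemma relopenI V (A B C : set V) :
  relopen A B -> relopen A C -> relopen A (B `&` C).
Proof.
move=> [BA oB] [_ oC]; split; first by move=> x [/BA].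
by move=> x [Bx Cx]; apply: filterI; [exact: oB|exact: oC].
Qed.

Lemma relopenIo V (A U : set V) : open U -> relopen A (A `&` U).
Proof.
move=> oU; split; first by move=> x [].
move=> x [_ Ux]; rewrite /within /=.
have : nbhs x U by exact: open_nbhs_nbhs.
by apply: filterS => y Uy Ay.
Qed.

Lemma relopen_preimage V (T : topologicalType) (A : set V) (f : V -> T)
    (D : set T) : {within A, continuous f} -> open D ->
  relopen A (A `&` f @^-1` D).
Proof.
move=> /subspace_continuousP cf oD; split; first by move=> x [].
move=> x [Ax Dx]; have := cf _ Ax D; rewrite /= => /(_ (open_nbhs_nbhs (conj oD Dx))).
rewrite /within /= => H.
have : \forall y \near x, A y -> D (f y) by exact: H.
by apply: filterS => y H1 Ay; split=> //; exact: H1.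
Qed.

Lemma cont_relopen V (T : topologicalType) (A B : set V) (f : V -> T) :
  relopen A B -> {within A, continuous f} -> {within B, continuous f}.
Proof. by move=> [BA _]; exact: continuous_subspaceW. Qed.

Lemma cont_glue V (T : topologicalType) (A : set V) (f : V -> T) :
  (forall x, A x -> exists B, [/\ relopen A B, B x & {within B, continuous f}]) ->
  {within A, continuous f}.
Proof.
move=> H; apply/subspace_continuousP => x Ax.
have [B [[BA oB] Bx /subspace_continuousP cf]] := H _ Ax.
move=> P /= fP; have := cf _ Bx _ fP; rewrite /= /within /= => H1.
have := oB _ Bx; rewrite /within /= => H2.
have : \forall y \near x, B y -> P (f y) by exact: H1.
by move: H2; apply: filterS2 => y H2 H3 /H2.
Qed.

Lemma derive_in_eq V W (A : set V) (f g : V -> W) x v :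
  (forall y, A y -> f y = g y) -> A x -> derive_in A f x v = derive_in A g x v.
Proof.
move=> fg Ax; rewrite /derive_in.
suff -> : (fun h : R => h^-1 *: (f (h *: v + x) - f x))
         @ within [set h | A (h *: v + x)] 0^' =
  (fun h : R => h^-1 *: (g (h *: v + x) - g x))
         @ within [set h | A (h *: v + x)] 0^' by [].
apply/seteqP; split; apply: near_eq_cvg; rewrite /prop_near1 /within /=;
  by apply: nearW => h Ah; rewrite !fg.
Qed.

Lemma has_derive_eq V W (A : set V) (f g : V -> W) x v l :
  (forall y, A y -> f y = g y) -> A x -> has_derive A f x v l -> has_derive A g x v l.
Proof.
move=> fg Ax /has_deriveP H; apply/has_deriveP => e /H[d d0 Hd].
by exists d => // h h0 hd Ah; rewrite -!fg //; exact: Hd.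
Qed.

Lemma derivable_in_eq V W (A : set V) (f g : V -> W) x v :
  (forall y, A y -> f y = g y) -> A x -> derivable_in A f x v -> derivable_in A g x v.
Proof.
by move=> fg Ax /derivable_in_has /(has_derive_eq fg Ax); exact: has_derivable_in.
Qed.

Lemma cont_eq V (T : topologicalType) (A : set V) (f g : V -> T) :
  (forall y, A y -> f y = g y) -> {within A, continuous f} -> {within A, continuous g}.
Proof. by move=> fg; apply: subspace_eq_continuous => x; rewrite inE; exact: fg. Qed.

Lemma Ck_on_eq V W k (A : set V) (f g : V -> W) :
  (forall y, A y -> f y = g y) -> Ck_on k A f -> Ck_on k A g.
Proof.
elim: k f g => [|k IH] f g fg /=.
  by move=> [cf _]; split=> //; apply: cont_eq cf.
move=> [cf Hf]; split; first exact: cont_eq cf.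
move=> v; have [df Cf] := Hf v; split.
  by move=> x Ax; apply: derivable_in_eq (df _ Ax).
by apply: IH Cf => x Ax; exact: derive_in_eq.
Qed.

Lemma Ck_on_relopen V W k (A B : set V) (f : V -> W) :
  relopen A B -> Ck_on k A f -> Ck_on k B f.
Proof.
move=> AB; have [BA _] := AB; elim: k f => [|k IH] f /=.
  by move=> [cf _]; split=> //; exact: cont_relopen cf.
move=> [cf Hf]; split; first exact: cont_relopen cf.
move=> v; have [df Cf] := Hf v; split.
  by move=> x Bx; rewrite (derivable_in_relopen _ _ AB) //; apply: df; exact: BA.
apply: Ck_on_eq (IH _ Cf) => x Bx; by rewrite (derive_in_relopen _ _ AB).
Qed.

(** Derivatives within [B] and within [A] agree on [B], so each order can be patched in turn. This
    is how facts proved in charts reach the whole domain. *)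
Lemma Ck_on_glue V W k (A : set V) (f : V -> W) :
  (forall x, A x -> exists B, [/\ relopen A B, B x & Ck_on k B f]) -> Ck_on k A f.
Proof.
elim: k f => [|k IH] f H /=.
  by split=> //; apply: cont_glue => x /H[B [? ? []]]; exists B.
split; first by apply: cont_glue => x /H[B [? ? []]]; exists B.
move=> v; split.
  move=> x /H[B [AB Bx [_ /(_ v)[df _]]]].
  by rewrite -(derivable_in_relopen _ _ AB) //; exact: df.
apply: IH => x /H[B [AB Bx [_ /(_ v)[_ Cf]]]]; exists B; split=> //.
by apply: Ck_on_eq Cf => y By; rewrite (derive_in_relopen _ _ AB).
Qed.

Lemma Ck_on_cont V W k (A : set V) (f : V -> W) :
  Ck_on k A f -> {within A, continuous f}.
Proof. by case: k => [|k] []. Qed.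

Lemma Ck_onW V W k (A : set V) (f : V -> W) : Ck_on k.+1 A f -> Ck_on k A f.
Proof.
elim: k f => [|k IH] f; first by move=> [].
move=> [cf H]; split=> // v; have [df Cf] := H v; split=> //.
exact: IH Cf.
Qed.

Lemma Ck_on_derivable V W k (A : set V) (f : V -> W) x v :
  Ck_on k.+1 A f -> A x -> derivable_in A f x v.
Proof. by move=> [_ /(_ v)[df _]] /df. Qed.

Lemma Ck_on_has V W k (A : set V) (f : V -> W) x v :
  Ck_on k.+1 A f -> A x -> has_derive A f x v (derive_in A f x v).
Proof. by move=> /Ck_on_derivable; apply. Qed.

Lemma Ck_on_derive V W k (A : set V) (f : V -> W) v :
  Ck_on k.+1 A f -> Ck_on k A (fun x => derive_in A f x v).
Proof. by move=> [_ /(_ v)[]]. Qed.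

Lemma smooth_on_derive V W (A : set V) (f : V -> W) v :
  smooth_on A f -> smooth_on A (fun x => derive_in A f x v).
Proof. by move=> Cf k; exact: Ck_on_derive. Qed.

(** The way to gain one order: exhibit a formula [df] for the directional derivatives.
    Approachability makes limits unique and so identifies [derive_in] with that formula. *)
Lemma Ck_onS V W k (A : set V) (f : V -> W) (df : V -> V -> W) :
  approachable A -> {within A, continuous f} ->
  (forall v x, A x -> has_derive A f x v (df v x)) ->
  (forall v, Ck_on k A (df v)) -> Ck_on k.+1 A f.
Proof.
move=> gA cf dfE Cdf; split=> // v; split.
  by move=> x Ax; exact: has_derivable_in (dfE _ _ Ax).
apply: Ck_on_eq (Cdf v) => x Ax; symmetry; apply: approachable_lim => //.
exact: dfE.
Qed.

Lemma has_derive_cst V W (A : set V) (c : W) x v : has_derive A (fun=> c) x v 0.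
Proof.
apply/has_deriveP => e e0; exists 1 => // h _ _ _.
by rewrite subrr scaler0 subrr normr0 mulr_ge0 // ltW.
Qed.

Lemma has_deriveD V W (A : set V) (f g : V -> W) x v l m :
  has_derive A f x v l -> has_derive A g x v m ->
  has_derive A (fun y => f y + g y) x v (l + m).
Proof.
rewrite /has_derive => Hf Hg.
rewrite (_ : (fun h : R => _) = (fun h : R => h^-1 *: (f (h *: v + x) - f x))
  \+ (fun h : R => h^-1 *: (g (h *: v + x) - g x))); first exact: cvgD.
by apply/funext => h /=; rewrite -scalerDr opprD addrACA.
Qed.

Lemma has_deriveZ V W (A : set V) (f : V -> W) (c : R) x v l :
  has_derive A f x v l -> has_derive A (fun y => c *: f y) x v (c *: l).
Proof.
rewrite /has_derive => Hf.
rewrite (_ : (fun h : R => _) =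
  c \*: (fun h : R => h^-1 *: (f (h *: v + x) - f x))); first exact: cvgZl_tmp.
by apply/funext => h /=; rewrite !scalerA -scalerBr scalerA mulrC.
Qed.

(** A directional derivative yields continuity along its ray only; the product rule asks for just
    that. *)
Lemma has_derive_along V W (A : set V) (f : V -> W) x v l :
  has_derive A f x v l ->
  (fun h : R => f (h *: v + x)) @ within [set h | A (h *: v + x)] 0^' --> f x.
Proof.
rewrite /has_derive => Hf.
have H0 : (id : R -> R) @ within [set h | A (h *: v + x)] 0^' --> (0 : R).
  apply: cvg_trans (@cvg_within _ (nbhs (0:R)) _ (fun h => h != 0)).
  exact: cvg_within.
have H : (fun h : R => h *: (h^-1 *: (f (h *: v + x) - f x)) + f x)
    @ within [set h | A (h *: v + x)] 0^' --> 0 *: l + f x.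
  by apply: cvgD; [exact: cvgZ|exact: cvg_cst].
rewrite scale0r add0r in H.
apply: cvg_trans H; apply: near_eq_cvg.
suff : \forall h \near (0 : R)^', A (h *: v + x) ->
  h *: (h^-1 *: (f (h *: v + x) - f x)) + f x = f (h *: v + x) by [].
near=> h => Ah; rewrite scalerA divff ?scale1r ?subrK //.
near: h; exact: nbhs_dnbhs_neq.
Unshelve. all: by end_near. Qed.

Lemma has_deriveM V (A : set V) (f g : V -> R) x v l m :
  has_derive A f x v l -> has_derive A g x v m ->
  has_derive A (fun y => f y * g y) x v (l * g x + f x * m).
Proof.
move=> Hf Hg; have Hf' := has_derive_along Hg; rewrite /has_derive in Hf Hg *.
rewrite (_ : (fun h : R => _) =
  ((fun h : R => h^-1 *: (f (h *: v + x) - f x)) \* (fun h => g (h *: v + x)))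
  \+ (cst (f x) \* (fun h : R => h^-1 *: (g (h *: v + x) - g x)))).
  by apply: cvgD; apply: cvgM => //; exact: cvg_cst.
apply/funext => h /=; rewrite /GRing.scale /=; ring.
Qed.

End basics.

(** * Rules of differentiation, affine substitutions and the mean value theorem *)

Section algebra.
Context {R : realType}.
Implicit Types V W : normedModType R.

Lemma has_derive_sum V W (I : Type) (r : seq I) (P : pred I) (A : set V) (f : I -> V -> W) x v l :
  (forall i, P i -> has_derive A (f i) x v (l i)) ->
  has_derive A (fun y => \sum_(i <- r | P i) f i y) x v (\sum_(i <- r | P i) l i).
Proof.
move=> H; elim: r => [|i r IH].
  rewrite big_nil (_ : (fun _ => _) = fun=> 0); first exact: has_derive_cst.
  by apply/funext => y; rewrite big_nil.
rewrite big_cons (_ : (fun _ => _) = fun y => if P i then f i y + \sum_(i <- r | P i) f i y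
  else \sum_(i <- r | P i) f i y); last by apply/funext => y; rewrite big_cons.
by case: ifP => // Pi; apply: has_deriveD => //; exact: H.
Qed.

Lemma has_deriveZr V W (A : set V) (f : V -> R) (w : W) x v l :
  has_derive A f x v l -> has_derive A (fun y => f y *: w) x v (l *: w).
Proof.
rewrite /has_derive => Hf.
rewrite (_ : (fun h : R => _) = fun h : R => (h^-1 *: (f (h *: v + x) - f x)) *: w).
  exact: cvgZr_tmp.
by apply/funext => h /=; rewrite -scalerBl scalerA.
Qed.

Lemma has_deriveN V W (A : set V) (f : V -> W) x v l :
  has_derive A f x v l -> has_derive A (fun y => - f y) x v (- l).
Proof.
move=> /(has_deriveZ (c := -1)); rewrite scaleN1r.
by rewrite (_ : (fun y => -1 *: f y) = (fun y => - f y)) //; apply/funext => y; rewrite scaleN1r.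
Qed.

Lemma has_deriveB V W (A : set V) (f g : V -> W) x v l m :
  has_derive A f x v l -> has_derive A g x v m ->
  has_derive A (fun y => f y - g y) x v (l - m).
Proof. by move=> Hf Hg; apply: has_deriveD => //; exact: has_deriveN. Qed.

Lemma has_derive_dir V W (A : set V) (f : V -> W) x v l (c : R) :
  has_derive A f x v l -> has_derive A f x (c *: v) (c *: l).
Proof.
have [->|c0] := eqVneq c 0.
  move=> _; rewrite !scale0r; apply/has_deriveP => e e0; exists 1 => // h _ _ _.
  by rewrite scaler0 add0r subrr sub0r normrN scaler0 normr0 mulr_ge0 // ltW.
move=> /has_deriveP H; apply/has_deriveP => e e0.
have ec0 : 0 < e / `|c| by rewrite divr_gt0 // normr_gt0.
have [d d0 Hd] := H _ ec0; exists (d / `|c|); first by rewrite divr_gt0 // normr_gt0.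
move=> h h0; rewrite ltr_pdivlMr ?normr_gt0 // -normrM => hd; rewrite !scalerA => Ah.
have := Hd (h * c); rewrite mulf_neq0 // => /(_ isT hd Ah) /le_trans; apply.
by rewrite normrM mulrA mulrAC divfK ?normr_eq0 // lexx.
Qed.

Lemma has_derive_affine V V' W (A : set V) (f : V -> W) (j : V' -> V) x v y l :
  (forall h : R, j (h *: v + x) = h *: y + j x) ->
  has_derive A f (j x) y l -> has_derive (j @^-1` A) (fun z => f (j z)) x v l.
Proof.
move=> jE /has_deriveP H; apply/has_deriveP => e /H[d d0 Hd]; exists d => // h h0 hd /=.
rewrite jE => Ah; exact: Hd.
Qed.

Lemma has_derive_is_derive V W (f : V -> W) x v l :
  has_derive setT f x v l <-> is_derive x v f l.
Proof.
rewrite /has_derive (_ : [set h : R | setT (h *: v + x)] = setT); last by apply/seteqP; split.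
rewrite withinET; split.
  move=> H; apply: DeriveDef; first by apply/cvg_ex; exists l.
  by apply: cvg_lim.
by move=> [dfx <-]; exact: dfx.
Qed.

Lemma has_derive_open V W (A : set V) (f : V -> W) x v l : open A -> A x ->
  has_derive A f x v l <-> is_derive x v f l.
Proof.
move=> /relopen_open oA Ax; rewrite (has_derive_relopen _ _ _ oA) //.
exact: has_derive_is_derive.
Qed.

Lemma derive_in_open V W (A : set V) (f : V -> W) x v : open A -> A x ->
  derive_in A f x v = 'D_v f x.
Proof.
move=> /relopen_open oA Ax; rewrite (derive_in_relopen _ _ oA) // /derive_in.
rewrite (_ : [set h : R | setT (h *: v + x)] = setT); last by apply/seteqP; split.
by rewrite withinET.
Qed.

Lemma Ck_on_cst V W k (A : set V) (c : W) : approachable A -> Ck_on k A (fun=> c).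
Proof.
move=> gA; elim: k c => [|k IH] c.
  by split=> //; apply/subspace_continuousP => x _; exact: cvg_cst.
apply: (@Ck_onS _ _ _ _ _ _ (fun _ _ => 0)) => //.
  by apply/subspace_continuousP => x _; exact: cvg_cst.
by move=> v x _; exact: has_derive_cst.
Qed.

Lemma cont_in_add V W (A : set V) (f g : V -> W) :
  {within A, continuous f} -> {within A, continuous g} ->
  {within A, continuous (fun y => f y + g y)}.
Proof.
move=> /subspace_continuousP cf /subspace_continuousP cg.
by apply/subspace_continuousP => x Ax; apply: cvgD; [exact: cf|exact: cg].
Qed.

Lemma cont_in_mul V (A : set V) (f g : V -> R) :
  {within A, continuous f} -> {within A, continuous g} ->
  {within A, continuous (fun y => f y * g y)}.
Proof.
move=> /subspace_continuousP cf /subspace_continuousP cg.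
by apply/subspace_continuousP => x Ax; apply: cvgM; [exact: cf|exact: cg].
Qed.

Lemma cont_in_scaler V W (A : set V) (f : V -> R) (w : W) :
  {within A, continuous f} -> {within A, continuous (fun y => f y *: w)}.
Proof.
move=> /subspace_continuousP cf.
by apply/subspace_continuousP => x Ax; apply: cvgZr_tmp; exact: cf.
Qed.

Lemma Ck_onD V W k (A : set V) (f g : V -> W) : approachable A ->
  Ck_on k A f -> Ck_on k A g -> Ck_on k A (fun y => f y + g y).
Proof.
move=> gA; elim: k f g => [|k IH] f g Cf Cg.
  by split=> //; refine (cont_in_add (Ck_on_cont Cf) (Ck_on_cont Cg)).
apply: (@Ck_onS _ _ _ _ _ _ (fun v x => derive_in A f x v + derive_in A g x v)) => //.
- refine (cont_in_add (Ck_on_cont Cf) (Ck_on_cont Cg)).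
- by move=> v x Ax; apply: has_deriveD; [exact: (Ck_on_has Cf Ax)|exact: (Ck_on_has Cg Ax)].
- by move=> v; apply: IH; exact: Ck_on_derive.
Qed.

Lemma Ck_on_scaler V W k (A : set V) (f : V -> R) (w : W) : approachable A ->
  Ck_on k A f -> Ck_on k A (fun y => f y *: w).
Proof.
move=> gA; elim: k f => [|k IH] f Cf.
  by split=> //; refine (cont_in_scaler (Ck_on_cont Cf)).
apply: (@Ck_onS _ _ _ _ _ _ (fun v x => derive_in A f x v *: w)) => //.
- refine (cont_in_scaler (Ck_on_cont Cf)).
- by move=> v x Ax; apply: has_deriveZr; exact: (Ck_on_has Cf Ax).
- by move=> v; apply: IH; exact: Ck_on_derive.
Qed.

Lemma Ck_onM V k (A : set V) (f g : V -> R) : approachable A ->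
  Ck_on k A f -> Ck_on k A g -> Ck_on k A (fun y => f y * g y).
Proof.
move=> gA; elim: k f g => [|k IH] f g Cf Cg.
  by split=> //; refine (cont_in_mul (Ck_on_cont Cf) (Ck_on_cont Cg)).
apply: (@Ck_onS _ _ _ _ _ _ (fun v x => derive_in A f x v * g x + f x * derive_in A g x v)) => //.
- refine (cont_in_mul (Ck_on_cont Cf) (Ck_on_cont Cg)).
- by move=> v x Ax; apply: has_deriveM; [exact: (Ck_on_has Cf Ax)|exact: (Ck_on_has Cg Ax)].
- move=> v; apply: Ck_onD => //; apply: IH; by [exact: Ck_on_derive|exact: Ck_onW].
Qed.

Lemma Ck_on_sum V W k (I : Type) (r : seq I) (P : pred I) (A : set V) (f : I -> V -> W) :
  approachable A -> (forall i, P i -> Ck_on k A (f i)) ->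
  Ck_on k A (fun y => \sum_(i <- r | P i) f i y).
Proof.
move=> gA H; elim: r => [|i r IH].
  apply: (@Ck_on_eq _ _ _ _ _ (fun=> 0)); last exact: Ck_on_cst.
  by move=> y _; rewrite big_nil.
apply: (@Ck_on_eq _ _ _ _ _ (fun y => if P i then f i y + \sum_(i <- r | P i) f i y
  else \sum_(i <- r | P i) f i y)); first by move=> y _; rewrite big_cons.
by case: (P i) (H i) => // Hi; apply: Ck_onD => //; exact: Hi.
Qed.

Lemma cont_in_sum V W (I : Type) (r : seq I) (A : set V) (f : I -> V -> W) :
  (forall i, {within A, continuous (f i)}) ->
  {within A, continuous (fun y => \sum_(i <- r) f i y)}.
Proof.
move=> H; elim: r => [|i r IH].
  rewrite (_ : (fun _ => _) = fun=> 0); last by apply/funext => y; rewrite big_nil.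
  by apply/subspace_continuousP => x _; exact: cvg_cst.
rewrite (_ : (fun _ => _) = fun y => f i y + \sum_(i <- r) f i y).
  exact: cont_in_add.
by apply/funext => y; rewrite big_cons.
Qed.

(** Affine maps send increments to increments, so difference quotients correspond exactly. This
    covers slices, projections, translations and reflections. *)
Lemma Ck_on_affine V V' W k (A : set V) (f : V -> W) (j : V' -> V) (dj : V' -> V) :
  approachable (j @^-1` A) -> continuous j ->
  (forall (h : R) v x, j (h *: v + x) = h *: dj v + j x) ->
  Ck_on k A f -> Ck_on k (j @^-1` A) (fun z => f (j z)).
Proof.
move=> gA cj jE.
have cfj (g : V -> W) : {within A, continuous g} -> {within j @^-1` A, continuous (fun z => g (j z))}.
  move=> /subspace_continuousP cg; apply/subspace_continuousP => x Ax P HP.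
  have := cg _ Ax _ HP; rewrite /= /within /= => H.
  exact: (cj x _ H).
elim: k f => [|k IH] f Cf; first by split=> //; refine (cfj _ (Ck_on_cont Cf)).
apply: (@Ck_onS _ _ _ _ _ _ (fun v x => derive_in A f (j x) (dj v))) => //.
- refine (cfj _ (Ck_on_cont Cf)).
- by move=> v x Ax; apply: (has_derive_affine (y := dj v)) => //; exact: (Ck_on_has Cf Ax).
- by move=> v; exact: (IH (fun y => derive_in A f y (dj v)) (Ck_on_derive _ Cf)).
Qed.

(** On the line every increment is a multiple of the direction 1, so here a derivative does imply
    continuity. *)
Lemma has_derive_cont (A : set R) (W : normedModType R) (f : R -> W) (l : R -> W) :
  (forall x, A x -> has_derive A f x 1 (l x)) -> {within A, continuous f}.
Proof.
move=> H; apply/subspace_continuousP => x Ax; apply/cvgrPdist_le => e e0.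
have /has_deriveP /(_ _ ltr01) [d d0 Hd] := H _ Ax.
(* With tolerance 1 in the remainder, [C] bounds the difference quotients near [x]. *)
pose C := `|l x| + 1; have C0 : 0 < C by rewrite ltr_wpDl.
suff : \forall y \near x, A y -> `|f x - f y| <= e by [].
apply/nbhs_ballP; exists (Num.min d (e / C)); first by rewrite /= lt_min d0 divr_gt0.
move=> y /=; rewrite /ball /= lt_min => /andP[yd yC] Ay.
have [->|yx] := eqVneq y x; first by rewrite subrr normr0 ltW.
have := Hd (y - x); rewrite subr_eq0 => /(_ yx); rewrite distrC => /(_ yd).
have -> : (y - x) *: 1 + x = y by rewrite /GRing.scale /= mulr1 subrK.
move=> /(_ Ay); rewrite [X in _ <= 1 * X]distrC => H1; rewrite distrC -[f y - f x](subrK ((y - x) *: l x)).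
apply: le_trans (ler_normD _ _) _; rewrite normrZ.
apply: (@le_trans _ _ (C * `|y - x|)).
  by rewrite mulrDl [leRHS]addrC; apply: lerD => //; rewrite mulrC.
by rewrite mulrC -ler_pdivlMr // distrC ltW.
Qed.

Lemma has_derive_interior (f : R -> R) (t l : R) : 0 < t < 1 ->
  has_derive (@closed_unit R) f t 1 l -> is_derive t 1 f l.
Proof.
move=> t01 H; apply/(@has_derive_open R R^o `]0, 1[%classic) => //.
apply: has_derive_sub H => x; rewrite /= in_itv /= => /andP[x0 x1].
by rewrite /closed_unit /= !ltW.
Qed.

(** The derivatives at 0 and 1 contribute continuity at the end points; inside they are ordinary
    derivatives. *)
Lemma MVT01 (f l : R -> R) :
  (forall t, closed_unit t -> has_derive (@closed_unit R) f t 1 (l t)) ->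
  exists2 t, 0 < t < 1 & f 1 - f 0 = l t.
Proof.
move=> H; have [t] : exists2 t : R, t \in `]0:R, 1[ & f 1 - f 0 = l t * (1 - 0).
  apply: MVT => //.
    move=> t; rewrite in_itv /= => t01; apply: has_derive_interior => //; apply: H.
    by case/andP: t01 => *; rewrite /closed_unit /= !ltW.
  apply: continuous_subspaceW (has_derive_cont H).
  by move=> x; rewrite /= in_itv.
by rewrite in_itv /= subr0 mulr1 => ? ?; exists t.
Qed.

Lemma has_derive_seg V W (A : set V) (f : V -> W) (p w : V) (t : R) l :
  (forall u, closed_unit u -> A (u *: w + p)) ->
  has_derive A f (t *: w + p) w l ->
  has_derive (@closed_unit R) (fun u : R => f (u *: w + p)) t 1 l.
Proof.
move=> HA H.
have : has_derive ((fun u : R => u *: w + p) @^-1` A) (fun u : R => f (u *: w + p)) t 1 l.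
  apply: (has_derive_affine (y := w)) => // h.
  by rewrite scalerDl addrA /GRing.scale /= mulr1.
by apply: has_derive_sub => u; exact: HA.
Qed.

End algebra.

(** * The chain rule in finite dimension *)

Section frames.
Context {R : realType}.
Implicit Types V W : normedModType R.

(* Finite-dimensionality of [E] in the form needed for the chain rule; it is
   used for R, for row vectors and for the jet space ('rV * 'rV) * R. *)
Record frame (E : normedModType R) (I : finType) := Frame {
  fvec : I -> E;
  fcoord : I -> E -> R;
  fcoord_linear : forall i (a : R) x y, fcoord i (a *: x + y) = a * fcoord i x + fcoord i y;
  fcoord_continuous : forall i, continuous (fcoord i);
  fcoordK : forall x, \sum_i fcoord i x *: fvec i = x;
  fbound : R;
  fbound_ge0 : 0 <= fbound;
  fcoord_bound : forall x, \sum_i `|fcoord i x| * `|fvec i| <= fbound * `|x|;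
  fcoord_bound1 : forall x, \sum_i `|fcoord i x| <= fbound * `|x| }.

Section chain.
Variables (E : normedModType R) (I : finType) (fr : frame E I).
Variables (B : set E).
Hypothesis oB : open B.

Lemma segment_estimate (f : E -> R) (p e : E) (d c eps : R) : 0 <= eps ->
  (forall t : R, 0 <= t <= 1 -> B (p + (t * d) *: e)) ->
  Ck_on 1 B f ->
  (forall t : R, 0 <= t <= 1 -> `|derive_in B f (p + (t * d) *: e) e - c| <= eps) ->
  `|f (p + d *: e) - f p - d * c| <= eps * `|d|.
Proof.
move=> eps0 HB Cf Hd.
have jE (t : R) : t *: (d *: e) + p = p + (t * d) *: e by rewrite addrC scalerA.
have [t t01] : exists2 t : R, 0 < t < 1 &
    f (1 *: (d *: e) + p) - f (0 *: (d *: e) + p) = d * derive_in B f (t *: (d *: e) + p) e.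
  apply: (@MVT01 R (fun t => f (t *: (d *: e) + p))
    (fun t => d * derive_in B f (t *: (d *: e) + p) e)) => t t01.
  apply: has_derive_seg; first by move=> u u01; rewrite jE; exact: (HB _ u01).
  apply: has_derive_dir; apply: (Ck_on_has Cf); rewrite jE; exact: (HB _ t01).
rewrite scale1r scale0r add0r [_ + p]addrC => ->.
rewrite -mulrBr normrM mulrC; apply: ler_wpM2r => //.
by rewrite jE; apply: Hd; case/andP: t01 => t0 t1; rewrite !ltW.
Qed.

(** Strict differentiability at [p0]: go from [p] to [q] one frame direction after the other. On
    each leg the partial derivative is within [e1] of its value at [p0], so the errors add up to
    [e1] times the sum of the coordinates of [q - p] in absolute value. *)
Lemma C1_strict (f : E -> R) p0 : Ck_on 1 B f -> B p0 ->
  forall eps, 0 < eps -> exists2 d, 0 < d & forall p q, `|p - p0| < d -> `|q - p0| < d ->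
    `|f q - f p - \sum_i fcoord fr i (q - p) * derive_in B f p0 (fvec fr i)| <= eps * `|q - p|.
Proof.
move=> Cf Bp0 eps eps0.
pose K := fbound fr + 1.
have K0 : 0 < K by rewrite ltr_wpDl // fbound_ge0.
pose e1 := eps / K; have e10 : 0 < e1 by rewrite divr_gt0.
have : \forall p \near p0, B p /\ forall i, `|derive_in B f p (fvec fr i) - derive_in B f p0 (fvec fr i)| <= e1.
  have B1 : \forall p \near p0, B p by exact: open_nbhs_nbhs.
  have H i : \forall p \near p0, `|derive_in B f p (fvec fr i) - derive_in B f p0 (fvec fr i)| <= e1.
    have /subspace_continuousP /(_ _ Bp0) := Ck_on_cont (Ck_on_derive (fvec fr i) Cf).
    move=> /cvgrPdist_le /(_ _ e10); rewrite /within /= => H.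
    have H' : \forall p \near p0, B p ->
        `|derive_in B f p0 (fvec fr i) - derive_in B f p (fvec fr i)| <= e1 by exact: H.
    by move: H' B1; apply: filterS2 => p H1 /H1; rewrite distrC.
  apply: filterI => //; exact: (@filter_forall _ I _ (nbhs p0) _ H).
move=> /nbhs_normP[d /= d0 Hd].
(* Induction over the list of legs. The hypothesis bounds the distance of the start from [p0] plus
   the length still to travel, so every intermediate point stays in the ball of radius [d]. *)
have tele (x : I -> R) (r : seq I) p :
    `|p - p0| + \sum_(i <- r) `|x i| * `|fvec fr i| < d ->
    `|f (p + \sum_(i <- r) x i *: fvec fr i) - f p
      - \sum_(i <- r) x i * derive_in B f p0 (fvec fr i)| <= e1 * \sum_(i <- r) `|x i|.
  elim: r p => [|i r IH] p; first by move=> _; rewrite !big_nil mulr0 subr0 addr0 subrr normr0.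
  rewrite !big_cons => Hp.
  have S0 : 0 <= \sum_(j <- r) `|x j| * `|fvec fr j| by apply: sumr_ge0 => j _; rewrite mulr_ge0.
  have Hseg (t : R) : 0 <= t <= 1 -> `|p + (t * x i) *: fvec fr i - p0| < d.
    move=> /andP[t0 t1]; apply: le_lt_trans Hp; rewrite addrAC.
    apply: le_trans (ler_normD _ _) _; rewrite lerD2l.
    apply: (@le_trans _ _ (`|x i| * `|fvec fr i|)); last by rewrite lerDl.
    rewrite normrZ normrM ler_wpM2r // -[X in _ <= X]mul1r ler_wpM2r //.
    by rewrite ger0_norm.
  have Hd' y : `|y - p0| < d -> B y /\ forall i, `|derive_in B f y (fvec fr i) - derive_in B f p0 (fvec fr i)| <= e1.
    by move=> yd; apply: Hd; rewrite /= distrC.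
  have H1 := @segment_estimate f p (fvec fr i) (x i) (derive_in B f p0 (fvec fr i)) e1
    (ltW e10) (fun t t01 => (Hd' _ (Hseg t t01)).1) Cf (fun t t01 => (Hd' _ (Hseg t t01)).2 i).
  have := IH (p + x i *: fvec fr i).
  have Hp' : `|p + x i *: fvec fr i - p0| + \sum_(i <- r) `|x i| * `|fvec fr i| < d.
    apply: le_lt_trans Hp; rewrite addrA lerD2r addrAC.
    by apply: le_trans (ler_normD _ _) _; rewrite normrZ.
  move=> /(_ Hp') H2; rewrite mulrDr; apply: le_trans (lerD H1 H2).
  apply: le_trans (ler_normD _ _); rewrite le_eqVlt; apply/orP; left; apply/eqP; congr (`|_|).
  rewrite !addrA; set a := f (_ + _ + _); set b := f (_ + _); set u := _ * _; set w := \sum_(_ <- _) _.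
  ring.
(* Then [p] is within [d / 3] of [p0], and the legs have total length at most [K * |q - p|], below
   [2 d / 3]. *)
exists (d / (3 * K)); first by rewrite divr_gt0 // mulr_gt0.
move=> p q pd qd; pose x i := fcoord fr i (q - p).
have qE : p + \sum_i x i *: fvec fr i = q by rewrite fcoordK addrC subrK.
have qpK : `|q - p| * K < d / 3 * 2.
  have -> : q - p = (q - p0) - (p - p0) by rewrite opprB addrA subrK.
  apply: (@le_lt_trans _ _ ((`|q - p0| + `|p - p0|) * K)).
    by apply: ler_wpM2r; [exact: ltW|exact: ler_normB].
  have -> : d / 3 * 2 = (d / (3 * K) + d / (3 * K)) * K by field; rewrite gt_eqF.
  by rewrite ltr_pM2r // ltrD.
have K1 : 1 <= K by rewrite lerDr fbound_ge0.
rewrite -{1}qE; apply: le_trans (tele _ _ _ _) _.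
  rewrite (_ : d = d / 3 + d / 3 * 2); last lra.
  apply: ltrD.
    apply: lt_le_trans pd _; rewrite ler_pdivrMr ?mulr_gt0 // mulrA divfK //.
    by rewrite ler_peMr // ltW.
  apply: le_lt_trans qpK; apply: le_trans (fcoord_bound fr _) _.
  by rewrite mulrC; apply: ler_wpM2l => //; rewrite lerDl.
apply: (@le_trans _ _ (e1 * (fbound fr * `|q - p|))).
  by apply: ler_wpM2l; [exact: ltW|exact: fcoord_bound1].
rewrite mulrA; apply: ler_wpM2r => //.
by rewrite /e1 -mulrA ger_pMr // mulrC ler_pdivrMr // mul1r lerDl.
Qed.

Lemma frame_has_derive V (A : set V) (g : V -> E) x v (l : I -> R) :
  (forall i, has_derive A (fun y => fcoord fr i (g y)) x v (l i)) ->
  has_derive A g x v (\sum_i l i *: fvec fr i).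
Proof.
move=> H; rewrite (_ : g = fun y => \sum_i fcoord fr i (g y) *: fvec fr i).
  by apply: has_derive_sum => i _; exact: has_deriveZr.
by apply/funext => y; rewrite fcoordK.
Qed.

(** Subtract from [f] its linearization at [g x]: the remainder [r] has derivative 0 by strict
    differentiability, and the linear part is differentiated coordinate by coordinate. *)
Lemma has_derive_chain V (A : set V) (g : V -> E) x v (l : I -> R) (f : E -> R) :
  Ck_on 1 B f -> B (g x) ->
  (forall i, has_derive A (fun y => fcoord fr i (g y)) x v (l i)) ->
  has_derive A (fun y => f (g y)) x v (\sum_i l i * derive_in B f (g x) (fvec fr i)).
Proof.
move=> Cf Bgx Hg; pose D i := derive_in B f (g x) (fvec fr i).
pose r y := f (g y) - \sum_i fcoord fr i (g y) * D i.
have Hr : has_derive A r x v 0.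
  apply/has_deriveP => e e0.
  pose L := \sum_i l i *: fvec fr i; pose C := `|L| + 1.
  have C0 : 0 < C by rewrite ltr_wpDl.
  have [d d0 Hd] := C1_strict Cf Bgx (divr_gt0 e0 C0).
  have /has_deriveP /(_ _ ltr01) [d1 d10 Hd1] := frame_has_derive Hg.
  exists (Num.min d1 (d / C)); first by rewrite lt_min d10 divr_gt0.
  move=> h h0; rewrite lt_min => /andP[hd1 hd2] Ah; rewrite scaler0 subr0.
  have gC : `|g (h *: v + x) - g x| <= C * `|h|.
    rewrite -[g _ - g x](subrK (h *: L)); apply: le_trans (ler_normD _ _) _.
    by rewrite normrZ mulrDl addrC [`|L| * _]mulrC lerD2l Hd1.
  have := Hd (g x) (g (h *: v + x)); rewrite subrr normr0 d0 => /(_ isT).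
  have -> : `|g (h *: v + x) - g x| < d.
    by apply: le_lt_trans gC _; rewrite mulrC -ltr_pdivlMr.
  move=> /(_ isT) H1.
  have -> : r (h *: v + x) - r x = f (g (h *: v + x)) - f (g x) -
      \sum_i fcoord fr i (g (h *: v + x) - g x) * derive_in B f (g x) (fvec fr i).
    have -> : \sum_i fcoord fr i (g (h *: v + x) - g x) * derive_in B f (g x) (fvec fr i) =
      \sum_i fcoord fr i (g (h *: v + x)) * D i - \sum_i fcoord fr i (g x) * D i.
      rewrite -sumrB; apply: eq_bigr => i _.
      have -> : g (h *: v + x) - g x = (-1) *: g x + g (h *: v + x).
        by rewrite scaleN1r addrC.
      rewrite fcoord_linear -/(D i); ring.
    rewrite /r; set a := \sum_i _; set b := \sum_i _; ring.
  apply: le_trans H1 _; apply: (@le_trans _ _ (e / C * (C * `|h|))).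
    by apply: ler_wpM2l => //; rewrite divr_ge0 // ltW.
  by rewrite mulrA divfK // gt_eqF.
have -> : (fun y => f (g y)) = fun y => r y + \sum_i fcoord fr i (g y) * D i.
  by apply/funext => y; rewrite subrK.
rewrite -[X in has_derive _ _ _ _ X]add0r; apply: has_deriveD => //.
by apply: has_derive_sum => i _; apply: has_deriveZr.
Qed.

Lemma frame_cont V (A : set V) (g : V -> E) :
  (forall i, {within A, continuous (fun y => fcoord fr i (g y))}) -> {within A, continuous g}.
Proof.
move=> H; rewrite (_ : g = fun y => \sum_i fcoord fr i (g y) *: fvec fr i); last first.
  by apply/funext => y; rewrite fcoordK.
by apply: cont_in_sum => i; apply: cont_in_scaler; exact: H.
Qed.

Lemma cont_in_comp V (T : topologicalType) (A : set V) (g : V -> E) (f : E -> T) :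
  (forall x, A x -> B (g x)) -> {within A, continuous g} -> {within B, continuous f} ->
  {within A, continuous (fun y => f (g y))}.
Proof.
move=> AB /subspace_continuousP cg; rewrite continuous_open_subspace // => cf.
apply/subspace_continuousP => x Ax; apply: (cvg_comp g f (cg _ Ax)).
by apply: cf; rewrite inE; exact: AB.
Qed.

(** The derivative is a sum of products of derivatives of coordinates of [g] with partial
    derivatives of [f] composed with [g]; hence the induction is over all [f] at once. *)
Lemma Ck_on_chain k V (A : set V) (g : V -> E) (f : E -> R) :
  approachable A -> (forall x, A x -> B (g x)) ->
  (forall i, Ck_on k A (fun y => fcoord fr i (g y))) -> Ck_on k B f ->
  Ck_on k A (fun y => f (g y)).
Proof.
move=> gA AB; elim: k f => [|k IH] f Cg Cf.
  split=> //; apply: cont_in_comp (Ck_on_cont Cf) => //.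
  by apply: frame_cont => i; exact: Ck_on_cont (Cg i).
have Cf1 : Ck_on 1 B f.
  by elim: (k) Cf => // m IHm /Ck_onW.
apply: (@Ck_onS _ _ _ _ _ _ (fun v x => \sum_i derive_in A (fun y => fcoord fr i (g y)) x v
   * derive_in B f (g x) (fvec fr i))) => //.
- apply: cont_in_comp (Ck_on_cont Cf) => //.
  by apply: frame_cont => i; exact: Ck_on_cont (Cg i).
- move=> v x Ax; apply: has_derive_chain => //; first exact: AB.
  by move=> i; exact: (Ck_on_has (Cg i) Ax).
- move=> v; apply: Ck_on_sum => // i _; apply: Ck_onM => //.
    exact: Ck_on_derive (Cg i).
  apply: (IH (fun z => derive_in B f z (fvec fr i))).
    by move=> j; apply: Ck_onW.
  exact: Ck_on_derive.
Qed.

End chain.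
End frames.

(** * Frames of the line, of row vectors and of the jet space *)

Section frame_instances.
Context {R : realType}.

Section make_frame.
Variables (E : normedModType R) (I : finType) (e : I -> E) (c : I -> E -> R).
Hypothesis c_linear : forall i (a : R) x y, c i (a *: x + y) = a * c i x + c i y.
Hypothesis c_continuous : forall i, continuous (c i).
Hypothesis cK : forall x, \sum_i c i x *: e i = x.
Hypothesis c_bound : forall i x, `|c i x| <= `|x|.

(** Adding 1 to each norm lets one constant serve for both bounds of a frame. *)
Let M := \sum_i (`|e i| + 1).

Lemma make_frame_ge0 : 0 <= M.
Proof. by apply: sumr_ge0 => i _; rewrite addr_ge0. Qed.

Lemma make_frame_bound x : \sum_i `|c i x| * `|e i| <= M * `|x|.
Proof.
rewrite mulr_suml; apply: ler_sum => i _; rewrite mulrC.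
by apply: ler_pM => //; rewrite lerDl.
Qed.

Lemma make_frame_bound1 x : \sum_i `|c i x| <= M * `|x|.
Proof.
rewrite mulr_suml; apply: ler_sum => i _; rewrite -[leLHS]mul1r.
by apply: ler_pM => //; rewrite lerDr.
Qed.

Definition make_frame : frame E I :=
  Frame c_linear c_continuous cK make_frame_ge0 make_frame_bound make_frame_bound1.
End make_frame.

Lemma real_coord_linear (i : unit) (a : R) (x y : R^o) : idfun (a *: x + y) = a * idfun x + idfun y.
Proof. by []. Qed.

Lemma real_coord_continuous (i : unit) : continuous (idfun : R^o -> R).
Proof. by move=> x; exact: cvg_id. Qed.

Lemma real_coordK (x : R^o) : \sum_(i : unit) idfun x *: (1 : R^o) = x.
Proof. by rewrite (bigD1 tt) //= big1 ?addr0 /GRing.scale /= ?mulr1 // => -[]. Qed.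

Lemma real_coord_bound (i : unit) (x : R^o) : `|idfun x : R| <= `|x|.
Proof. by []. Qed.

Definition real_frame : frame R^o unit :=
  @make_frame R^o unit (fun=> (1:R)) (fun=> idfun) real_coord_linear real_coord_continuous real_coordK real_coord_bound.

Section rows.
Variable n : nat.
Local Notation rV := ('rV[R]_n).

Lemma row_coord_linear (i : 'I_n) (a : R) (x y : rV) :
  (a *: x + y) ord0 i = a * x ord0 i + y ord0 i.
Proof. by rewrite !mxE. Qed.

Lemma row_coord_continuous (i : 'I_n) : continuous (fun x : rV => x ord0 i).
Proof. exact: matrix_normedtype.coord_continuous. Qed.

Lemma row_coordK (x : rV) : \sum_i x ord0 i *: delta_mx ord0 i = x.
Proof. by rewrite -row_sum_delta. Qed.

Lemma row_coord_bound (i : 'I_n) (x : rV) : `|x ord0 i| <= `|x|.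
Proof.
rewrite [leRHS]/Num.Def.normr/= mx_normrE.
exact: (le_bigmax _ (fun ij : 'I_1 * 'I_n => `|x ij.1 ij.2|) (ord0, i)).
Qed.

Definition row_frame : frame rV 'I_n :=
  make_frame row_coord_linear row_coord_continuous row_coordK row_coord_bound.

Local Notation E := (rV * rV * R)%type.

Definition jet_vec (i : 'I_n + 'I_n + unit) : E :=
  match i with
  | inl (inl i) => (delta_mx ord0 i, 0, 0)
  | inl (inr i) => (0, delta_mx ord0 i, 0)
  | inr _ => (0, 0, 1)
  end.

Definition jet_coord (i : 'I_n + 'I_n + unit) (p : E) : R :=
  match i with
  | inl (inl i) => p.1.1 ord0 i
  | inl (inr i) => p.1.2 ord0 i
  | inr _ => p.2
  end.

Lemma jet_coord_linear i (a : R) (x y : E) :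
  jet_coord i (a *: x + y) = a * jet_coord i x + jet_coord i y.
Proof. by case: i => [[i|i]|[]] /=; rewrite ?mxE. Qed.

Lemma jet_coord_continuous i : continuous (jet_coord i).
Proof.
case: i => [[i|i]|[]] p /=.
- apply: (cvg_comp (fun p : E => p.1.1) (fun x : rV => x ord0 i)); last exact: row_coord_continuous.
  apply: (cvg_comp (fun p : E => p.1) (fun x : rV * rV => x.1)); exact: cvg_fst.
- apply: (cvg_comp (fun p : E => p.1.2) (fun x : rV => x ord0 i)); last exact: row_coord_continuous.
  apply: (cvg_comp (fun p : E => p.1) (fun x : rV * rV => x.2)); [exact: cvg_fst|exact: cvg_snd].
- exact: cvg_snd.
Qed.

Lemma sum_jet (W : nmodType) (F : 'I_n + 'I_n + unit -> W) :
  \sum_i F i = \sum_i F (inl (inl i)) + \sum_i F (inl (inr i)) + F (inr tt).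
Proof.
rewrite big_sumType /= big_sumType /=; congr (_ + _).
by rewrite (bigD1 tt) //= big1 ?addr0 // => -[].
Qed.

Lemma jet_scale (a : R) (x y : rV) (z : R) :
  a *: (x, y, z) = (a *: x, a *: y, a * z) :> E.
Proof. by []. Qed.

Lemma jet_add (x y x' y' : rV) (z z' : R) :
  (x, y, z) + (x', y', z') = (x + x', y + y', z + z') :> E.
Proof. by []. Qed.

Lemma jet_coordK x : \sum_i jet_coord i x *: jet_vec i = x.
Proof.
rewrite sum_jet /=; case: x => -[a b] z /=.
have H1 (r : seq 'I_n) : \sum_(i <- r) a ord0 i *: (delta_mx ord0 i, 0 : rV, 0 : R) =
    (\sum_(i <- r) a ord0 i *: delta_mx ord0 i, 0, 0) :> E.
  elim: r => [|i r IH]; first by rewrite !big_nil.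
  by rewrite !big_cons IH jet_scale jet_add !scaler0 mulr0 !addr0.
have H2 (r : seq 'I_n) : \sum_(i <- r) b ord0 i *: (0 : rV, delta_mx ord0 i, 0 : R) =
    (0, \sum_(i <- r) b ord0 i *: delta_mx ord0 i, 0) :> E.
  elim: r => [|i r IH]; first by rewrite !big_nil.
  by rewrite !big_cons IH jet_scale jet_add !scaler0 mulr0 !addr0.
rewrite H1 H2 !row_coordK jet_scale !jet_add !scaler0 mulr1.
by rewrite !addr0 !add0r.
Qed.

Lemma jet_coord_bound i x : `|jet_coord i x| <= `|x|.
Proof.
rewrite prod_normE /= prod_normE /= !le_max; case: i => [[i|i]|[]] /=.
- by rewrite row_coord_bound.
- by rewrite row_coord_bound orbT.
- by rewrite lexx orbT.
Qed.

Definition jet_frame : frame (rV * rV * R)%type ('I_n + 'I_n + unit)%type :=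
  make_frame jet_coord_linear jet_coord_continuous jet_coordK jet_coord_bound.

End rows.
End frame_instances.

(** * Vector-valued functions, coordinate by coordinate *)

Section vector_chain.
Context {R : realType}.
Implicit Types V W : normedModType R.
Variables (E : normedModType R) (I : finType) (fr : frame E I).

Lemma fcoord0 i : fcoord fr i 0 = 0.
Proof.
have := fcoord_linear fr i 1 0 0; rewrite scale1r mul1r addr0 => /esym/eqP.
by rewrite -subr_eq0 addrK => /eqP.
Qed.

Lemma fcoordZ i (a : R) x : fcoord fr i (a *: x) = a * fcoord fr i x.
Proof. by have := fcoord_linear fr i a x 0; rewrite fcoord0 !addr0. Qed.

Lemma fcoordB i x y : fcoord fr i (x - y) = fcoord fr i x - fcoord fr i y.
Proof. by have := fcoord_linear fr i (-1) y x; rewrite scaleN1r mulN1r addrC => ->; rewrite addrC. Qed.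

Lemma has_derive_coord V (A : set V) (g : V -> E) x v l i :
  has_derive A g x v l -> has_derive A (fun y => fcoord fr i (g y)) x v (fcoord fr i l).
Proof.
rewrite /has_derive => H.
rewrite (_ : (fun h : R => _) = fun h : R => fcoord fr i (h^-1 *: (g (h *: v + x) - g x))).
  by apply: (cvg_comp _ (fcoord fr i) H); exact: fcoord_continuous.
by apply/funext => h; rewrite fcoordZ fcoordB.
Qed.

Lemma cont_in_coord V (A : set V) (g : V -> E) i :
  {within A, continuous g} -> {within A, continuous (fun y => fcoord fr i (g y))}.
Proof.
move=> /subspace_continuousP cg; apply/subspace_continuousP => x Ax.
by apply: (cvg_comp _ (fcoord fr i) (cg _ Ax)); exact: fcoord_continuous.
Qed.

Lemma Ck_on_coord V k (A : set V) (g : V -> E) i : approachable A ->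
  Ck_on k A g -> Ck_on k A (fun y => fcoord fr i (g y)).
Proof.
move=> gA; elim: k g => [|k IH] g Cg.
  by split=> //; refine (cont_in_coord (Ck_on_cont Cg)).
apply: (@Ck_onS _ _ _ _ _ _ (fun v x => fcoord fr i (derive_in A g x v))) => //.
- refine (cont_in_coord (Ck_on_cont Cg)).
- by move=> v x Ax; apply: has_derive_coord; exact: (Ck_on_has Cg Ax).
- by move=> v; exact: (IH _ (Ck_on_derive v Cg)).
Qed.

Lemma Ck_on_frame V k (A : set V) (g : V -> E) : approachable A ->
  (forall i, Ck_on k A (fun y => fcoord fr i (g y))) -> Ck_on k A g.
Proof.
move=> gA H; apply: (@Ck_on_eq _ _ _ _ _ (fun y => \sum_i fcoord fr i (g y) *: fvec fr i)).
  by move=> y _; rewrite fcoordK.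
by apply: Ck_on_sum => // i _; exact: Ck_on_scaler.
Qed.

End vector_chain.

Section outer.
Context {R : realType}.
Implicit Types V W : normedModType R.
Variables (E : normedModType R) (I : finType) (fr : frame E I).
Variables (F : normedModType R) (J : finType) (fr' : frame F J).
Variable B : set E.
Hypothesis oB : open B.

(** Linearity in the direction for C^1 functions: the chain rule with the identity as inner map. *)
Lemma derive_in_sum (f : E -> R) p v : Ck_on 1 B f -> B p ->
  derive_in B f p v = \sum_i fcoord fr i v * derive_in B f p (fvec fr i).
Proof.
move=> Cf Bp; apply: approachable_lim => //; first exact: approachable_open.
apply: (@has_derive_chain _ _ _ fr _ oB _ B id) => // i; apply: has_derive_coord.
apply/has_deriveP => e e0; exists 1 => // h _ _ _.
by rewrite addrK subrr normr0 mulr_ge0 // ltW.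
Qed.

Lemma has_derive_comp V (A : set V) (g : V -> E) (f : E -> F) x v l :
  Ck_on 1 B f -> B (g x) -> has_derive A g x v l ->
  has_derive A (fun y => f (g y)) x v (derive_in B f (g x) l).
Proof.
move=> Cf Bgx Hg; rewrite -[X in has_derive _ _ _ _ X](fcoordK fr').
apply: (@frame_has_derive _ _ _ fr') => j.
have gB := approachable_open oB.
rewrite -(approachable_lim gB Bgx (has_derive_coord (fr := fr') (i := j) (Ck_on_has Cf Bgx))).
rewrite derive_in_sum //; last exact: (Ck_on_coord fr').
apply: (@has_derive_chain _ _ _ fr _ oB _ A g (x) v (fun i => fcoord fr i l)
  (fun y => fcoord fr' j (f y))) => //; first exact: (Ck_on_coord fr').
by move=> i; exact: has_derive_coord.
Qed.

Lemma derive_in_comp V (A : set V) (g : V -> E) (f : E -> F) x v :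
  approachable A -> A x -> Ck_on 1 B f -> B (g x) -> derivable_in A g x v ->
  derive_in A (fun y => f (g y)) x v = derive_in B f (g x) (derive_in A g x v).
Proof.
by move=> gA Ax Cf Bgx Hg; apply: approachable_lim => //; exact: has_derive_comp.
Qed.

Lemma Ck_on_comp V k (A : set V) (g : V -> E) (f : E -> F) :
  approachable A -> (forall x, A x -> B (g x)) -> Ck_on k A g -> Ck_on k B f ->
  Ck_on k A (fun y => f (g y)).
Proof.
move=> gA AB Cg Cf; apply: (Ck_on_frame (fr := fr')) => // j.
apply: (@Ck_on_chain _ _ _ fr _ oB k _ A g (fun y => fcoord fr' j (f y))) => //.
  by move=> i; exact: Ck_on_coord.
by apply: (Ck_on_coord fr') => //; exact: approachable_open.
Qed.

End outer.

(** * Functions on ]-e, e[ x [0, 1] *)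

Section strips.
Context {R : realType}.
Implicit Types V W : normedModType R.

Lemma approachable_criterion V (A : set V) :
  (forall x v, A x -> forall e : R, 0 < e -> exists h, [/\ h != 0, `|h| < e & A (h *: v + x)]) ->
  approachable A.
Proof.
move=> H x v Ax; split; last exact: within_filter.
rewrite /within /= => -[d /= d0 Hd].
have [h [h0 hd Ah]] := H x v Ax d d0.
by have := Hd h; rewrite /ball_ /= sub0r normrN => /(_ hd h0 Ah).
Qed.

Lemma approachable_preimage V V' (A : set V) (j : V' -> V) (dj : V' -> V) :
  (forall (h : R) v x, j (h *: v + x) = h *: dj v + j x) ->
  approachable A -> approachable (j @^-1` A).
Proof.
move=> jE gA x v Ax; rewrite (_ : [set h | _] = [set h | A (h *: dj v + j x)]); first exact: gA.
by apply/seteqP; split => h /=; rewrite jE.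
Qed.

Lemma relopen_comp V V' (A B : set V) (j : V' -> V) :
  continuous j -> relopen A B -> relopen (j @^-1` A) (j @^-1` B).
Proof.
move=> cj [BA oB]; split; first by move=> x /BA.
move=> x Bx; have H : \forall y \near j x, A y -> B y by exact: (oB _ Bx).
exact: (cj x _ H).
Qed.

(** A point of [[0, 1]] can always be moved towards the farther half of the interval; the sign of
    the step depends on that of [v]. *)
Lemma approachable_unit : approachable (@closed_unit R).
Proof.
apply: approachable_criterion => x v /= /andP[x0 x1] e e0.
have v0 : 0 < 2 * (`|v| + 1) by rewrite mulr_gt0 // ltr_wpDl.
(* The second bound makes [|t * v|] at most 1/2, so a step away from the nearer end cannot
   overshoot. *)
pose t := Num.min (e / 2) (2 * (`|v| + 1))^-1.
have t0 : 0 < t by rewrite lt_min divr_gt0 // invr_gt0.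
have te : t < e by rewrite gt_min ltr_pdivrMr // ltr_pMr // ltr1n.
have tv : t * `|v| <= 2^-1.
  apply: (@le_trans _ _ ((2 * (`|v| + 1))^-1 * (`|v| + 1))).
    by apply: ler_pM => //; [exact: ltW|rewrite ge_min lexx orbT|rewrite lerDl].
  by rewrite invfM -mulrA mulVf ?mulr1 // gt_eqF // ltr_wpDl.
have tvabs : `|t * v| <= 2^-1 by rewrite normrM gtr0_norm.
have := tvabs; rewrite ler_norml => /andP[tv1 tv2].
have tE (c : R) : c *: v + x = c * v + x by [].
have [x2|x2] := leP x 2^-1; have [vs|vs] := leP 0 (t * v).
- exists t; rewrite gt_eqF // gtr0_norm //; split=> //=; rewrite tE /closed_unit /=; lra.
- exists (- t); rewrite oppr_eq0 normrN gt_eqF // gtr0_norm //; split=> //=; rewrite tE /closed_unit /= mulNr; lra.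
- exists (- t); rewrite oppr_eq0 normrN gt_eqF // gtr0_norm //; split=> //=; rewrite tE /closed_unit /= mulNr; lra.
- exists t; rewrite gt_eqF // gtr0_norm //; split=> //=; rewrite tE /closed_unit /=; lra.
Qed.

(** The strip without bounds on [s]. Being the preimage of [[0, 1]] under a linear map it inherits
    approachability, which then passes to strips as relatively open subsets. *)
Definition band : set (R * R) := snd @^-1` (@closed_unit R).

Lemma approachable_band : approachable band.
Proof. exact: (@approachable_preimage _ _ _ snd snd _ approachable_unit). Qed.

Lemma strip_relopen (e : R) : relopen band (strip e).
Proof.
have -> : strip e = band `&` [set p : R * R | - e < p.1 < e].
  by apply/seteqP; split => p /= [].
apply: relopenIo.
have -> : [set p : R * R | - e < p.1 < e] = fst @^-1` `]- e, e[%classic.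
  by apply/seteqP; split => p /=; rewrite in_itv.
by apply: open_comp; [move=> p _; exact: cvg_fst|exact: itv_open].
Qed.

Lemma approachable_strip (e : R) : approachable (strip e).
Proof. exact: approachable_relopen (strip_relopen e) approachable_band. Qed.

Definition slice (A : set (R * R)) (s : R) : set R := [set t | A (s, t)].

Lemma slice_continuous (s : R) : continuous (fun t : R => (s, t)).
Proof.
move=> t; apply: (@cvg_pair _ _ _ (nbhs t) (nbhs s) (nbhs t) _ _ _ (fun=> s) id).
  exact: cvg_cst.
exact: cvg_id.
Qed.

Lemma slice_affine (s : R) (h v x : R) : (s, h *: v + x) = h *: (0, v) + (s, x) :> R * R.
Proof. by apply/pair_eqP; rewrite /= scaler0 add0r !eqxx. Qed.

Lemma slice_relopen (e s : R) (A : set (R * R)) : - e < s < e -> relopen (strip e) A ->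
  relopen (@closed_unit R) (slice A s).
Proof.
move=> se AS; have := relopen_comp (@slice_continuous s) AS.
suff -> : (fun t : R => (s, t)) @^-1` strip e = closed_unit (R := R) by [].
by apply/seteqP; split => t /=; [case|split].
Qed.

Lemma Ck_on_slice (e s : R) W k (A : set (R * R)) (f : R * R -> W) :
  - e < s < e -> relopen (strip e) A -> Ck_on k A f ->
  Ck_on k (slice A s) (fun t => f (s, t)).
Proof.
move=> se AS Cf; apply: (@Ck_on_affine _ _ _ _ _ A f (fun t => (s, t)) (fun v => (0, v))) => //.
- by apply: approachable_relopen (slice_relopen se AS) approachable_unit.
- exact: slice_continuous.
- by move=> h v x; exact: slice_affine.
Qed.

Lemma has_derive_slice (e s t : R) W (A : set (R * R)) (f : R * R -> W) l :
  - e < s < e -> relopen (strip e) A -> A (s, t) -> has_derive A f (s, t) (0, 1) l ->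
  has_derive (@closed_unit R) (fun t => f (s, t)) t 1 l.
Proof.
move=> se AS Ast H.
rewrite -(has_derive_relopen _ _ _ (slice_relopen se AS)) //.
by apply: (@has_derive_affine _ _ _ _ A f (fun t => (s, t)) t 1 (0, 1)) => // h; exact: slice_affine.
Qed.

Lemma has_derive_fst (e s t : R) W (A : set (R * R)) (f : R * R -> W) l :
  relopen (strip e) A -> A (s, t) -> has_derive A f (s, t) (1, 0) l ->
  is_derive s 1 (fun s => f (s, t)) l.
Proof.
move=> AS Ast; rewrite (has_derive_relopen _ _ _ AS) // => H.
have [se t01] : strip e (s, t) by case: AS => + _; exact.
apply/(@has_derive_open R R^o W `]- e, e[%classic); [exact: itv_open|by rewrite /= in_itv|].
have jE (h : R) : (h *: (1 : R) + s, t) = h *: (1, 0) + (s, t) :> R * R.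
  by apply/pair_eqP; rewrite /= scaler0 add0r !eqxx.
have := @has_derive_affine _ _ _ _ _ f (fun s => (s, t)) s 1 (1, 0) l jE H.
by apply: has_derive_sub => u /=; rewrite in_itv /= => ue; split.
Qed.

Lemma has_derive_snd (e s t : R) W (f : R * R -> W) l :
  strip e (s, t) -> has_derive (@closed_unit R) (fun t => f (s, t)) t 1 l ->
  has_derive (strip e) f (s, t) (0, 1) l.
Proof.
move=> st /has_deriveP H; apply/has_deriveP => eps /H [d d0 Hd].
exists d => // h h0 hd; rewrite -[in X in strip e X](slice_affine s h 1 t) => -[_ Ah].
by have := Hd h h0 hd Ah; rewrite -slice_affine.
Qed.

Lemma Ck_on_time W k (B : set R) (f : R -> W) : relopen (@closed_unit R) B -> Ck_on k B f ->
  Ck_on k [set p : R * R | B p.2] (fun p => f p.2).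
Proof.
move=> BU Cf; apply: (@Ck_on_affine _ _ _ _ _ B f snd snd) => //.
  apply: approachable_preimage (approachable_relopen BU approachable_unit).
  by [].
by move=> p; exact: cvg_snd.
Qed.

Lemma time_relopen (e : R) (B : set R) : relopen (@closed_unit R) B ->
  relopen (strip e) [set p | strip e p /\ B p.2].
Proof.
move=> BU.
have H : relopen band (snd @^-1` B).
  by apply: relopen_comp BU => p; exact: cvg_snd.
apply: relopen_sub (relopenI (strip_relopen e) H) _ _ => // p [] //.
Qed.

End strips.

(** * Partial derivatives on strips *)

Section partials.
Context {R : realType}.

Lemma pairZD (h a b s t : R) : h *: (a, b) + (s, t) = (h * a + s, h * b + t) :> R * R.
Proof. by []. Qed.

Lemma cont_withinP (V : normedModType R) (A : set V) (f : V -> R) x : A x ->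
  {within A, continuous f} -> forall e, 0 < e -> exists2 d, 0 < d &
  forall y, A y -> `|y - x| < d -> `|f y - f x| < e.
Proof.
move=> Ax /subspace_continuousP /(_ _ Ax) /cvgrPdist_lt H e e0.
have H' : \forall y \near x, A y -> `|f x - f y| < e by exact: (H e e0).
move: H' => /nbhs_ballP[d /= d0 Hd]; exists d => // y Ay yd.
rewrite distrC; apply: Hd => //; rewrite -ball_normE /ball_ /= distrC //.
Qed.

Lemma norm_pair_lt (a b d : R) : (`|(a, b) : R * R| < d) = (`|a| < d) && (`|b| < d).
Proof. by rewrite prod_normE /= gt_max. Qed.

(** Move first in [t] and then in [s]. The first increment is governed by the derivative at the base
    point; the second is, by the mean value theorem, a value of [fs] at a nearby point, where
    continuity of [fs] applies. *)
Lemma strip_partials (e : R) (f fs ft : R * R -> R) :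
  (forall p, strip e p -> has_derive (strip e) f p (1, 0) (fs p)) ->
  (forall p, strip e p -> has_derive (strip e) f p (0, 1) (ft p)) ->
  {within strip e, continuous fs} ->
  forall v p, strip e p -> has_derive (strip e) f p v (v.1 * fs p + v.2 * ft p).
Proof.
move=> Hs Ht cs [v1 v2] [s t] st /=; apply/has_deriveP => eps eps0.
have Ht2 : has_derive (strip e) f (s, t) (0, v2) (v2 * ft (s, t)).
  have -> : (0, v2) = v2 *: (0, 1) :> R * R by rewrite -[RHS]addr0 pairZD mulr0 mulr1 !addr0.
  exact: has_derive_dir (Ht _ st).
have e2 : 0 < eps / 2 by rewrite divr_gt0.
have /has_deriveP /(_ _ e2) [d1 d10 Hd1] := Ht2.
pose N := `|v1| + `|v2| + 1.
have N0 : 0 < N by rewrite ltr_wpDl.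
have [d2 d20 Hd2] := cont_withinP st cs (divr_gt0 e2 N0).
have [se t01] := st; rewrite /= in se.
have [d3 d30 Hd3] : exists2 d3, 0 < d3 & forall a, `|a| < d3 -> - e < a + s < e.
  exists (Num.min (s + e) (e - s)); first by case/andP: se => *; rewrite lt_min; apply/andP; split; lra.
  move=> a; rewrite lt_min ltr_norml => /andP[/andP[? ?]]; rewrite ltr_norml => /andP[? ?].
  by apply/andP; split; lra.
(* Since [N] exceeds both components of [v], these bounds keep the increments below [d2], for
   continuity of [fs], and below [d3], for staying between [- e] and [e]. *)
exists (Num.min d1 (Num.min (d2 / N) (d3 / N))).
  by rewrite !lt_min d10 !divr_gt0.
move=> h h0; rewrite !lt_min => /and3P[hd1 hd2 hd3]; rewrite pairZD => -[/= hse ht01].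
have hv2 : strip e (h * 0 + s, h * v2 + t) by split=> //=; rewrite mulr0 add0r.
have := Hd1 h h0 hd1; rewrite pairZD mulr0 add0r => H1.
have {}H1 := H1 (conj se ht01).
pose p : R * R := (s, h * v2 + t).
have small c : `|h| < c / N -> `|h * v1| < c /\ `|h * v2| < c.
  rewrite ltr_pdivlMr // => hN; rewrite !normrM.
  have : 0 < `|h| by rewrite normr_gt0.
  have n1 : 0 <= `|v1| by []. have n2 : 0 <= `|v2| by [].
  by move: hN; rewrite /N => hN h1; split; nra.
have [h31 _] := small _ hd3; have [h21 h22] := small _ hd2.
have seg (u : R) : closed_unit u -> `|u * (h * v1)| <= `|h * v1|.
  move=> /andP[u0 u1]; rewrite normrM -[leRHS]mul1r; apply: ler_wpM2r => //.
  by rewrite ger0_norm.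
have segS (u : R) : closed_unit u -> strip e (u *: (h * v1, 0) + p).
  move=> u01; rewrite /p pairZD mulr0 add0r; split=> //=; apply: Hd3.
  exact: le_lt_trans (seg _ u01) h31.
have dirS q : strip e q -> has_derive (strip e) f q (h * v1, 0) (h * v1 * fs q).
  move=> Sq; have -> : (h * v1, 0) = (h * v1) *: (1, 0) :> R * R.
    by rewrite -[RHS]addr0 pairZD mulr0 mulr1 !addr0.
  exact: has_derive_dir (Hs _ Sq).
have [u u01 MV] : exists2 u : R, 0 < u < 1 &
    f (1 *: (h * v1, 0) + p) - f (0 *: (h * v1, 0) + p) = h * v1 * fs (u *: (h * v1, 0) + p).
  apply: (@MVT01 _ (fun u => f (u *: (h * v1, 0) + p)) (fun u => h * v1 * fs (u *: (h * v1, 0) + p))).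
  move=> u u01; apply: (@has_derive_seg _ _ _ (strip e)) => //.
  exact: dirS (segS _ u01).
have u01' : closed_unit u by case/andP: u01 => *; rewrite /closed_unit /= !ltW.
have := Hd2 _ (segS _ u01').
have -> : `|u *: (h * v1, 0) + p - (s, t)| < d2.
  rewrite /p pairZD mulr0 add0r (_ : _ - _ = (u * (h * v1), h * v2)).
    by rewrite norm_pair_lt h22 (le_lt_trans (seg _ u01')).
  by apply/pair_eqP; rewrite /= !addrK !eqxx.
move=> /(_ isT); set F := fs (_ + _) => HF.
move: MV; rewrite -/F /p !pairZD mul1r !mul0r !mulr0 !add0r => MV.
have -> : f (h * v1 + s, h * v2 + t) - f (s, t) - h *: (v1 * fs (s, t) + v2 * ft (s, t)) =
   h * v1 * (F - fs (s, t)) + (f (s, h * v2 + t) - f (s, t) - h *: (v2 * ft (s, t))).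
  by rewrite mulrBr -MV /GRing.scale /=; ring.
apply: le_trans (ler_normD _ _) _.
have -> : eps * `|h| = eps / 2 * `|h| + eps / 2 * `|h| by field.
apply: lerD => //; rewrite !normrM -mulrA [leRHS]mulrC; apply: ler_wpM2l => //.
apply: (@le_trans _ _ (N * (eps / 2 / N))).
  by apply: ler_pM => //; [rewrite /N -addrA lerDl addr_ge0|exact: ltW].
by rewrite mulrC divfK // gt_eqF.
Qed.

Lemma Ck_on_stripS (e : R) (f fs ft : R * R -> R) k :
  {within strip e, continuous f} ->
  (forall p, strip e p -> has_derive (strip e) f p (1, 0) (fs p)) ->
  (forall p, strip e p -> has_derive (strip e) f p (0, 1) (ft p)) ->
  Ck_on k (strip e) fs -> Ck_on k (strip e) ft -> Ck_on k.+1 (strip e) f.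
Proof.
move=> cf Hs Ht Cs Ct.
apply: (@Ck_onS _ _ _ _ _ _ (fun v p : R * R => v.1 * fs p + v.2 * ft p)) => //.
- exact: approachable_strip.
- by apply: strip_partials => //; exact: Ck_on_cont Cs.
- move=> v; apply: Ck_onD; first exact: approachable_strip.
    by apply: Ck_onM => //; [exact: approachable_strip|apply: Ck_on_cst; exact: approachable_strip].
  by apply: Ck_onM => //; [exact: approachable_strip|apply: Ck_on_cst; exact: approachable_strip].
Qed.

Lemma dist_lt_split (a b x d : R) : `|x - a| < d / 2 -> `|x - b| < d / 2 -> `|a - b| < d.
Proof.
rewrite !ltr_norml => /andP[h1 h2] /andP[h3 h4]; apply/andP; split; lra.
Qed.

(** Schwarz's argument with a second difference over a small rectangle, which also works when [t] is
    0 or 1 since the rectangle can be laid on the inner side. *)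
Lemma mixed_partials (e : R) (A : set (R * R)) (f : R * R -> R) p :
  relopen (strip e) A -> A p -> Ck_on 2 A f ->
  derive_in A (fun q => derive_in A f q (1, 0)) p (0, 1) =
  derive_in A (fun q => derive_in A f q (0, 1)) p (1, 0).
Proof.
move=> AS; case: p => s t Ap Cf.
pose fs q := derive_in A f q (1, 0); pose ft q := derive_in A f q (0, 1).
pose fst_ q := derive_in A fs q (0, 1); pose fts q := derive_in A ft q (1, 0).
rewrite -/fs -/ft -/(fst_ _) -/(fts _).
have Cfs : Ck_on 1 A fs by exact: Ck_on_derive.
have Cft : Ck_on 1 A ft by exact: Ck_on_derive.
(* Suppose the two values differ by [del > 0]. On the rectangle each mixed derivative stays within
   [del / 2] of its value at [p], yet the two share a value. *)
apply/eqP; rewrite -subr_eq0 -normr_le0 -[_ <= _]negbK -ltNge; apply/negP => ne.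
set del := `|_| in ne.
have d3 : 0 < del / 2 by rewrite divr_gt0.
have [d1 d10 Hd1] := cont_withinP Ap (Ck_on_cont (Ck_on_derive ((0, 1) : R * R) Cfs)) d3.
have [d2 d20 Hd2] := cont_withinP Ap (Ck_on_cont (Ck_on_derive ((1, 0) : R * R) Cft)) d3.
have [[AsubS oA] [se t01]] := (AS, AS.1 _ Ap); rewrite /= in se t01.
have [d4 d40 Hd4] : exists2 d, 0 < d & forall q, `|q - (s, t)| < d -> strip e q -> A q.
  have H : \forall q \near (s, t), strip e q -> A q by exact: (oA _ Ap).
  move: H => /nbhs_ballP[d /= d0 Hd]; exists d => // q qd; apply: Hd.
  by rewrite -ball_normE /ball_ /= distrC.
have [d5 d50 Hd5] : exists2 d3, 0 < d3 & forall a, `|a| < d3 -> - e < a + s < e.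
  exists (Num.min (s + e) (e - s)); first by case/andP: se => *; rewrite lt_min; apply/andP; split; lra.
  move=> a; rewrite lt_min ltr_norml => /andP[/andP[? ?]]; rewrite ltr_norml => /andP[? ?].
  by apply/andP; split; lra.
pose d := Num.min (Num.min d1 d2) (Num.min d4 d5).
have d0 : 0 < d by rewrite !lt_min d10 d20 d40 d50.
pose h := d / 2.
have h0 : 0 < h by rewrite divr_gt0.
have hd : h < d by rewrite /h; lra.
(* The sign of [k] is not prescribed: approachability of [[0, 1]] provides a nonzero one that keeps
   [k + t] inside. *)
have [k [k0 kd tk]] : exists k : R, [/\ k != 0, `|k| < d & closed_unit (k + t)].
  have gU := @approachable_unit R t 1 t01.
  have nk : \forall k \near within [set k : R | closed_unit (k *: 1 + t)] 0^',
     k != 0 /\ `|k| < d.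
    suff : \forall k \near (0 : R)^', closed_unit (k *: 1 + t) -> k != 0 /\ `|k| < d by [].
    near=> k => _; split; first by near: k; exact: nbhs_dnbhs_neq.
    by near: k; exact: dnbhs0_lt.
  have nk2 : \forall k \near within [set k : R | closed_unit (k *: 1 + t)] 0^', closed_unit (k *: 1 + t).
    exact: near_withinT.
  have [k [[k1 k2] k3]] := @filter_ex _ _ gU _ (filterI nk nk2).
  by exists k; split=> //; move: k3; rewrite /GRing.scale /= mulr1.
have box (u w : R) : closed_unit u -> closed_unit w -> A (u * h + s, w * k + t) /\
   `|(u * h + s, w * k + t) - (s, t)| < d.
  move=> /andP[u0 u1] /andP[w0 w1].
  have uh : `|u * h| < d.
    by rewrite normrM (ger0_norm u0) (gtr0_norm h0); apply: le_lt_trans hd; rewrite ler_piMl // ltW.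
  have wk : `|w * k| < d.
    by rewrite normrM (ger0_norm w0); apply: le_lt_trans kd; rewrite ler_piMl.
  have lt_d : `|(u * h + s, w * k + t) - (s, t)| < d.
    rewrite (_ : _ - _ = (u * h, w * k)); first by rewrite norm_pair_lt uh wk.
    by apply/pair_eqP; rewrite /= !addrK !eqxx.
  split=> //; apply: Hd4; first by apply: lt_le_trans lt_d _; rewrite !ge_min lexx !orbT.
  split=> /=; first by apply: Hd5; apply: lt_le_trans uh _; rewrite !ge_min lexx !orbT.
  case/andP: tk => tk0 tk1; case/andP: t01 => t0 t1; apply/andP; split; nra.
have c0 : closed_unit (0 : R) by rewrite /closed_unit /= lexx ler01.
have c1 : closed_unit (1 : R) by rewrite /closed_unit /= lexx ler01.
have pathE1 (u w : R) : u *: (h, 0) + (s, w * k + t) = (u * h + s, w * k + t) :> R * R.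
  by rewrite pairZD mulr0 add0r.
have pathE2 (u w : R) : w *: (0, k) + (u * h + s, t) = (u * h + s, w * k + t) :> R * R.
  by rewrite pairZD mulr0 add0r.
have dh (g : R * R -> R) (u w : R) : Ck_on 1 A g -> closed_unit u -> closed_unit w ->
    has_derive (@closed_unit R) (fun u => g (u * h + s, w * k + t)) u 1
      (h * derive_in A g (u * h + s, w * k + t) (1, 0)).
  move=> Cg u01 w01.
  rewrite (_ : (fun u => _) = fun u : R => g (u *: (h, 0) + (s, w * k + t))); last first.
    by apply/funext => u'; rewrite pathE1.
  apply: (@has_derive_seg _ _ _ A); first by move=> u' u'01; rewrite pathE1; exact: (box _ _ u'01 w01).1.
  rewrite pathE1; have Aq := (box _ _ u01 w01).1.
  have -> : (h, 0) = h *: (1, 0) :> R * R by rewrite -[RHS]addr0 pairZD mulr0 mulr1 !addr0.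
  exact: has_derive_dir (Ck_on_has Cg Aq).
have dk (g : R * R -> R) (u w : R) : Ck_on 1 A g -> closed_unit u -> closed_unit w ->
    has_derive (@closed_unit R) (fun w => g (u * h + s, w * k + t)) w 1
      (k * derive_in A g (u * h + s, w * k + t) (0, 1)).
  move=> Cg u01 w01.
  rewrite (_ : (fun w => _) = fun w : R => g (w *: (0, k) + (u * h + s, t))); last first.
    by apply/funext => u'; rewrite pathE2.
  apply: (@has_derive_seg _ _ _ A); first by move=> u' u'01; rewrite pathE2; exact: (box _ _ u01 u'01).1.
  rewrite pathE2; have Aq := (box _ _ u01 w01).1.
  have -> : (0, k) = k *: (0, 1) :> R * R by rewrite -[RHS]addr0 pairZD mulr0 mulr1 !addr0.
  exact: has_derive_dir (Ck_on_has Cg Aq).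
have Cf1 : Ck_on 1 A f by exact: Ck_onW.
have io (u : R) : 0 < u < 1 -> closed_unit u by case/andP => *; rewrite /closed_unit /= !ltW.
(* Two mean value theorems, in either order, write [Delta] as [h * k] times a value of either mixed
   derivative. *)
pose Delta := (f (1 * h + s, 1 * k + t) - f (0 * h + s, 1 * k + t)) -
              (f (1 * h + s, 0 * k + t) - f (0 * h + s, 0 * k + t)).
have [u [w [u01 w01 D1]]] : exists u w, [/\ closed_unit u, closed_unit w &
    Delta = h * k * fst_ (u * h + s, w * k + t)].
  have [u u01 Hu] := MVT01 (fun u (u01 : closed_unit u) => has_deriveB (dh _ _ _ Cf1 u01 c1) (dh _ _ _ Cf1 u01 c0)).
  have [w w01 Hw] := MVT01 (fun w (w01 : closed_unit w) => (dk _ _ _ Cfs (io _ u01) w01)).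
  exists u, w; split; [exact: io|exact: io|].
  by rewrite -mulrA -Hw mulrBr -Hu /Delta; ring.
have [u' [w' [u'01 w'01 D2]]] : exists u w, [/\ closed_unit u, closed_unit w &
    Delta = h * k * fts (u * h + s, w * k + t)].
  have [w2 w201 Hw] := MVT01 (fun w (w01 : closed_unit w) => has_deriveB (dk _ _ _ Cf1 c1 w01) (dk _ _ _ Cf1 c0 w01)).
  have [u2 u201 Hu] := MVT01 (fun u (u01 : closed_unit u) => (dh _ _ _ Cft u01 (io _ w201))).
  exists u2, w2; split; [exact: io|exact: io|].
  by rewrite (mulrC h) -mulrA -Hu mulrBr -Hw /Delta; ring.
have hk0 : h * k != 0 by rewrite mulf_neq0 // gt_eqF.
have E2 : fst_ (u * h + s, w * k + t) = fts (u' * h + s, w' * k + t).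
  by apply: (mulfI hk0); rewrite -D1 -D2.
have [A1 l1] := box _ _ u01 w01; have [A2 l2] := box _ _ u'01 w'01.
have := Hd1 _ A1 (lt_le_trans l1 _); rewrite !ge_min lexx => /(_ isT).
have := Hd2 _ A2 (lt_le_trans l2 _); rewrite !ge_min lexx orbT => /(_ isT).
rewrite -/(fst_ _) -/(fts _) E2 => H1 H2.
by have := dist_lt_split H2 H1; rewrite -/del ltxx.
Unshelve. all: by end_near. Qed.

End partials.

(** * Smooth dependence of ODE solutions on a parameter *)

Section interval_ode.
Context {R : realType}.
Local Notation I01 := (@closed_unit R).

Lemma unit0 : I01 0. Proof. by rewrite /closed_unit /= lexx ler01. Qed.
Lemma unit1 : I01 1. Proof. by rewrite /closed_unit /= lexx ler01. Qed.

Lemma is_derive_has (W : normedModType R) (A : set R) (f : R -> W) (x : R) l :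
  is_derive x 1 f l -> has_derive A f x 1 l.
Proof. by move=> /has_derive_is_derive; apply: has_derive_sub. Qed.

Lemma has_derive_id (V : normedModType R) (A : set V) (x v : V) :
  has_derive A (fun y => y) x v v.
Proof.
apply/has_deriveP => e e0; exists 1 => // h _ _ _.
by rewrite addrK subrr normr0 mulr_ge0 // ltW.
Qed.

(** Here the outer function is only differentiable at the single point [B x], so the remainder is
    estimated directly instead of through C^1 regularity. *)
Lemma has_derive_outer (V : normedModType R) (A : set V) (B : V -> R) (phi : R -> R) x v l m :
  has_derive A B x v l -> is_derive (B x) 1 phi m ->
  has_derive A (fun y => phi (B y)) x v (l * m).
Proof.
move=> /has_deriveP HB /has_derive_is_derive /has_deriveP Hphi.
apply/has_deriveP => e e0.
pose N := `|l| + 1; have N0 : 0 < N by rewrite ltr_wpDl.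
pose M := `|m| + 1; have M0 : 0 < M by rewrite ltr_wpDl.
have eN0 : 0 < e / 2 / N by rewrite !divr_gt0.
have [d d0 Hd] := Hphi _ eN0.
(* Tolerance 1 gives [|y - B x| <= N * |h|]; the other bound controls the linear part of the
   remainder. *)
have m0 : 0 < Num.min 1 (e / 2 / M) by rewrite lt_min ltr01 !divr_gt0.
have [d1 d10 Hd1] := HB _ m0.
exists (Num.min d1 (d / N)); first by rewrite lt_min d10 divr_gt0.
move=> h h0; rewrite lt_min => /andP[hd1 hd2] Ah.
have := Hd1 h h0 hd1 Ah; set y := B (h *: v + x); rewrite minr_pMl // le_min => /andP[H1 H2].
have hE (c : R) : h *: c = h * c by [].
rewrite !hE in H1 H2 *.
have yN : `|y - B x| <= N * `|h|.
  rewrite -[y - B x](subrK (h * l)); apply: le_trans (ler_normD _ _) _.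
  by rewrite mulrDl [leRHS]addrC; apply: lerD => //; rewrite normrM mulrC.
have H3 : `|phi y - phi (B x) - (y - B x) * m| <= e / 2 / N * `|y - B x|.
  have [->|yx] := eqVneq y (B x); first by rewrite !subrr mul0r subrr normr0 mulr0.
  have := Hd (y - B x); rewrite subr_eq0 => /(_ yx).
  have -> : (y - B x) *: 1 + B x = y by rewrite /GRing.scale /= mulr1 subrK.
  apply=> //; apply: le_lt_trans yN _; by rewrite mulrC -ltr_pdivlMr.
have -> : phi y - phi (B x) - h * (l * m) =
   (phi y - phi (B x) - (y - B x) * m) + (y - B x - h * l) * m by ring.
apply: le_trans (ler_normD _ _) _; rewrite [leRHS](_ : _ = e / 2 * `|h| + e / 2 * `|h|); last by field.
apply: lerD.
  apply: le_trans H3 _; apply: le_trans (_ : e / 2 / N * (N * `|h|) <= _).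
    by apply: ler_wpM2l => //; rewrite ltW // !divr_gt0.
  by rewrite mulrA divfK // gt_eqF.
rewrite normrM; apply: le_trans (_ : (e / 2 / M * `|h|) * M <= _).
  by apply: ler_pM => //; rewrite lerDl.
by rewrite mulrAC divfK // gt_eqF.
Qed.

(** Consider the first time [t1] at which [f] is nonnegative. There [f] vanishes with negative
    derivative, so [f] is already nonnegative slightly earlier, which is absurd. *)
Lemma barrier (f df : R -> R) :
  (forall t, I01 t -> has_derive I01 f t 1 (df t)) -> f 0 < 0 ->
  (forall t, I01 t -> f t = 0 -> df t < 0) -> forall t, I01 t -> f t < 0.
Proof.
move=> Hf f0 Hd ts ts01; rewrite ltNge; apply/negP => fts.
have cf := has_derive_cont Hf.
pose S := [set t | I01 t /\ 0 <= f t].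
have hS : has_inf S.
  by split; [exists ts|exists 0 => t [/andP[]]].
pose t1 := inf S.
have t10 : 0 <= t1 by apply: lb_le_inf; [exists ts|move=> t [/andP[]]].
have lbS t : S t -> t1 <= t by move=> St; apply: ge_inf => //; exists 0 => u [/andP[]].
have t11 : t1 <= 1 by apply: le_trans (lbS ts (conj ts01 fts)) _; case/andP: ts01.
have It1 : I01 t1 by apply/andP.
have ft1 : f t1 = 0.
  apply/eqP; rewrite eq_le; apply/andP; split; rewrite leNgt; apply/negP => ft.
    have [d d0 Hdd] := cont_withinP It1 cf ft.
    have t1n0 : 0 < t1.
      rewrite lt_neqAle t10 andbT; apply/eqP => t1E; move: ft; rewrite -t1E; lra.
    pose t := t1 - Num.min (d / 2) t1.
    have m0 : 0 < Num.min (d / 2) t1 by rewrite lt_min divr_gt0.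
    have m1 : Num.min (d / 2) t1 <= t1 by rewrite ge_min lexx orbT.
    have md : Num.min (d / 2) t1 < d by rewrite gt_min ltr_pdivrMr // ltr_pMr // ltr1n.
    have It : I01 t by rewrite /t; apply/andP; split; lra.
    have := Hdd _ It; rewrite /t addrAC subrr sub0r normrN gtr0_norm // => /(_ md).
    rewrite ltr_norml => /andP[h _].
    have := lbS t (conj It _); rewrite -/t in h.
    have ft0 : 0 <= f t by lra.
    move=> /(_ ft0); rewrite /t; lra.
  have nft : 0 < - f t1 by rewrite oppr_gt0.
  have [d d0 Hdd] := cont_withinP It1 cf nft.
  have [s [Is fs] sd] := inf_adherent d0 hS.
  have := Hdd s Is; rewrite ger0_norm ?subr_ge0; last exact: lbS.
  rewrite ltrBlDl => /(_ sd); rewrite ltr_norml => /andP[_]; lra.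
have t1n0 : 0 < t1.
  rewrite lt_neqAle t10 andbT; apply/eqP => t1E; move: f0; rewrite t1E ft1; lra.
have dft := Hd _ It1 ft1.
have e0 : 0 < - df t1 / 2 by rewrite divr_gt0 // oppr_gt0.
have /has_deriveP /(_ _ e0) [d d0 Hdd] := Hf _ It1.
pose m := Num.min (d / 2) t1.
have m0 : 0 < m by rewrite lt_min divr_gt0.
have m1 : m <= t1 by rewrite ge_min lexx orbT.
have md : m < d by rewrite gt_min ltr_pdivrMr // ltr_pMr // ltr1n.
have := Hdd (- m); rewrite oppr_eq0 gt_eqF // normrN gtr0_norm // => /(_ isT md).
have -> : - m *: 1 + t1 = t1 - m by rewrite /GRing.scale /= mulr1 addrC.
have It : I01 (t1 - m) by apply/andP; split; lra.
move=> /(_ It); rewrite ft1 subr0 ler_norml => /andP[h _].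
have ft0 : 0 <= f (t1 - m).
  have dm : df t1 * m < 0 by rewrite nmulr_rlt0.
  have sE : - m *: df t1 = - m * df t1 by [].
  move: h; rewrite sE; lra.
have := lbS _ (conj It ft0); lra.
Qed.

(** A local Gronwall estimate: the bound on [du] is assumed only while [u] is small. The function
    [b] grows strictly faster than the bound allows, because [b >= kappa > beta] gives
    [(M + 1) b > M b + beta]; so [u] never catches up and never leaves the region. *)
Lemma gronwall_small (u du : R -> R) (rho M beta kappa : R) :
  (forall t, I01 t -> has_derive I01 u t 1 (du t)) -> u 0 = 0 -> 0 <= M ->
  (forall t, I01 t -> `|u t| <= rho -> `|du t| <= M * `|u t| + beta) ->
  0 <= beta < kappa -> kappa * expR (M + 1) <= rho ->
  forall t, I01 t -> `|u t| < kappa * expR (M + 1).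
Proof.
move=> Hu u0 M0 Hdu /andP[b0 bk] krho.
have k0 : 0 < kappa by exact: le_lt_trans bk.
pose b (t : R) := kappa * expR ((M + 1) * t).
pose db (t : R) := (M + 1) * b t.
have Hb t : has_derive I01 b t 1 (db t).
  have H := has_deriveZ (c := M + 1) (@has_derive_id R^o I01 t 1).
  have := has_deriveZ (c := kappa) (has_derive_outer H (is_derive_expR _)).
  congr has_derive; rewrite /db /b /GRing.scale /= mulr1; ring.
have bpos t : 0 < b t by rewrite mulr_gt0 // expR_gt0.
have bub t : I01 t -> b t <= kappa * expR (M + 1).
  move=> /andP[t0 t1]; rewrite ler_pM2l // ler_expR -[leRHS]mulr1.
  by apply: ler_wpM2l => //; rewrite addr_ge0.
have blb t : I01 t -> kappa <= b t.
  move=> /andP[t0 t1]; rewrite -[leLHS]mulr1 ler_pM2l // -expR0 ler_expR.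
  by rewrite mulr_ge0 // addr_ge0.
(* Squares replace the absolute value, which is not differentiable at 0. *)
have key t : I01 t -> u t * u t - b t * b t < 0.
  apply: (@barrier (fun t => u t * u t - b t * b t) (fun t => du t * u t + u t * du t - (db t * b t + b t * db t))).
  - by move=> v v01; apply: has_deriveB; apply: has_deriveM => //; exact: Hu.
  - by rewrite u0 mul0r sub0r oppr_lt0 mulr_gt0.
  move=> v v01 /eqP; rewrite subr_eq0 => /eqP uv.
  have uvb : `|u v| = b v.
    apply/eqP; rewrite -(@eqrXn2 _ 2) //; last exact: ltW.
    by rewrite -normrX ger0_norm ?sqr_ge0 // !expr2 uv.
  have := Hdu _ v01; rewrite uvb => /(_ (le_trans (bub _ v01) krho)) Hd.
  have H1 : u v * du v <= b v * (M * b v + beta).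
    apply: le_trans (ler_norm _) _; rewrite normrM uvb; apply: ler_wpM2l => //.
    exact: ltW.
  have H2 : b v * (M * b v + beta) < b v * db v.
    rewrite ltr_pM2l // /db mulrDl ltrD2l mul1r; exact: lt_le_trans bk (blb _ v01).
  rewrite subr_lt0 (mulrC (du v)) (mulrC (db v)).
  by apply: ltrD; exact: le_lt_trans H2.
move=> t t01; apply: lt_le_trans (bub _ t01).
rewrite -(@ltr_pXn2r _ 2) // ?nnegrE ?normr_ge0 //; last exact: ltW.
by rewrite -normrX ger0_norm ?sqr_ge0 // !expr2 -subr_lt0; exact: key.
Qed.

(** Compactness of [[0, 1]]: radii that work near each time can be replaced by a single one when
    smaller radii remain admissible. *)
Lemma unit_tube (P : R -> R -> Prop) :
  (forall d d' t, 0 < d' <= d -> P d t -> P d' t) ->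
  (forall t0, I01 t0 -> exists2 d, 0 < d & forall t, I01 t -> `|t - t0| < d -> P d t) ->
  exists2 d, 0 < d & forall t, I01 t -> P d t.
Proof.
move=> Pmono Ploc.
have cI : compact I01.
  rewrite (_ : I01 = `[0, 1]%classic); first exact: segment_compact.
  by apply/seteqP; split => t; rewrite /= in_itv.
have /compact_near_coveringP/near_covering_withinP := cI.
move=> /(_ R (at_right (0 : R)) (fun d t => P d t) _).
have H x : I01 x -> \forall x' \near x & i \near (0 : R)^'+, I01 x' -> P i x'.
  move=> x01; have [d d0 Hd] := Ploc _ x01.
  exists ([set y | `|y - x| < d], [set i | 0 < i < d]).
    split => /=.
      by apply/nbhs_ballP; exists d => // y; rewrite -ball_normE /ball_ /= distrC.
    near=> i; apply/andP; split; near: i.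
      exact: nbhs_right_gt.
    exact: nbhs_right_lt.
  move=> [y i] /= [yd /andP[i0 id]] y01; apply: (Pmono d); last exact: Hd.
  by rewrite i0 ltW.
move=> /(_ H) HH.
have : \forall d \near (0 : R)^'+, 0 < d /\ (forall t, I01 t -> P d t).
  near=> d; split; first by near: d; exact: nbhs_right_gt.
  by near: d; exact: HH.
by move=> /filter_ex [d [d0 Hd]]; exists d.
Unshelve. all: by end_near. Qed.

Lemma cont_bounded (f : R -> R) : {within I01, continuous f} ->
  exists2 M, 0 <= M & forall t, I01 t -> `|f t| <= M.
Proof.
move=> cf; have [] := @unit_tube (fun d t => `|f t| <= d^-1).
- move=> d d' t /andP[d'0 dd'] /le_trans; apply.
  by rewrite lef_pV2 // posrE // (lt_le_trans d'0).
- move=> t0 t01; have [d d0 Hd] := cont_withinP t01 cf ltr01.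
  exists (Num.min d (`|f t0| + 1)^-1); first by rewrite lt_min d0 invr_gt0 ltr_wpDl.
  move=> t It; rewrite lt_min => /andP[/(Hd _ It) H _].
  apply: (@le_trans _ _ (`|f t0| + 1)).
    rewrite -[f t](subrK (f t0)) addrC; apply: le_trans (ler_normD _ _) _.
    by rewrite lerD2l ltW.
  rewrite -[leLHS]invrK lef_pV2 ?posrE ?ge_min ?lexx ?orbT // ?invr_gt0 ?ltr_wpDl //.
  by rewrite lt_min d0 invr_gt0 ltr_wpDl.
move=> d d0 Hd; exists d^-1 => //; by rewrite invr_ge0 ltW.
Qed.

(** Extend [f] to the line by its end values and integrate. *)
Lemma primitive (f : R -> R) : {within I01, continuous f} ->
  exists F : R -> R, forall t, I01 t -> has_derive I01 F t 1 (f t).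
Proof.
move=> cf; pose c (t : R) : R := Num.max 0 (Num.min t 1).
have cI t : I01 (c t) by exact: clamp_subproof.
have cE t : I01 t -> c t = t.
  by move=> /andP[t0 t1]; rewrite /c (min_idPl t1) (max_idPr t0).
have cc : continuous c.
  move=> t; apply: (@continuous_max R R (fun=> 0) (fun t => Num.min t 1) t); first exact: cvg_cst.
  by apply: (@continuous_min R R id (fun=> 1) t); [exact: cvg_id|exact: cvg_cst].
pose g t := f (c t).
have cg : continuous g.
  move=> t; apply/cvgrPdist_lt => e e0.
  have [d d0 Hd] := cont_withinP (cI t) cf e0.
  have /cvgrPdist_lt /(_ _ d0) := cc t; apply: filterS => u ud.
  by rewrite distrC; apply: Hd => //; rewrite distrC.
(* Integrating from -1, with integrability up to 2, puts all of [[0, 1]] in the interior, where the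
   fundamental theorem gives a two-sided derivative. *)
exists (fun x => \int[lebesgue_measure]_(t in `[(-1)%R, x]) g t) => t t01.
have t2 : t < 2 by case/andP: t01; lra.
have tN1 : -1 < t by case/andP: t01; lra.
have gi : lebesgue_measure.-integrable `[-1, 2] (EFin \o g).
  apply: continuous_compact_integrable; first exact: segment_compact.
  exact: continuous_subspaceT.
have [df fE] := @continuous_FTC1_closed R g (-1) t 2 t2 gi tN1 (cg t).
apply: is_derive_has; apply: DeriveDef => //.
by rewrite -derive1E fE /g cE.
Qed.

(** Variation of constants, with [A] a primitive of [a] and [B] one of [exp(- A) b]. *)
Lemma linear_ode_exists (a b : R -> R) : {within I01, continuous a} -> {within I01, continuous b} ->
  exists w, w 0 = 0 /\ forall t, I01 t -> has_derive I01 w t 1 (a t * w t + b t).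
Proof.
move=> ca cb; have [A HA] := primitive ca.
have Hexp t : I01 t -> has_derive I01 (fun t => expR (A t)) t 1 (a t * expR (A t)).
  by move=> t01; apply: has_derive_outer (HA _ t01) (is_derive_expR _).
have HexpN t : I01 t -> has_derive I01 (fun t => expR (- A t)) t 1 (- a t * expR (- A t)).
  by move=> t01; apply: has_derive_outer (has_deriveN (HA _ t01)) (is_derive_expR _).
have cg : {within I01, continuous (fun t => expR (- A t) * b t)}.
  by apply: cont_in_mul => //; exact: has_derive_cont HexpN.
have [B HB] := primitive cg.
exists (fun t => expR (A t) * (B t - B 0)); split; first by rewrite subrr mulr0.
move=> t t01; have := has_deriveM (Hexp _ t01) (has_deriveB (HB _ t01) (has_derive_cst I01 (B 0) t 1)).
by rewrite subr0 mulrA expRN divff ?gt_eqF ?expR_gt0 // mul1r mulrA.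
Qed.

End interval_ode.

(** * Uniqueness and continuous dependence on the parameter *)

Section parametric_ode.
Context {R : realType}.
Local Notation I01 := (@closed_unit R).
Variable e : R.

Lemma norm_triple_lt (a b c d : R) :
  (`|(a, b, c) : R * R * R| < d) = [&& `|a| < d, `|b| < d & `|c| < d].
Proof. by rewrite prod_normE /= gt_max prod_normE /= gt_max andbA. Qed.

(** The domain of a right-hand side [G (s, t, x)], with no restriction on [x]. *)
Definition slab : set (R * R * R) := [set q | strip e q.1].

Lemma mean_value (g dg : R -> R) (a b : R) :
  (forall x : R, is_derive x (1 : R) g (dg x)) ->
  exists2 c, `|c - a| <= `|b - a| & g b - g a = (b - a) * dg c.
Proof.
move=> Hg.
have [u u01] : exists2 u : R, 0 < u < 1 &
    g (1 *: (b - a) + a) - g (0 *: (b - a) + a) = (b - a) * dg (u *: (b - a) + a).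
  apply: (@MVT01 R (fun u : R => g (u *: (b - a) + a)) (fun u => (b - a) * dg (u *: (b - a) + a))).
  move=> u _; apply: (@has_derive_seg R R^o R^o setT) => //.
  have := has_derive_dir (c := b - a) (is_derive_has setT (Hg (u *: (b - a) + a))).
  by rewrite /GRing.scale /= mulr1.
rewrite scale1r scale0r add0r subrK => E; exists (u *: (b - a) + a) => //.
rewrite addrK normrZ -[leRHS]mul1r; apply: ler_wpM2r => //.
by case/andP: u01 => u0 u1; rewrite gtr0_norm // ltW.
Qed.

Lemma mean_value_strip (g dg : R -> R) (a b : R) : - e < a < e -> - e < b < e ->
  (forall x : R, - e < x < e -> is_derive x (1 : R) g (dg x)) ->
  exists c, [/\ - e < c < e, `|c - a| <= `|b - a| & g b - g a = (b - a) * dg c].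
Proof.
move=> ae be Hg.
have inS (u : R) : I01 u -> - e < u *: (b - a) + a < e.
  move=> /andP[u0 u1]; have uE : u *: (b - a) = u * (b - a) by [].
  case/andP: ae => a1 a2; case/andP: be => b1 b2; rewrite uE.
  have [ab|ba] := leP a b.
    have h1 : 0 <= u * (b - a) by rewrite mulr_ge0 // subr_ge0.
    have h2 : 0 <= (1 - u) * (b - a) by rewrite mulr_ge0 // subr_ge0.
    by apply/andP; split; lra.
  have h1 : 0 <= u * (a - b) by rewrite mulr_ge0 // subr_ge0 ltW.
  have h2 : 0 <= (1 - u) * (a - b) by rewrite mulr_ge0 // subr_ge0 // ltW.
  by apply/andP; split; lra.
have [u u01] : exists2 u : R, 0 < u < 1 &
    g (1 *: (b - a) + a) - g (0 *: (b - a) + a) = (b - a) * dg (u *: (b - a) + a).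
  apply: (@MVT01 R (fun u : R => g (u *: (b - a) + a)) (fun u => (b - a) * dg (u *: (b - a) + a))).
  move=> u u01; apply: (@has_derive_seg R R^o R^o setT) => //.
  have := has_derive_dir (c := b - a) (is_derive_has setT (Hg (u *: (b - a) + a) (inS _ u01))).
  by rewrite /GRing.scale /= mulr1.
rewrite scale1r scale0r add0r subrK => E; exists (u *: (b - a) + a); split=> //.
  by apply: inS; case/andP: u01 => u0 u1; rewrite /closed_unit /= !ltW.
rewrite addrK normrZ -[leRHS]mul1r; apply: ler_wpM2r => //.
by case/andP: u01 => u0 u1; rewrite gtr0_norm // ltW.
Qed.

(** The graph of [y] over [[0, 1]] is compact, so continuity is uniform in a tube around it. This
    replaces global bounds on the right-hand side. *)
Lemma graph_uniform (H : R * R * R -> R) (y : R -> R) (s0 eps : R) :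
  {within slab, continuous H} -> {within I01, continuous y} -> - e < s0 < e -> 0 < eps ->
  exists2 d, 0 < d & forall t s x, I01 t -> - e < s < e -> `|s - s0| < d -> `|x - y t| <= d ->
    `|H (s, t, x) - H (s0, t, y t)| <= eps.
Proof.
move=> cH cy s0e eps0.
have [] := @unit_tube R (fun d t => forall s x, - e < s < e -> `|s - s0| < d -> `|x - y t| <= d ->
    `|H (s, t, x) - H (s0, t, y t)| <= eps).
- move=> d d' t /andP[_ dd'] HH s x se sd xd; apply: HH => //.
    exact: lt_le_trans dd'.
  exact: le_trans dd'.
- move=> t0 t01; have e2 : 0 < eps / 2 by rewrite divr_gt0.
  have St0 : slab (s0, t0, y t0) by split.
  have [d d0 Hd] := cont_withinP St0 cH e2.
  have d2 : 0 < d / 2 by rewrite divr_gt0.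
  have [d' d'0 Hd'] := cont_withinP t01 cy d2.
  exists (Num.min (d / 4) d'); first by rewrite lt_min d'0 divr_gt0.
  move=> t It; rewrite lt_min => /andP[td td'] s x se; rewrite lt_min => /andP[sd _].
  rewrite le_min => /andP[xd _].
  have d4 : d / 4 < d / 2 by lra. have d21 : d / 2 < d by lra.
  have near (s1 x1 : R) : - e < s1 < e -> `|s1 - s0| < d -> `|x1 - y t| <= d / 4 ->
      `|H (s1, t, x1) - H (s0, t0, y t0)| < eps / 2.
    move=> s1e s1d x1d; apply: Hd; first by split.
    rewrite (_ : _ - _ = (s1 - s0, t - t0, x1 - y t0)) //.
    rewrite norm_triple_lt s1d (lt_trans td) //=; last exact: lt_trans d4 d21.
    rewrite (_ : x1 - y t0 = (x1 - y t) + (y t - y t0)); last by rewrite addrA subrK.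
    apply: le_lt_trans (ler_normD _ _) _; apply: (@lt_le_trans _ _ (d / 4 + d / 2)); last lra.
    by apply: ler_ltD => //; exact: Hd'.
  have n1 := near s x se (lt_trans sd (lt_trans d4 d21)) xd.
  have n2 : `|H (s0, t, y t) - H (s0, t0, y t0)| < eps / 2.
    by apply: near => //; rewrite subrr normr0 // ltW // divr_gt0.
  by apply: ltW; apply: (@dist_lt_split _ _ _ (H (s0, t0, y t0))); rewrite distrC.
by move=> d d0 Hd; exists d => // t s x It; exact: Hd.
Qed.

Section comparison.
Variables (G Gz : R * R * R -> R).
Hypothesis cG : {within slab, continuous G}.
Hypothesis cGz : {within slab, continuous Gz}.
Hypothesis dGz : forall q, slab q -> is_derive q.2 (1 : R) (fun x => G (q.1, x)) (Gz q).

(** By the mean value theorem in [x], [u = w - y] satisfies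
    [u' = Gz u + (G (s, t, y) - G (s0, t, y))]. In a tube around [y] the coefficient is bounded, and
    the source is small for [s] near [s0]; the local Gronwall estimate keeps [w] in the tube. *)
Lemma solution_comparison (s0 : R) (y : R -> R) : - e < s0 < e ->
  (forall t, I01 t -> has_derive I01 y t 1 (G (s0, t, y t))) ->
  forall eps, 0 < eps -> exists2 d, 0 < d & forall s w, - e < s < e -> `|s - s0| < d ->
    (forall t, I01 t -> has_derive I01 w t 1 (G (s, t, w t))) -> w 0 = y 0 ->
    forall t, I01 t -> `|w t - y t| < eps.
Proof.
move=> s0e Hy eps eps0; have cy := has_derive_cont Hy.
have [d1 d10 Hd1] := graph_uniform cGz cy s0e ltr01.
have cGzy : {within I01, continuous (fun t => Gz (s0, t, y t))}.
  apply/subspace_continuousP => t It; apply/cvgrPdist_le => eps1 eps10.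
  have St0 : slab (s0, t, y t) by split.
  have [d d0 Hd] := cont_withinP St0 cGz eps10.
  have [d' d'0 Hd'] := cont_withinP It cy d0.
  suff : \forall t' \near t, I01 t' -> `|Gz (s0, t, y t) - Gz (s0, t', y t')| <= eps1 by [].
  apply/nbhs_ballP; exists (Num.min d d'); first by rewrite /= lt_min d0.
  move=> t'; rewrite -ball_normE /ball_ /= lt_min => /andP[td td'] It'.
  rewrite distrC ltW //; apply: Hd; first by split.
  rewrite (_ : _ - _ = (s0 - s0, t' - t, y t' - y t)) //.
  by rewrite norm_triple_lt subrr normr0 d0 distrC td /= Hd' // distrC.
have [M0 M00 HM0] := cont_bounded cGzy.
pose M := M0 + 1.
have M1 : 0 <= M by rewrite addr_ge0.
(* Within [rho] of [y], [|Gz|] is at most [M], and [rho < eps]; [kappa] is then chosen to make the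
   Gronwall bound equal to [rho]. *)
pose rho := Num.min d1 (eps / 2).
have rho0 : 0 < rho by rewrite lt_min d10 divr_gt0.
pose kappa := rho / expR (M + 1).
have k0 : 0 < kappa by rewrite divr_gt0 // expR_gt0.
have [d2 d20 Hd2] := graph_uniform cG cy s0e (divr_gt0 k0 (ltr0Sn _ 1)).
exists (Num.min d1 d2); first by rewrite lt_min d10.
move=> s w se; rewrite lt_min => /andP[sd1 sd2] Hw w0 t It.
have kE : kappa * expR (M + 1) = rho by rewrite divfK // gt_eqF // expR_gt0.
apply: (@lt_trans _ _ rho); last first.
  by apply: (@le_lt_trans _ _ (eps / 2)); [rewrite ge_min lexx orbT|lra].
rewrite -kE; apply: (@gronwall_small R (fun t => w t - y t) (fun t => G (s, t, w t) - G (s0, t, y t))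
    rho M (kappa / 2)) => //.
- by move=> u u01; apply: has_deriveB; [exact: Hw|exact: Hy].
- by rewrite w0 subrr.
- move=> u u01 wy.
  have [c cw ->] : exists2 c, `|c - y u| <= `|w u - y u| &
      G (s, u, w u) - G (s0, u, y u) = (w u - y u) * Gz (s, u, c) + (G (s, u, y u) - G (s0, u, y u)).
    have [c c1 c2] := @mean_value (fun x => G (s, u, x)) (fun x => Gz (s, u, x)) (y u) (w u)
       (fun x => dGz (q := (s, u, x)) (conj se u01)).
    by exists c => //; rewrite -c2 addrA subrK.
  apply: le_trans (ler_normD _ _) _; apply: lerD.
    rewrite normrM mulrC; apply: ler_wpM2r => //.
    have cd : `|c - y u| <= d1.
      by apply: le_trans cw _; apply: le_trans wy _; rewrite ge_min lexx.
    have := Hd1 u s c u01 se sd1 cd => H1.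
    rewrite -[Gz _](subrK (Gz (s0, u, y u))) addrC; apply: le_trans (ler_normD _ _) _.
    by apply: lerD => //; exact: HM0.
  by apply: Hd2 => //; rewrite subrr normr0 ltW.
- by rewrite divr_ge0 ?ltW //= ltr_pdivrMr // ltr_pMr // ltr1n.
- by rewrite kE.
Qed.

Lemma solution_unique (s0 : R) (y w : R -> R) : - e < s0 < e ->
  (forall t, I01 t -> has_derive I01 y t 1 (G (s0, t, y t))) ->
  (forall t, I01 t -> has_derive I01 w t 1 (G (s0, t, w t))) -> w 0 = y 0 ->
  forall t, I01 t -> w t = y t.
Proof.
move=> s0e Hy Hw w0 t It; apply/eqP; rewrite -subr_eq0 -normr_le0.
apply/ler_addgt0Pl => eps eps0; rewrite addr0.
have [d d0 Hd] := solution_comparison s0e Hy eps0.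
by apply: ltW; apply: (Hd s0) => //; rewrite subrr normr0.
Qed.

Lemma solution_continuous (z : R * R -> R) (z0 : R) :
  (forall s t, - e < s < e -> I01 t -> has_derive I01 (fun t => z (s, t)) t 1 (G (s, t, z (s, t)))) ->
  (forall s, - e < s < e -> z (s, 0) = z0) -> {within strip e, continuous z}.
Proof.
move=> Hz z0E; apply/subspace_continuousP => -[s0 t0] st; apply/cvgrPdist_le => eps eps0.
have [s0e t01] := st; rewrite /= in s0e t01.
have e2 : 0 < eps / 2 by rewrite divr_gt0.
have Hy t : I01 t -> has_derive I01 (fun t => z (s0, t)) t 1 (G (s0, t, z (s0, t))).
  exact: Hz.
have [d d0 Hd] := solution_comparison s0e Hy e2.
have [d' d'0 Hd'] := cont_withinP t01 (has_derive_cont Hy) e2.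
suff : \forall q \near (s0, t0), strip e q -> `|z (s0, t0) - z q| <= eps by [].
apply/nbhs_ballP; exists (Num.min d d'); first by rewrite /= lt_min d0.
move=> [s t]; rewrite -ball_normE /ball_ /= -[(s0, t0) - (s, t)]/(s0 - s, t0 - t) norm_pair_lt !lt_min.
move=> /andP[/andP[sd _] /andP[_ td]] [/= se It].
apply: ltW; apply: (@dist_lt_split _ _ _ (z (s0, t))); first by apply: Hd' => //; rewrite distrC.
rewrite distrC; apply: (Hd s (fun t => z (s, t))) => //; first by rewrite distrC.
  by move=> u Iu; exact: Hz.
by rewrite !z0E.
Qed.

End comparison.
End parametric_ode.

(** * Differentiability and smoothness in the parameter *)

Section parametric_smooth.
Context {R : realType}.
Local Notation I01 := (@closed_unit R).
Variable e : R.
Local Notation slab := (slab e).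

Lemma cont_graph (H : R * R * R -> R) (s0 : R) (y : R -> R) : - e < s0 < e ->
  {within slab, continuous H} -> {within I01, continuous y} ->
  {within I01, continuous (fun t => H (s0, t, y t))}.
Proof.
move=> s0e cH cy; apply/subspace_continuousP => t It; apply/cvgrPdist_le => eps1 eps10.
have St0 : slab (s0, t, y t) by split.
have [d d0 Hd] := cont_withinP St0 cH eps10.
have [d' d'0 Hd'] := cont_withinP It cy d0.
suff : \forall t' \near t, I01 t' -> `|H (s0, t, y t) - H (s0, t', y t')| <= eps1 by [].
apply/nbhs_ballP; exists (Num.min d d'); first by rewrite /= lt_min d0.
move=> t'; rewrite -ball_normE /ball_ /= lt_min => /andP[td td'] It'.
rewrite distrC ltW //; apply: Hd; first by split.
rewrite (_ : _ - _ = (s0 - s0, t' - t, y t' - y t)) //.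
by rewrite norm_triple_lt subrr normr0 d0 distrC td /= Hd' // distrC.
Qed.

Section derivative.
Variables (G Gs Gz : R * R * R -> R).
Hypothesis cG : {within slab, continuous G}.
Hypothesis cGs : {within slab, continuous Gs}.
Hypothesis cGz : {within slab, continuous Gz}.
Hypothesis dGz : forall q, slab q -> is_derive q.2 (1 : R) (fun x => G (q.1, x)) (Gz q).
Hypothesis dGs : forall q, slab q -> is_derive q.1.1 (1 : R) (fun s => G (s, q.1.2, q.2)) (Gs q).
Variables (z : R * R -> R) (z0 : R).
Hypothesis Hz : forall s t, - e < s < e -> I01 t ->
  has_derive I01 (fun t => z (s, t)) t 1 (G (s, t, z (s, t))).
Hypothesis z0E : forall s, - e < s < e -> z (s, 0) = z0.

(** With [h = s - s0], the remainder [r = z (s, t) - z (s0, t) - h w] starts at 0 and satisfies a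
    linear equation up to an error that is small compared with [h], uniformly in [t]; Gronwall turns
    this into the claim. *)
Lemma solution_derivable (s0 : R) (w : R -> R) : - e < s0 < e -> w 0 = 0 ->
  (forall t, I01 t -> has_derive I01 w t 1 (Gz (s0, t, z (s0, t)) * w t + Gs (s0, t, z (s0, t)))) ->
  forall eps, 0 < eps -> exists2 d, 0 < d & forall s t, - e < s < e -> `|s - s0| < d -> I01 t ->
   `|z (s, t) - z (s0, t) - (s - s0) * w t| <= eps * `|s - s0|.
Proof.
move=> s0e w0 Hw eps eps0; pose y t := z (s0, t).
have Hy t : I01 t -> has_derive I01 y t 1 (G (s0, t, y t)) by exact: Hz.
have cy := has_derive_cont Hy.
have [M0 M00 HM0] := cont_bounded (cont_graph s0e cGz cy).
have [W W0 HW] := cont_bounded (has_derive_cont Hw).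
pose M := M0 + 1; have M1 : 0 <= M by rewrite addr_ge0.
(* [K * eps1 * |h|] is the Gronwall bound obtained below from the error
   [beta = eps1 (1 + W) |h|]. *)
pose K := 2 * (1 + W) * expR (M + 1).
have K0 : 0 < K by rewrite !mulr_gt0 ?expR_gt0 // ltr_wpDr.
pose eps1 := Num.min 1 (eps / K).
have eps10 : 0 < eps1 by rewrite lt_min ltr01 divr_gt0.
have eps1K : K * eps1 <= eps by rewrite mulrC -ler_pdivlMr // ge_min lexx orbT.
have eps11 : eps1 <= 1 by rewrite ge_min lexx.
have [d1 d10 Hd1] := graph_uniform cGz cy s0e eps10.
have [d2 d20 Hd2] := graph_uniform cGs cy s0e eps10.
pose dd := Num.min d1 d2.
have dd0 : 0 < dd by rewrite lt_min d10.
have [d3 d30 Hd3] := solution_comparison cG cGz dGz s0e Hy dd0.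
exists (Num.min dd d3); first by rewrite lt_min dd0.
move=> s t se; rewrite !lt_min => /andP[/andP[sd1 sd2] sd3] It.
have [->|hn0] := eqVneq s s0; first by rewrite !subrr mul0r subrr normr0 mulr0.
pose h := s - s0; rewrite -/h.
have h0 : 0 < `|h| by rewrite normr_gt0 subr_eq0.
have zclose u : I01 u -> `|z (s, u) - y u| < dd.
  move=> Iu; apply: (Hd3 s (fun t => z (s, t))) => //; last by rewrite /y !z0E.
  by move=> v Iv; exact: Hz.
pose a t := Gz (s0, t, y t); pose b t := Gs (s0, t, y t).
pose beta := eps1 * (1 + W) * `|h|.
have b0 : 0 < beta by rewrite !mulr_gt0 // ltr_wpDr.
pose kappa := 2 * beta.
have kE : kappa * expR (M + 1) = K * eps1 * `|h| by rewrite /kappa /beta /K; ring.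
apply: (@le_trans _ _ (kappa * expR (M + 1))); last by rewrite kE ler_pM2r.
apply: ltW; apply: (@gronwall_small R (fun t => z (s, t) - y t - h * w t)
   (fun t => G (s, t, z (s, t)) - G (s0, t, y t) - h * (a t * w t + b t))
   (kappa * expR (M + 1)) M beta) => //.
- move=> u Iu; apply: has_deriveB; first by apply: has_deriveB; [exact: Hz|exact: Hy].
  exact: (has_deriveZ (c := h) (Hw _ Iu)).
- by rewrite w0 mulr0 subr0 /y !z0E // subrr.
- move=> u Iu _; set r := z (s, u) - y u - h * w u.
  have zc := zclose _ Iu.
  have [c [ce cs Ec]] := @mean_value_strip R e (fun s' => G (s', u, z (s, u)))
    (fun s' => Gs (s', u, z (s, u))) s0 s s0e se
    (fun s' s'e => dGs (q := (s', u, z (s, u))) (conj s'e Iu)).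
  have [c' cz Ec'] := @mean_value R (fun x => G (s0, u, x)) (fun x => Gz (s0, u, x)) (y u) (z (s, u))
       (fun x => dGz (q := (s0, u, x)) (conj s0e Iu)).
  have n1 : `|Gs (c, u, z (s, u)) - b u| <= eps1.
    apply: Hd2 => //; first exact: le_lt_trans cs sd2.
    by apply: ltW; apply: lt_le_trans zc _; rewrite ge_min lexx orbT.
  have n2 : `|Gz (s0, u, c') - a u| <= eps1.
    apply: Hd1 => //; first by rewrite subrr normr0.
    by apply: le_trans cz _; apply: ltW; apply: lt_le_trans zc _; rewrite ge_min lexx.
  (* The mean value theorem in [s] and then in [x] produces the points [c] and [c']; what deviates
     from [a u * r] carries the factors bounded by [n1] and [n2]. *)
  have -> : G (s, u, z (s, u)) - G (s0, u, y u) - h * (a u * w u + b u) =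
      a u * r + (h * (Gs (c, u, z (s, u)) - b u) + (z (s, u) - y u) * (Gz (s0, u, c') - a u)).
    have -> : G (s, u, z (s, u)) = G (s0, u, z (s, u)) + h * Gs (c, u, z (s, u)).
      by rewrite -Ec addrC subrK.
    have -> : G (s0, u, z (s, u)) = G (s0, u, y u) + (z (s, u) - y u) * Gz (s0, u, c').
      by rewrite -Ec' addrC subrK.
    by rewrite /r; ring.
  have n3 : `|z (s, u) - y u| <= `|r| + `|h| * W.
    have -> : z (s, u) - y u = r + h * w u by rewrite /r subrK.
    apply: le_trans (ler_normD _ _) _; rewrite lerD2l normrM; apply: ler_wpM2l => //.
    exact: HW.
  apply: le_trans (ler_normD _ _) _.
  rewrite [leRHS](_ : _ = M0 * `|r| + (`|r| + beta)); last by rewrite /M; ring.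
  apply: lerD.
    by rewrite normrM; apply: ler_wpM2r => //; exact: (HM0 _ Iu).
  apply: le_trans (ler_normD _ _) _; rewrite !normrM.
  apply: (@le_trans _ _ (`|h| * eps1 + (`|r| + `|h| * W) * eps1)).
    by apply: lerD; [exact: ler_wpM2l|exact: ler_pM].
  (* Part of the error is a multiple of [r] itself; as [eps1 <= 1], it is absorbed by the extra 1 in
     [M = M0 + 1]. *)
  have : `|r| * eps1 <= `|r| by rewrite ler_piMr.
  by rewrite /beta; set x := `|r|; set x' := `|h|; lra.
- by rewrite ltW //= /kappa ltr_pMl // ltr1n.
Qed.

Lemma solution_has_derive (s0 t : R) (w : R -> R) : - e < s0 < e -> w 0 = 0 ->
  (forall t, I01 t -> has_derive I01 w t 1 (Gz (s0, t, z (s0, t)) * w t + Gs (s0, t, z (s0, t)))) ->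
  I01 t -> has_derive (strip e) z (s0, t) (1, 0) (w t).
Proof.
move=> s0e w0 Hw It; apply/has_deriveP => eps eps0.
have [d d0 Hd] := solution_derivable s0e w0 Hw eps0.
exists d => // h h0 hd; rewrite pairZD mulr1 mulr0 add0r => -[/= hs _].
by have := Hd _ t hs; rewrite addrK => /(_ hd It).
Qed.

Lemma variation_exists : exists w : R * R -> R, forall s, - e < s < e ->
  w (s, 0) = 0 /\ forall t, I01 t ->
    has_derive I01 (fun t => w (s, t)) t 1 (Gz (s, t, z (s, t)) * w (s, t) + Gs (s, t, z (s, t))).
Proof.
suff H s : exists w : R -> R, - e < s < e -> w 0 = 0 /\ forall t, I01 t ->
    has_derive I01 w t 1 (Gz (s, t, z (s, t)) * w t + Gs (s, t, z (s, t))).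
  by have [W HW] := choice H; exists (fun p => W p.1 p.2).
have [se|] := pselect (- e < s < e); last by exists (fun=> 0).
have cy := has_derive_cont (fun t (It : I01 t) => Hz se It).
have [w Hw] := linear_ode_exists (cont_graph se cGz cy) (cont_graph se cGs cy).
by exists w.
Qed.

End derivative.

Lemma cont_slab_fst (a : R * R -> R) : {within strip e, continuous a} ->
  {within slab, continuous (fun q => a q.1)}.
Proof.
move=> ca; apply/subspace_continuousP => -[p x] Sp; apply/cvgrPdist_le => eps eps0.
have [d d0 Hd] := cont_withinP (Sp : strip e p) ca eps0.
suff : \forall q \near (p, x), slab q -> `|a p - a q.1| <= eps by [].
apply/nbhs_ballP; exists d => // -[p' x']; rewrite -ball_normE /ball_ /=.
rewrite -[(p, x) - (p', x')]/(p - p', x - x') prod_normE /= gt_max => /andP[pd _] Sp'.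
by rewrite distrC ltW //; apply: Hd => //; rewrite distrC.
Qed.

Lemma cont_slab_snd : {within slab, continuous (fun q => q.2)}.
Proof.
apply: continuous_subspaceT => q; exact: cvg_snd.
Qed.

(** Induction on [k]: the [s]-derivative of [w] solves a linear equation with the same [a] and
    source [a_s w + b_s], of one order less, and the [t]-derivative is [a w + b]. The induction
    therefore quantifies over the source and the initial value. *)
Lemma linear_smooth k (a b w : R * R -> R) (c : R) :
  Ck_on k (strip e) a -> Ck_on k (strip e) b ->
  (forall s t, - e < s < e -> I01 t ->
    has_derive I01 (fun t => w (s, t)) t 1 (a (s, t) * w (s, t) + b (s, t))) ->
  (forall s, - e < s < e -> w (s, 0) = c) -> Ck_on k (strip e) w.
Proof.
have gS := @approachable_strip R e.
elim: k a b w c => [|k IH] a b w c Ca Cb Hw w0.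
  split=> //; apply: (@solution_continuous R e (fun q => a q.1 * q.2 + b q.1) (fun q => a q.1) _ _ _ w c) => //.
  - apply: cont_in_add; last exact: cont_slab_fst (Ck_on_cont Cb).
    apply: cont_in_mul; last exact: cont_slab_snd.
    exact: cont_slab_fst (Ck_on_cont Ca).
  - exact: cont_slab_fst (Ck_on_cont Ca).
  - move=> [p x] Sp; apply/has_derive_is_derive => /=.
    have := has_deriveD (has_deriveZ (c := a p) (@has_derive_id R R^o setT x 1)) (has_derive_cst setT (b p) x 1).
    by rewrite /GRing.scale /= mulr1 addr0.
have Cw : Ck_on k (strip e) w by exact: IH (Ck_onW Ca) (Ck_onW Cb) Hw w0.
pose as_ p := derive_in (strip e) a p (1, 0).
pose bs_ p := derive_in (strip e) b p (1, 0).
have Cas : Ck_on k (strip e) as_ by exact: Ck_on_derive.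
have Cbs : Ck_on k (strip e) bs_ by exact: Ck_on_derive.
pose G (q : R * R * R) := a q.1 * q.2 + b q.1.
pose Gs (q : R * R * R) := as_ q.1 * q.2 + bs_ q.1.
pose Gz (q : R * R * R) := a q.1.
have cG : {within slab, continuous G}.
  apply: cont_in_add; last exact: cont_slab_fst (Ck_on_cont Cb).
  apply: cont_in_mul; last exact: cont_slab_snd.
  exact: cont_slab_fst (Ck_on_cont Ca).
have cGs : {within slab, continuous Gs}.
  apply: cont_in_add; last exact: cont_slab_fst (Ck_on_cont Cbs).
  apply: cont_in_mul; last exact: cont_slab_snd.
  exact: cont_slab_fst (Ck_on_cont Cas).
have cGz : {within slab, continuous Gz} by exact: cont_slab_fst (Ck_on_cont Ca).
have dGz q : slab q -> is_derive q.2 (1 : R) (fun x => G (q.1, x)) (Gz q).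
  case: q => p x Sp; apply/has_derive_is_derive => /=.
  have := has_deriveD (has_deriveZ (c := a p) (@has_derive_id R R^o setT x 1)) (has_derive_cst setT (b p) x 1).
  by rewrite /GRing.scale /= mulr1 addr0.
have dGs q : slab q -> is_derive q.1.1 (1 : R) (fun s => G (s, q.1.2, q.2)) (Gs q).
  case: q => -[s t] x Sp /=.
  apply: (@has_derive_fst R e s t R^o (strip e) (fun p => a p * x + b p)) => //.
    exact: relopen_refl.
  apply: has_deriveD; last exact: (Ck_on_has Cb Sp).
  have := has_deriveM (Ck_on_has (v := ((1, 0) : R * R)) Ca Sp) (has_derive_cst (strip e) x (s, t) (1, 0)).
  by rewrite mulr0 addr0.
have [w1 Hw1] := @variation_exists G Gs Gz cGs cGz w Hw.
have Cw1 : Ck_on k (strip e) w1.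
  apply: (IH a (fun p => as_ p * w p + bs_ p) w1 0) => //.
  - exact: Ck_onW.
  - by apply: Ck_onD => //; exact: Ck_onM.
  - by move=> s t se It; apply: (Hw1 _ se).2.
  - by move=> s se; apply: (Hw1 _ se).1.
apply: (@Ck_on_stripS R e w w1 (fun p => a p * w p + b p)) => //.
- exact: Ck_on_cont Cw.
- move=> [s t] [/= se It].
  apply: (@solution_has_derive G Gs Gz cG cGs cGz dGz dGs w c Hw w0 s t (fun t => w1 (s, t))) => //.
    exact: (Hw1 _ se).1.
  exact: (Hw1 _ se).2.
- move=> [s t] st; apply: has_derive_snd => //.
  by case: st => se It; exact: Hw.
- by apply: Ck_onD => //; [apply: Ck_onM => //|]; exact: Ck_onW.
Qed.

(* The last hypothesis allows bootstrapping: if [z] is C^k, the equations for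
   [z] and for its parameter derivative have C^k coefficients, whence [z] is
   C^(k+1). *)
Lemma solution_smooth (G Gs Gz : R * R * R -> R) (z : R * R -> R) (z0 : R) :
  {within slab, continuous G} -> {within slab, continuous Gs} -> {within slab, continuous Gz} ->
  (forall q, slab q -> is_derive q.2 (1 : R) (fun x => G (q.1, x)) (Gz q)) ->
  (forall q, slab q -> is_derive q.1.1 (1 : R) (fun s => G (s, q.1.2, q.2)) (Gs q)) ->
  (forall s t, - e < s < e -> I01 t ->
    has_derive I01 (fun t => z (s, t)) t 1 (G (s, t, z (s, t)))) ->
  (forall s, - e < s < e -> z (s, 0) = z0) ->
  (forall k, Ck_on k (strip e) z -> [/\ Ck_on k (strip e) (fun p => G (p, z p)),
     Ck_on k (strip e) (fun p => Gs (p, z p)) & Ck_on k (strip e) (fun p => Gz (p, z p))]) ->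
  smooth_on (strip e) z.
Proof.
move=> cG cGs cGz dGz dGs Hz z0E HC.
have [w Hw] := @variation_exists G Gs Gz cGs cGz z Hz.
elim=> [|k IH]; first by split=> //; exact: (solution_continuous cG cGz dGz Hz z0E).
have [C1 C2 C3] := HC _ IH.
apply: (@Ck_on_stripS R e z w (fun p => G (p, z p))) => //.
- exact: Ck_on_cont IH.
- move=> [s t] [/= se It].
  apply: (@solution_has_derive G Gs Gz cG cGs cGz dGz dGs z z0 Hz z0E s t (fun t => w (s, t))) => //.
    exact: (Hw _ se).1.
  exact: (Hw _ se).2.
- by move=> [s t] st; apply: has_derive_snd => //; case: st => se It; exact: Hz.
- apply: (@linear_smooth k (fun p => Gz (p, z p)) (fun p => Gs (p, z p)) w 0) => //.
    by move=> s t se It; apply: (Hw _ se).2.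
  by move=> s se; apply: (Hw _ se).1.
Qed.

End parametric_smooth.

(** * Families of curves on a manifold *)

Section manifolds.
Context {R : realType} {n : nat} (Q : manifold R n).
Implicit Types (phi psi chi : chart R n Q).
Local Notation I01 := (@closed_unit R).
Local Notation rV := ('rV[R]_n).
Local Notation rfr := (row_frame (R := R) n).

Lemma smooth_comp (V : normedModType R) (A : set V) (B : set rV) (g : V -> rV) (f : rV -> rV) :
  approachable A -> open B -> (forall x, A x -> B (g x)) -> smooth_on A g -> smooth_on B f ->
  smooth_on A (fun y => f (g y)).
Proof. by move=> gA oB AB Cg Cf k; exact: (Ck_on_comp rfr rfr oB gA AB (Cg k) (Cf k)). Qed.

Lemma open_relopen (V : normedModType R) (B C : set V) : open C -> C `<=` B -> relopen B C.
Proof. by move=> /relopen_open oC CB; apply: relopen_sub oC CB _. Qed.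

Lemma overlapE phi (D : set Q) :
  coord phi @` (dom phi `&` D) = img phi `&` point phi @^-1` D.
Proof.
apply/seteqP; split.
  by move=> _ [q [pq Dq] <-]; split; [exists q|rewrite /= coordK].
move=> _ [[q pq <-]]; rewrite /= coordK // => Dq.
by exists q.
Qed.

Lemma overlap_open phi (D : set Q) : open D -> open (coord phi @` (dom phi `&` D)).
Proof.
move=> oD; rewrite overlapE.
apply/relopen_open; apply: (@relopen_trans _ _ _ (img phi)).
  by apply/relopen_open; exact: img_open.
by apply: relopen_preimage => //; exact: point_continuous.
Qed.

(** Charts of the maximal atlas are compatible by definition with charts of the atlas only; near
    each point the transition factors through one of those. *)
Lemma transition_smooth phi psi : max_atlas phi -> max_atlas psi ->
  smooth_on (coord phi @` (dom phi `&` dom psi)) (transition phi psi).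
Proof.
move=> mphi mpsi k; apply: Ck_on_glue => _ [q [phiq psiq] <-].
have [chi achi chiq] := atlas_cover q.
have [_ Tphi] := mphi chi achi; have [Cphi _] := mphi chi achi.
have [Cpsi Dpsi] := mpsi chi achi.
pose O := coord phi @` (dom phi `&` (dom psi `&` dom chi)).
have oO : open O by apply: overlap_open; apply: openI; exact: dom_open.
have OS : O `<=` coord phi @` (dom phi `&` dom psi).
  by move=> _ [r [pr [sr _]] <-]; exists r.
exists O; split.
- exact: open_relopen.
- by exists q.
have gO : approachable O by exact: approachable_open.
apply: (@Ck_on_eq _ _ _ _ _ (fun x => transition chi psi (transition phi chi x))).
  move=> _ [r [pr [sr cr]] <-]; by rewrite /transition (coordK pr) (coordK cr).
apply: (@smooth_comp _ O (coord chi @` (dom psi `&` dom chi)) (transition phi chi) (transition chi psi)) => //.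
- by rewrite setIC; apply: overlap_open; exact: dom_open.
- by move=> _ [r [pr [sr cr]] <-]; rewrite /transition (coordK pr); exists r.
- move=> k'; apply: (@Ck_on_relopen _ _ _ _ (coord phi @` (dom phi `&` dom chi))) (Cphi k').
  apply: open_relopen => //.
  by move=> _ [r [pr [sr cr]] <-]; exists r.
Qed.

Lemma transition_derive phi psi q v : max_atlas phi -> max_atlas psi -> dom phi q -> dom psi q ->
  has_derive (coord phi @` (dom phi `&` dom psi)) (transition phi psi) (coord phi q) v
    ('D_v (transition phi psi) (coord phi q)).
Proof.
move=> mphi mpsi pq sq; set O := _ @` _.
have oO : open O by apply: overlap_open; exact: dom_open.
have Oq : O (coord phi q) by exists q.
rewrite -(derive_in_open _ _ oO Oq).
exact: (Ck_on_has (transition_smooth mphi mpsi 1) Oq).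
Qed.

(** The chain rule for transition maps: the components in a third chart are the same whether
    computed from [phi] or by way of [psi]. *)
Lemma tclass_change phi psi q v : max_atlas phi -> max_atlas psi -> dom phi q -> dom psi q ->
  tclass phi q v = tclass psi q ('D_v (transition phi psi) (coord phi q)) :> set (chart R n Q * rV).
Proof.
move=> mphi mpsi pq sq.
suff H chi : max_atlas chi -> dom chi q ->
    'D_v (transition phi chi) (coord phi q) =
    'D_('D_v (transition phi psi) (coord phi q)) (transition psi chi) (coord psi q).
  apply/seteqP; split => -[chi u] [/= mchi cq ->]; split=> //.
    exact: H.
  exact/esym/H.
move=> mchi cq.
pose O := coord phi @` (dom phi `&` (dom psi `&` dom chi)).
have oO : open O by apply: overlap_open; apply: openI; exact: dom_open.
have Oq : O (coord phi q) by exists q.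
pose O2 := coord psi @` (dom psi `&` dom chi).
have oO2 : open O2 by apply: overlap_open; exact: dom_open.
have Tq : transition phi psi (coord phi q) = coord psi q by rewrite /transition coordK.
have O2q : O2 (coord psi q) by exists q.
have H1 : has_derive O (transition phi psi) (coord phi q) v ('D_v (transition phi psi) (coord phi q)).
  apply: has_derive_sub (transition_derive mphi mpsi pq sq).
  by move=> _ [r [pr [sr cr]] <-]; exists r.
have C2 : Ck_on 1 O2 (transition psi chi) by exact: transition_smooth.
have := @has_derive_comp _ _ _ rfr _ _ rfr O2 oO2 _ O (transition phi psi) (transition psi chi)
  (coord phi q) v _ C2.
rewrite Tq => /(_ _ O2q H1) H2.
have H3 : has_derive O (transition phi chi) (coord phi q) v ('D_v (transition phi chi) (coord phi q)).
  apply: has_derive_sub (transition_derive mphi mchi pq cq).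
  by move=> _ [r [pr [sr cr]] <-]; exists r.
have gO : approachable O by exact: approachable_open.
rewrite -(approachable_lim gO Oq H3) -(derive_in_open _ _ oO2 O2q) -(approachable_lim gO Oq H2).
apply: derive_in_eq => // _ [r [pr [sr cr]] <-].
by rewrite /transition (coordK pr) (coordK sr).
Qed.

Lemma tangent_eq (u v : tangent Q) : tbase u = tbase v -> tvector u = tvector v -> u = v.
Proof.
case: u v => [b1 s1 p1] [b2 s2 p2] /= E1 E2; subst b2 s2; congr Tangent; exact: Prop_irrelevance.
Qed.

Lemma chart_orE phi q : max_atlas phi -> dom phi q -> chart_or phi q = phi.
Proof. by move=> mphi pq; rewrite /chart_or; case: asboolP => // -[]. Qed.

Lemma tvec_change phi psi q v : max_atlas phi -> max_atlas psi -> dom phi q -> dom psi q ->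
  tvec phi q v = tvec psi q ('D_v (transition phi psi) (coord phi q)).
Proof.
move=> mphi mpsi pq sq; apply: tangent_eq => //=.
by rewrite !chart_orE //; exact: tclass_change.
Qed.

Lemma clampK (t : unit_interval R) : clamp (sval t) = t.
Proof.
apply/eqP; rewrite -(inj_eq val_inj) /=; case: t => t /= /andP[t0 t1].
by rewrite (min_idPl t1) (max_idPr t0).
Qed.

Lemma sval_clamp (t : R) : I01 t -> sval (clamp t) = t.
Proof. by move=> /andP[t0 t1] /=; rewrite (min_idPl t1) (max_idPr t0). Qed.

Lemma svalI (t : unit_interval R) : I01 (sval t).
Proof. by case: t. Qed.

Section maps.
Variables (V : normedModType R) (A : set V) (f : V -> Q).

Definition chart_dom phi : set V := A `&` f @^-1` dom phi.

Lemma chart_dom_relopen phi : {within A, continuous f} -> relopen A (chart_dom phi).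
Proof. by move=> cf; apply: relopen_preimage => //; exact: dom_open. Qed.

(** One suitable chart near each point is enough, since composition with smooth transitions handles
    all the others. *)
Lemma smooth_into_local : approachable A ->
  (forall x, A x -> exists B phi, [/\ relopen A B, B x, max_atlas phi,
     (forall y, B y -> dom phi (f y)) & smooth_on B (fun y => coord phi (f y))]) ->
  smooth_into A f.
Proof.
move=> gA H.
have cf : {within A, continuous f}.
  apply: cont_glue => x Ax; have [B [phi [AB Bx mphi Bphi Cf]]] := H _ Ax.
  exists B; split=> //; apply: (@cont_eq _ _ _ _ (fun y => point phi (coord phi (f y)))).
    by move=> y By; rewrite coordK //; exact: Bphi.
  apply: (@cont_in_comp R rV (img phi) (@img_open _ _ _ phi) V Q B (fun y => coord phi (f y)) (point phi)).
  - by move=> y By; exists (f y) => //; exact: Bphi.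
  - exact: Ck_on_cont (Cf 0).
  - exact: point_continuous.
split=> // psi mpsi k; apply: Ck_on_glue => x [Ax psix].
have [B [phi [AB Bx mphi Bphi Cf]]] := H _ Ax.
have AD : relopen A (chart_dom psi) by exact: chart_dom_relopen.
pose B' := B `&` chart_dom psi.
have AB' : relopen A B' by exact: relopenI.
exists B'; split=> //.
  by apply: relopen_sub AB' _ _; [move=> y []|case: AD].
apply: (@Ck_on_eq _ _ _ _ _ (fun y => transition phi psi (coord phi (f y)))).
  by move=> y [By _]; rewrite /transition coordK //; exact: Bphi.
apply: (@smooth_comp _ B' (coord phi @` (dom phi `&` dom psi)) (fun y => coord phi (f y))).
- exact: approachable_relopen AB' gA.
- by apply: overlap_open; exact: dom_open.
- by move=> y [By [_ psiy]]; exists (f y) => //; split=> //; exact: Bphi.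
- move=> k'; apply: Ck_on_relopen (Cf k'); apply: relopen_sub AB' _ _; first by move=> y [].
  by case: AB.
- exact: transition_smooth.
Qed.

Lemma smooth_into_chart phi : smooth_into A f -> max_atlas phi ->
  relopen A (chart_dom phi) /\ smooth_on (chart_dom phi) (fun x => coord phi (f x)).
Proof. by move=> [cf Cf] mphi; split; [exact: chart_dom_relopen|exact: Cf]. Qed.

Lemma derive_change phi psi x v : approachable A -> smooth_into A f -> max_atlas phi -> max_atlas psi ->
  A x -> dom phi (f x) -> dom psi (f x) ->
  derive_in A (fun y => coord psi (f y)) x v =
  'D_(derive_in A (fun y => coord phi (f y)) x v) (transition phi psi) (coord phi (f x)).
Proof.
move=> gA sf mphi mpsi Ax px sx.
have [rphi Cphi] := smooth_into_chart sf mphi.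
have [rpsi Cpsi] := smooth_into_chart sf mpsi.
have rB := relopenI rphi rpsi; set B := _ `&` _ in rB.
have Bx : B x by [].
pose O := coord phi @` (dom phi `&` dom psi).
have oO : open O by apply: overlap_open; exact: dom_open.
have Ox : O (coord phi (f x)) by exists (f x).
rewrite -(derive_in_open _ _ oO Ox) -!(derive_in_relopen _ _ rB Bx).
rewrite -(derive_in_comp rfr rfr oO).
- apply: derive_in_eq => // y [[_ py] [_ sy]].
  by rewrite /transition coordK.
- exact: approachable_relopen rB gA.
- by [].
- exact: transition_smooth.
- by [].
- rewrite (derivable_in_relopen _ _ rB Bx) -(derivable_in_relopen _ _ rphi); last by split.
  by apply: (Ck_on_derivable (Cphi 1)); split.
Qed.

End maps.

Lemma velocity_chart (c : unit_interval R -> Q) t phi : smooth_curve c -> max_atlas phi ->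
  dom phi (c t) ->
  velocity c t = tvec phi (c t) (curve_derive (fun u => coord phi (c u)) t).
Proof.
move=> sc mphi pt; rewrite /velocity.
have [mchi chit] := chart_atP (c t); set chi := chart_at _ in mchi chit *.
rewrite (tvec_change _ mchi mphi chit pt); congr tvec.
rewrite /curve_derive.
rewrite (derive_change (phi := chi) (psi := phi) _ approachable_unit sc) ?clampK //.
exact: svalI.
Qed.

Lemma smooth_family_curve (e s : R) (F : R -> unit_interval R -> Q) :
  smooth_family e F -> - e < s < e -> smooth_curve (F s).
Proof.
move=> sF se; apply: smooth_into_local; first exact: approachable_unit.
move=> t It; have [mphi pt] := chart_atP (F s (clamp t)).
set phi := chart_at _ in mphi pt.
have [rB CB] := smooth_into_chart sF mphi.
exists (slice (chart_dom (strip e) (fun p => F p.1 (clamp p.2)) phi) s), phi; split=> //.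
- exact: slice_relopen se rB.
- by move=> u [].
- by move=> k; exact: (Ck_on_slice se rB (CB k)).
Qed.

(** Through constant families, uniqueness and smoothness of [Zmap] along a single curve become
    instances of the results with a parameter. *)
Lemma constant_family (e : R) (c : unit_interval R -> Q) :
  smooth_curve c -> smooth_family e (fun=> c).
Proof.
move=> sc; apply: smooth_into_local; first exact: approachable_strip.
move=> [s t] [/= se It]; have [mphi pt] := chart_atP (c (clamp t)).
set phi := chart_at _ in mphi pt.
have [rB CB] := smooth_into_chart sc mphi.
have rS := time_relopen e rB.
exists [set p | strip e p /\ chart_dom I01 (fun u => c (clamp u)) phi p.2], phi; split=> //.
- by move=> p [_ []].
- move=> k; apply: Ck_on_relopen (Ck_on_time rB (CB k)).
  apply: relopen_sub (relopenI (strip_relopen e) _) _ _.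
  + by apply: relopen_comp rB => p; exact: cvg_snd.
  + by move=> p [_].
  + by case: rB => + _ p => /(_ p.2).
Qed.

Lemma local_rep_velocity (L : tangent Q -> R -> R) (c : unit_interval R -> Q) t phi z :
  smooth_curve c -> max_atlas phi -> dom phi (c t) ->
  L (velocity c t) z = local_rep L phi (coord phi (c t), curve_derive (fun u => coord phi (c u)) t, z).
Proof. by move=> sc mphi pt; rewrite /local_rep /= coordK // -velocity_chart. Qed.

End manifolds.

(** * Differentiating the Lagrangian along maps into the jet space *)

Section jets.
Context {R : realType} {n : nat}.
Local Notation rV := ('rV[R]_n).
Local Notation E := (rV * rV * R)%type.
Local Notation jfr := (jet_frame (R := R) n).
Local Notation rfr := (row_frame (R := R) n).
Variables (V : normedModType R) (A : set V).

Lemma Ck_on_jet k (x v : V -> rV) (z : V -> R) : approachable A ->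
  Ck_on k A x -> Ck_on k A v -> Ck_on k A z -> Ck_on k A (fun p => (x p, v p, z p) : E).
Proof.
move=> gA Cx Cv Cz; apply: (Ck_on_frame (fr := jfr)) => // -[[i|i]|[]] /=.
- exact: (Ck_on_coord rfr i gA Cx).
- exact: (Ck_on_coord rfr i gA Cv).
- exact: Cz.
Qed.

Lemma has_derive_jet (x v : V -> rV) (z : V -> R) p w lx lv lz :
  has_derive A x p w lx -> has_derive A v p w lv -> has_derive A z p w lz ->
  has_derive A (fun p => (x p, v p, z p) : E) p w (lx, lv, lz).
Proof.
move=> Hx Hv Hz; rewrite -[X in has_derive _ _ _ _ X](fcoordK jfr).
apply: (frame_has_derive (fr := jfr)) => -[[i|i]|[]] /=.
- exact: (has_derive_coord (fr := rfr) (i := i) Hx).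
- exact: (has_derive_coord (fr := rfr) (i := i) Hv).
- exact: Hz.
Qed.

Variable B : set E.
Hypothesis oB : open B.
Variable Lp : E -> R.
Hypothesis CL : smooth_on B Lp.

Lemma derive_jet_sum (j l : E) : B j ->
  'D_l Lp j = \sum_i l.1.1 ord0 i * 'D_((delta_mx ord0 i, 0, 0) : E) Lp j
    + \sum_i l.1.2 ord0 i * 'D_((0, delta_mx ord0 i, 0) : E) Lp j
    + l.2 * 'D_((0, 0, 1) : E) Lp j.
Proof.
move=> Bj; rewrite -(derive_in_open _ _ oB Bj) (derive_in_sum jfr oB _ (CL 1) Bj) sum_jet /=.
by congr (_ + _ + _); try (apply: eq_bigr => i _); rewrite (derive_in_open _ _ oB Bj).
Qed.

Lemma derive_jet_pair (j : E) (a b : rV) : B j ->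
  'D_((a, b, 0) : E) Lp j = \sum_i a ord0 i * 'D_((delta_mx ord0 i, 0, 0) : E) Lp j
    + \sum_i b ord0 i * 'D_((0, delta_mx ord0 i, 0) : E) Lp j.
Proof.
move=> Bj; apply: (etrans (derive_jet_sum (a, b, 0) Bj)).
by rewrite -[RHS]addr0; congr (_ + _); exact: mul0r.
Qed.

Lemma derive_jet_vel (j : E) (b : rV) : B j ->
  'D_((0, b, 0) : E) Lp j = \sum_i b ord0 i * 'D_((0, delta_mx ord0 i, 0) : E) Lp j.
Proof.
move=> Bj; apply: (etrans (derive_jet_pair 0 b Bj)); rewrite -[RHS]add0r; congr (_ + _).
by apply: big1 => i _; rewrite mxE; exact: mul0r.
Qed.

Lemma smooth_partial (l : E) : smooth_on B (fun j => 'D_l Lp j).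
Proof.
move=> k; apply: Ck_on_eq (Ck_on_derive l (CL k.+1)) => j Bj.
exact: derive_in_open.
Qed.

Lemma Ck_on_lagrangian k (f : E -> R) (j : V -> E) : approachable A -> smooth_on B f ->
  (forall p, A p -> B (j p)) -> Ck_on k A j -> Ck_on k A (fun p => f (j p)).
Proof.
move=> gA Cf AB Cj; exact: (Ck_on_comp jfr real_frame oB gA AB Cj (Cf k)).
Qed.

(** The direction varies with the point; expanding it in the frame leaves fixed partial derivatives
    with C^k coefficients. *)
Lemma Ck_on_derive_jet k (j l : V -> E) : approachable A ->
  (forall p, A p -> B (j p)) -> Ck_on k A j -> Ck_on k A l ->
  Ck_on k A (fun p => 'D_(l p) Lp (j p)).
Proof.
move=> gA AB Cj Cl.
apply: (@Ck_on_eq _ _ _ _ _ (fun p => \sum_i fcoord jfr i (l p) * 'D_(jet_vec i) Lp (j p))).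
  move=> p Ap; rewrite -(derive_in_open _ _ oB (AB _ Ap)) (derive_in_sum jfr oB _ (CL 1) (AB _ Ap)).
  by apply: eq_bigr => i _; rewrite -(derive_in_open _ _ oB (AB _ Ap)).
apply: Ck_on_sum => // i _; apply: Ck_onM => //; first exact: (Ck_on_coord jfr i gA Cl).
exact: (Ck_on_lagrangian gA (smooth_partial (jet_vec i)) AB Cj).
Qed.

Lemma has_derive_lagrangian (j : V -> E) p w l : A p -> B (j p) ->
  has_derive A j p w l -> has_derive A (fun p => Lp (j p)) p w ('D_l Lp (j p)).
Proof.
move=> Ap Bj Hj; rewrite -(derive_in_open _ _ oB Bj).
exact: (has_derive_comp jfr real_frame oB (CL 1) Bj Hj).
Qed.

End jets.

(** * The equation of [Z] along a family of curves *)

Section lift.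
Context {R : realType} {n : nat} (Q : manifold R n).
Local Notation rV := ('rV[R]_n).
Local Notation E := (rV * rV * R)%type.
Local Notation I01 := (@closed_unit R).
Variables (L : tangent Q -> R -> R).
Hypothesis smoothL : smooth_lagrangian L.

Definition jet_dom (phi : chart R n Q) : set E := [set p | img phi p.1.1].

Lemma jet_dom_open phi : open (jet_dom phi).
Proof.
have -> : jet_dom phi = (fun p : E => p.1.1) @^-1` img phi by [].
apply: open_comp; last exact: img_open.
move=> p _; apply: (cvg_comp (fun p : E => p.1) (fun x : rV * rV => x.1)); exact: cvg_fst.
Qed.

Variables (e : R) (F : R -> unit_interval R -> Q).
Hypothesis sF : smooth_family e F.

Definition family_map (p : R * R) : Q := F p.1 (clamp p.2).
Definition family_dom (phi : chart R n Q) := chart_dom (strip e) family_map phi.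
Definition family_pos phi (p : R * R) : rV := coord phi (family_map p).
Definition family_vel phi (p : R * R) : rV := derive_in (family_dom phi) (family_pos phi) p (0, 1).
(** The right-hand side of the equation for [Z], as a function of [(s, t, z)] on the whole slab. Its
    two derivatives below are also taken without coordinates, so all three are global although their
    regularity is checked in charts. *)
Definition family_lag (q : R * R * R) : R := L (velocity (F q.1.1) (clamp q.1.2)) q.2.
Definition family_lag_z (q : R * R * R) : R := 'D_1 (fun x : R => family_lag (q.1, x)) q.2.
Definition family_lag_s (q : R * R * R) : R :=
  'D_1 (fun s : R => family_lag (s, q.1.2, q.2)) q.1.1.
Definition family_jet phi (q : R * R * R) : E :=
  (family_pos phi q.1, family_vel phi q.1, q.2).
(** The [s]-derivative of the jet with [z] held fixed, whence the last component 0. *)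
Definition family_jet_s phi (p : R * R) : E :=
  (derive_in (family_dom phi) (family_pos phi) p (1, 0),
   derive_in (family_dom phi) (family_vel phi) p (1, 0), 0).

Section in_chart.
Variable phi : chart R n Q.
Hypothesis mphi : max_atlas phi.
Local Notation A := (family_dom phi).
Local Notation Lp := (local_rep L phi).

Lemma family_dom_relopen : relopen (strip e) A.
Proof. by have [] := smooth_into_chart sF mphi. Qed.

Lemma family_dom_approachable : approachable A.
Proof. exact: approachable_relopen family_dom_relopen (@approachable_strip R e). Qed.

Lemma family_pos_smooth : smooth_on A (family_pos phi).
Proof. by have [] := smooth_into_chart sF mphi. Qed.

Lemma family_vel_smooth : smooth_on A (family_vel phi).
Proof. exact: smooth_on_derive family_pos_smooth. Qed.

Lemma family_jet_dom p z : A p -> jet_dom phi (family_jet phi (p, z)).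
Proof. by move=> [_ pp]; exists (family_map p). Qed.

Lemma family_curve_derive s t : A (s, t) ->
  curve_derive (fun u => coord phi (F s u)) (clamp t) = family_vel phi (s, t).
Proof.
move=> Ast; have [se It] : - e < s < e /\ I01 t by case: Ast => -[].
 rewrite /curve_derive (sval_clamp It).
apply: approachable_lim; [exact: approachable_unit|exact: It|].
apply: (@has_derive_slice R e s t rV A (family_pos phi) _ se family_dom_relopen Ast).
exact: (Ck_on_has (family_pos_smooth 1) Ast).
Qed.

Lemma family_lag_chart p z : A p -> family_lag (p, z) = Lp (family_jet phi (p, z)).
Proof.
case: p => s t Ast.
have [se pp] : - e < s < e /\ dom phi (F s (clamp t)) by case: Ast => -[].
have -> : family_lag (s, t, z) = L (velocity (F s) (clamp t)) z by [].
rewrite (local_rep_velocity L z (smooth_family_curve sF se) mphi pp).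
by rewrite (family_curve_derive Ast).
Qed.

Lemma family_lag_derive_z p z : A p ->
  is_derive z (1 : R) (fun x => family_lag (p, x)) ('D_((0, 0, 1) : E) Lp (family_jet phi (p, z))).
Proof.
move=> Ap; apply/has_derive_is_derive.
rewrite (_ : (fun x => _) = fun x => Lp (family_jet phi (p, x))); last first.
  by apply/funext => x; exact: family_lag_chart.
apply: (@has_derive_lagrangian R n _ setT (jet_dom phi) (@jet_dom_open phi) Lp (smoothL mphi)
  (fun x => family_jet phi (p, x))) => //; first exact: family_jet_dom.
apply: (@has_derive_jet R n R^o setT (fun=> family_pos phi p) (fun=> family_vel phi p) (fun x => x));
  [exact: has_derive_cst|exact: has_derive_cst|exact: has_derive_id].
Qed.

Lemma family_lag_derive_s p z : A p ->
  is_derive p.1 (1 : R) (fun s => family_lag (s, p.2, z))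
    ('D_(family_jet_s phi p) Lp (family_jet phi (p, z))).
Proof.
case: p => s t Ast.
apply: (@has_derive_fst R e s t R^o A (fun p => family_lag (p, z))) => //.
  exact: family_dom_relopen.
apply: (@has_derive_eq _ _ _ _ (fun p => Lp (family_jet phi (p, z)))) => //.
  by move=> p Ap; rewrite family_lag_chart.
apply: (@has_derive_lagrangian R n _ A (jet_dom phi) (@jet_dom_open phi) Lp (smoothL mphi)
  (fun p => family_jet phi (p, z))) => //; first exact: family_jet_dom.
apply: (@has_derive_jet R n _ A (family_pos phi) (family_vel phi) (fun=> z)); last exact: has_derive_cst.
  exact: (Ck_on_has (family_pos_smooth 1) Ast).
exact: (Ck_on_has (family_vel_smooth 1) Ast).
Qed.

Lemma family_lag_z_chart p z : A p ->
  family_lag_z (p, z) = 'D_((0, 0, 1) : E) Lp (family_jet phi (p, z)).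
Proof. by move=> Ap; have [_ H] := family_lag_derive_z z Ap. Qed.

Lemma family_lag_s_chart p z : A p ->
  family_lag_s (p, z) = 'D_(family_jet_s phi p) Lp (family_jet phi (p, z)).
Proof. by move=> Ap; have [_ H] := family_lag_derive_s z Ap. Qed.

Lemma family_jet_s_smooth : smooth_on A (family_jet_s phi).
Proof.
move=> k; apply: Ck_on_jet; first exact: family_dom_approachable.
- exact: smooth_on_derive family_pos_smooth k.
- exact: smooth_on_derive family_vel_smooth k.
- apply: Ck_on_cst; exact: family_dom_approachable.
Qed.

(** Stated for a pullback along [j] because it is used twice: with [j = fst] on the slab, for
    continuity, and with [j = id] and [zt] a solution on the strip, for the bootstrap. *)
Lemma family_lag_regular (V : normedModType R) (D : set V) (j : V -> R * R) (zt : V -> R) k :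
  approachable D -> (forall p, D p -> A (j p)) ->
  (forall (W : normedModType R) (g : R * R -> W), smooth_on A g -> Ck_on k D (fun p => g (j p))) ->
  Ck_on k D zt ->
  [/\ Ck_on k D (fun p => family_lag (j p, zt p)),
      Ck_on k D (fun p => family_lag_s (j p, zt p)) &
      Ck_on k D (fun p => family_lag_z (j p, zt p))].
Proof.
move=> gD DA Hg Cz.
have Cj : Ck_on k D (fun p => family_jet phi (j p, zt p)).
  apply: Ck_on_jet => //; first exact: (Hg _ _ family_pos_smooth).
  exact: (Hg _ _ family_vel_smooth).
have Dj p : D p -> jet_dom phi (family_jet phi (j p, zt p)).
  by move=> Dp; apply: family_jet_dom; exact: DA.
have oB := @jet_dom_open phi; have CL := smoothL mphi.
split.
- apply: Ck_on_eq (Ck_on_lagrangian oB gD CL Dj Cj) => p Dp.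
  by rewrite family_lag_chart //; exact: DA.
- apply: Ck_on_eq (Ck_on_derive_jet oB CL gD Dj Cj (Hg _ _ family_jet_s_smooth)) => p Dp.
  by rewrite family_lag_s_chart //; exact: DA.
- apply: Ck_on_eq (Ck_on_lagrangian oB gD (smooth_partial oB CL ((0, 0, 1) : E)) Dj Cj) => p Dp.
  by rewrite family_lag_z_chart //; exact: DA.
Qed.

End in_chart.

Lemma family_dom_cover p : strip e p -> exists2 phi, max_atlas phi & family_dom phi p.
Proof.
move=> Sp; have [mphi pp] := chart_atP (family_map p).
by exists (chart_at (family_map p)).
Qed.

Lemma slab_relopen (A : set (R * R)) : relopen (strip e) A ->
  relopen (slab e) [set q : R * R * R | A q.1].
Proof. by move=> rA; apply: relopen_comp rA => q; exact: cvg_fst. Qed.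

Lemma slab_approachable : approachable (slab e).
Proof. exact: (@approachable_preimage _ _ _ _ fst fst _ (@approachable_strip R e)). Qed.

Lemma family_lag_cont : [/\ {within slab e, continuous family_lag},
  {within slab e, continuous family_lag_s} & {within slab e, continuous family_lag_z}].
Proof.
suff H q : slab e q -> exists B, [/\ relopen (slab e) B, B q & [/\ Ck_on 0 B family_lag,
    Ck_on 0 B family_lag_s & Ck_on 0 B family_lag_z]].
  by split; apply: cont_glue => q /H[B [rB Bq [[C1 _] [C2 _] [C3 _]]]]; exists B.
case: q => p z Sp; have [phi mphi Ap] := family_dom_cover Sp.
have rA := family_dom_relopen mphi.
exists [set q : R * R * R | family_dom phi q.1]; split=> //; first exact: slab_relopen.
have gD : approachable [set q : R * R * R | family_dom phi q.1].
  exact: approachable_relopen (slab_relopen rA) slab_approachable.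
have [||C1 C2 C3] := @family_lag_regular phi mphi _ [set q : R * R * R | family_dom phi q.1]
  fst snd 0 gD (fun q Dq => Dq).
- move=> W g Cg; apply: (@Ck_on_affine _ _ _ _ _ (family_dom phi) g fst fst) => //.
  by move=> q; exact: cvg_fst.
- split=> //; apply: continuous_subspaceT => q; exact: cvg_snd.
split.
- by apply: Ck_on_eq C1 => -[].
- by apply: Ck_on_eq C2 => -[].
- by apply: Ck_on_eq C3 => -[].
Qed.

Lemma lift_smooth (z : R * R -> R) (z0 : R) :
  (forall s t, - e < s < e -> I01 t ->
    has_derive I01 (fun t => z (s, t)) t 1 (family_lag (s, t, z (s, t)))) ->
  (forall s, - e < s < e -> z (s, 0) = z0) ->
  smooth_on (strip e) z.
Proof.
move=> Hz z0E; have [cG cGs cGz] := family_lag_cont.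
apply: (@solution_smooth R e family_lag family_lag_s family_lag_z z z0) => //.
- move=> [p x] Sp; have [phi mphi Ap] := family_dom_cover Sp.
  by have [d _] := family_lag_derive_z mphi x Ap; exact: DeriveDef.
- move=> [p x] Sp; have [phi mphi Ap] := family_dom_cover Sp.
  by have [d _] := family_lag_derive_s mphi x Ap; exact: DeriveDef.
- move=> k Cz.
  have H p : strip e p -> exists B, [/\ relopen (strip e) B, B p &
     [/\ Ck_on k B (fun p => family_lag (p, z p)),
     Ck_on k B (fun p => family_lag_s (p, z p)) & Ck_on k B (fun p => family_lag_z (p, z p))]].
    move=> Sp; have [phi mphi Ap] := family_dom_cover Sp.
    have rA := family_dom_relopen mphi.
    exists (family_dom phi); split=> //.
    apply: (@family_lag_regular phi mphi _ (family_dom phi) id z k) => //.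
    + exact: family_dom_approachable.
    + exact: (Ck_on_relopen rA Cz).
  by split; apply: Ck_on_glue => p /H[B [rB Bp [C1 C2 C3]]]; exists B.
Qed.

End lift.

(** * The contact action *)

Section contact.
Context {R : realType} {n : nat} (Q : manifold R n).
Local Notation I01 := (@closed_unit R).
Variables (L : tangent Q -> R -> R) (q0 q1 : Q) (z0 : R).
Hypothesis smoothL : smooth_lagrangian L.
Hypothesis solvable : forall c, Omega q0 q1 c -> exists z, is_solution L z0 c z.

Lemma Zmap_solution c : Omega q0 q1 c -> is_solution L z0 c (Zmap L z0 c).
Proof. by move=> /solvable; exact: xgetPex. Qed.

Lemma solution_curve c z t : is_solution L z0 c z -> I01 t ->
  has_derive I01 (fun u => z (clamp u)) t 1 (L (velocity c (clamp t)) (z (clamp t))).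
Proof.
move=> [_ /(_ (clamp t))] [+ <-]; rewrite /curve_derivable /curve_derive => + It.
by rewrite (sval_clamp It).
Qed.

Lemma N1_1 : (- 1 : R) < (0 : R) < (1 : R). Proof. by rewrite oppr_lt0 ltr01. Qed.

(** Uniqueness at parameter 0 in the constant family over []-1, 1[]. *)
Lemma solution_uniq c y z : smooth_curve c -> is_solution L z0 c y -> is_solution L z0 c z -> y = z.
Proof.
move=> sc Sy Sz; apply/funext => t; rewrite -(clampK t).
have sF := constant_family 1 sc.
have [cG cGs cGz] := family_lag_cont smoothL sF.
apply: (@solution_unique R 1 (family_lag L (fun=> c)) (family_lag_z L (fun=> c)) cG cGz _ 0
  (fun u => z (clamp u)) (fun u => y (clamp u)) N1_1) => //.
- move=> [p x] Sp; have [phi mphi Ap] := family_dom_cover (fun=> c) Sp.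
  by have [d _] := family_lag_derive_z smoothL sF mphi x Ap; exact: DeriveDef.
- by move=> u Iu; exact: solution_curve.
- by move=> u Iu; exact: solution_curve.
- by case: Sy => -> _; case: Sz.
- exact: svalI.
Qed.

Lemma Zmap_family_smooth e F : smooth_family e F -> (forall s, - e < s < e -> Omega q0 q1 (F s)) ->
  smooth_on (strip e) (fun p => Zmap L z0 (F p.1) (clamp p.2)).
Proof.
move=> sF OF; apply: (@lift_smooth R n Q L smoothL e F sF _ z0).
  by move=> s t se It; apply: solution_curve => //; apply: Zmap_solution; exact: OF.
by move=> s se /=; case: (Zmap_solution (OF _ se)).
Qed.

Lemma Zmap_smooth c : Omega q0 q1 c -> smooth_function (Zmap L z0 c).
Proof.
move=> Oc; have [sc _ _] := Oc.
have CF := Zmap_family_smooth (constant_family 1 sc) (fun s _ => Oc).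
move=> k; have := Ck_on_slice N1_1 (relopen_refl (strip 1)) (CF k).
by apply: Ck_on_relopen; apply: relopen_sub (relopen_refl _) _ _ => t It; [split=> //; exact: N1_1|case: It].
Qed.

Lemma IdZ_Omega_N c : Omega q0 q1 c -> Omega_N L q0 q1 z0 (IdZ L z0 c).
Proof.
move=> Oc; have [sc c0 c1] := Oc; have [Z0 Hz] := Zmap_solution Oc.
split; first by split=> //; exact: Zmap_smooth.
by move=> t; case: (Hz t).
Qed.

Lemma Omega_N_solution cb : Omega_N L q0 q1 z0 cb -> Omega q0 q1 cb.1 /\ is_solution L z0 cb.1 cb.2.
Proof.
move=> [[sc sz c0 c1 z0E] HN]; split; first by split.
split=> // t; split; last exact: HN.
exact: (Ck_on_derivable (sz 1) (svalI t)).
Qed.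

Lemma Omega_N_IdZ cb : Omega_N L q0 q1 z0 cb -> IdZ L z0 cb.1 = cb.
Proof.
move=> /Omega_N_solution[Oc Sz]; have [sc _ _] := Oc.
rewrite /IdZ (solution_uniq sc (Zmap_solution Oc) Sz); by case: cb {Oc Sz sc}.
Qed.

(** The fundamental theorem of calculus; C^1 regularity up to the end points makes the integrand
    continuous on [[0, 1]]. *)
Lemma bar_action_endpoints (cb : bar_curve Q) : smooth_function cb.2 ->
  bar_action cb = cb.2 (clamp 1) - cb.2 (clamp 0).
Proof.
move=> sz; set z := cb.2 in sz *.
pose f (t : R) := curve_derive z (clamp t).
have fE t : I01 t -> f t = derive_in I01 (fun u => z (clamp u)) t 1.
  by move=> It; rewrite /f /curve_derive (sval_clamp It).
have IE : I01 = `[0, 1]%classic by apply/seteqP; split => t; rewrite /= in_itv.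
have cf : {within `[0, 1], continuous f}.
  rewrite -IE; apply: (@cont_eq _ _ _ _ (fun t => derive_in I01 (fun u => z (clamp u)) t 1)).
    by move=> t It; rewrite fE.
  exact: Ck_on_cont (Ck_on_derive (1 : R) (sz 1)).
have cz : {within `[0, 1], continuous (fun u => z (clamp u))}.
  by rewrite -IE; exact: Ck_on_cont (sz 0).
have dz (t : R) : 0 < t < 1 -> is_derive t (1 : R) (fun u => z (clamp u)) (f t).
  move=> t01; have It : I01 t by case/andP: t01 => *; rewrite /closed_unit /= !ltW.
  by apply: has_derive_interior => //; rewrite fE //; exact: (Ck_on_has (sz 1) It).
have /(continuous_within_itvP _ ltr01) [_ c0 c1] := cz.
have D : derivable_oo_LRcontinuous (fun u => z (clamp u)) 0 1.
  by split=> // t; rewrite in_itv /= => /dz[].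
have F : {in `]0, 1[, (fun u => z (clamp u))^`()%classic =1 f}.
  by move=> t; rewrite in_itv /= => /dz[_ <-]; rewrite derive1E.
rewrite /bar_action /Rintegral -/z.
have -> : (\int[lebesgue_measure]_(t in I01) (curve_derive z (clamp t))%:E)%E =
   (\int[lebesgue_measure]_(t in `[0%R, 1%R]) (f t)%:E)%E by rewrite IE.
by rewrite (continuous_FTC2 ltr01 cf D F).
Qed.

Lemma bar_action_Omega_N cb : Omega_N L q0 q1 z0 cb -> bar_action cb = contact_action L z0 cb.1.
Proof.
move=> Ncb; have [[_ sz _ _ _] _] := Ncb; rewrite (bar_action_endpoints sz).
by have := Omega_N_IdZ Ncb; rewrite /contact_action => {1 2}<-.
Qed.

Lemma near_strip (e : R) : 0 < e -> \forall s \near (0 : R), - e < s < e.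
Proof.
move=> e0; apply/nbhs_ballP; exists e => // s; rewrite -ball_normE /ball_ /= sub0r normrN.
by rewrite ltr_norml.
Qed.

Lemma critical_Omega_N cb : Omega_N L q0 q1 z0 cb ->
  critical_point (Omega_N L q0 q1 z0) (@smooth_bar_family R n Q) (@bar_action R n Q) cb <->
  critical_point (Omega q0 q1) (@smooth_family R n Q) (contact_action L z0) cb.1.
Proof.
move=> Ncb; split=> -[_ H]; split.
- by have [] := Omega_N_solution Ncb.
- move=> e F e0 OF F0 sF.
  have := H e (fun s => IdZ L z0 (F s)) e0 (fun s se => IdZ_Omega_N (OF s se)).
  rewrite F0 (Omega_N_IdZ Ncb) => /(_ erefl) H1.
  have /H1 : smooth_bar_family e (fun s => IdZ L z0 (F s)).
    by split=> //; exact: Zmap_family_smooth.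
  (* Members of the family with [s] outside []-e, e[] are unconstrained, so the two actions agree
     only near [s = 0], which suffices for the derivative. *)
  apply: near_eq_is_derive; apply: filterS (near_strip e0) => s se.
  by rewrite (bar_action_Omega_N (IdZ_Omega_N (OF s se))).
- by [].
- move=> e F e0 OF F0 [sF _].
  have := H e (fun s => (F s).1) e0 (fun s se => (Omega_N_solution (OF s se)).1).
  rewrite F0 => /(_ erefl sF); apply: near_eq_is_derive.
  by apply: filterS (near_strip e0) => s se; rewrite (bar_action_Omega_N (OF s se)).
Qed.

Lemma IdZ_bij : set_bij (Omega q0 q1) (Omega_N L q0 q1 z0) (IdZ L z0).
Proof.
split.
- by move=> c; exact: IdZ_Omega_N.
- by move=> c c' _ _ [].
- move=> cb Ncb; exists cb.1; last exact: Omega_N_IdZ.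
  by have [] := Omega_N_solution Ncb.
Qed.

End contact.

(** * Bump variations *)

Section bump.
Context {R : realType}.

(** Here [B] need not be relatively open in [A]: a derivative within [A] restricts to [B], and
    approachability of [B] keeps it unique. It restricts bump functions from the line to
    [[0, 1]]. *)
Lemma Ck_on_sub (V W : normedModType R) k (A B : set V) (f : V -> W) :
  approachable A -> approachable B -> B `<=` A -> Ck_on k A f -> Ck_on k B f.
Proof.
move=> gA gB BA; elim: k f => [|k IH] f Cf.
  by split=> //; apply: continuous_subspaceW (Ck_on_cont Cf).
apply: (@Ck_onS _ _ _ _ _ _ (fun v x => derive_in A f x v)) => //.
- by apply: continuous_subspaceW (Ck_on_cont Cf).
- by move=> v x Bx; apply: (has_derive_sub BA); exact: (Ck_on_has Cf (BA _ Bx)).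
- by move=> v; exact: (IH _ (Ck_on_derive v Cf)).
Qed.

(* The derivative of [flat m] is a combination of [flat m.+1] and [flat m.+2],
   which gives smoothness of all of them by one induction. *)
Definition flat (m : nat) (x : R) : R :=
  if 0 < x then x^-1 ^+ m * expR (- x^-1) else 0.

(** The exponential series at [1 / x] dominates its term of degree [m + 2]; this leaves a factor
    [x ^+ 2], hence derivative 0 at the origin. *)
Lemma flat_bound m x : `|flat m x| <= (m.+2)`!%:R * x ^+ 2.
Proof.
rewrite /flat; case: ifPn => [x0|_]; last by rewrite normr0 mulr_ge0 // sqr_ge0.
have y0 : 0 < x^-1 by rewrite invr_gt0.
rewrite ger0_norm; last by rewrite mulr_ge0 ?expR_ge0 // exprn_ge0 // ltW.
have E0 := expR_gt0 x^-1; have F0 : 0 < ((m.+2)`!%:R : R) by rewrite ltr0n fact_gt0.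
have := expR_ge1Dxn m.+1 (ltW y0) => H.
have {}H : x^-1 ^+ m.+2 <= (m.+2)`!%:R * expR x^-1.
  rewrite mulrC -ler_pdivrMr //; apply: le_trans H; by rewrite lerDr.
rewrite expRN ler_pdivrMr // mulrAC; rewrite -ler_pdivrMr ?exprn_gt0 //.
by rewrite -exprVn -exprD addn2.
Qed.

Lemma flat_derive m x :
  has_derive setT (flat m) x 1 (- m%:R * flat m.+1 x + flat m.+2 x).
Proof.
have [x0|x0|<-] := ltgtP 0 x.
- have oP : open [set y : R | 0 < y] by exact: open_gt.
  rewrite -(has_derive_relopen _ _ _ (open_relopen oP (@subsetT _ _))) //.
  pose g y : R := y^-1 ^+ m * expR (- y^-1).
  apply: (@has_derive_eq _ _ _ _ g) => //; first by move=> y y0; rewrite /g /flat y0.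
  have xn0 : x != 0 by rewrite gt_eqF.
  have Hi : has_derive setT (fun y : R => y^-1) x 1 (- x ^- 2).
    apply: is_derive_has; have dI : derivable (id : R -> R) x 1 by exact: derivable_id.
    apply: DeriveDef; first exact: (derivableV xn0 dI).
    by rewrite (deriveV xn0 dI) derive_id /GRing.scale /= mulr1.
  have HX : is_derive x^-1 (1 : R) (fun u : R => u ^+ m) (m%:R * x^-1 ^+ m.-1).
    apply: DeriveDef; first exact: exprn_derivable.
    by rewrite exp_derive /GRing.scale /= mulr1.
  have H := has_deriveM (has_derive_outer Hi HX)
    (has_derive_outer (has_deriveN Hi) (is_derive_expR (- x^-1))).
  move: (has_derive_sub (@subsetT _ [set y : R | 0 < y]) H).
  congr has_derive; rewrite /flat x0 -exprVn; case: (m) => [|k]; first by rewrite !mul0r !mulr0; ring.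
  by rewrite succnK !exprS; ring.
- have oP : open [set y : R | y < 0] by exact: open_lt.
  rewrite -(has_derive_relopen _ _ _ (open_relopen oP (@subsetT _ _))) //.
  apply: (@has_derive_eq _ _ _ _ (fun=> 0)) => //.
    by move=> y /= y0; rewrite /flat ltNge ltW.
  rewrite /flat ltNge ltW //= mulr0 addr0; exact: has_derive_cst.
rewrite /flat ltxx mulr0 addr0; apply/has_deriveP => e e0.
have C0 : 0 < ((m.+2)`!%:R : R) by rewrite ltr0n fact_gt0.
exists (e / (m.+2)`!%:R); first by rewrite divr_gt0.
move=> h h0 hd _; rewrite addr0 scaler0 subr0 ltxx subr0.
have -> : h *: (1 : R) = h by rewrite /GRing.scale /= mulr1.
apply: le_trans (flat_bound m h) _.
rewrite -[h ^+ 2]ger0_norm ?sqr_ge0 // normrX expr2 mulrA; apply: ler_wpM2r => //.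
by rewrite mulrC -ler_pdivlMr // ltW.
Qed.

Lemma flat_smooth m : smooth_on setT (flat m).
Proof.
have H k : forall m, Ck_on k setT (flat m).
  elim: k => [|k IH] {}m.
    by split=> //; apply: has_derive_cont => x _; exact: flat_derive.
  apply: (@Ck_onS _ _ _ _ _ _ (fun v x : R => v * (- m%:R * flat m.+1 x + flat m.+2 x))).
  - exact: approachableT.
  - by apply: has_derive_cont => x _; exact: flat_derive.
  - move=> v x _; have := has_derive_dir (c := v) (@flat_derive m x).
    by rewrite /GRing.scale /= mulr1.
  - move=> v; apply: Ck_onM; [exact: approachableT|by apply: Ck_on_cst; exact: approachableT|].
    apply: Ck_onD; [exact: approachableT| |exact: IH].
    by apply: Ck_onM; [exact: approachableT|by apply: Ck_on_cst; exact: approachableT|exact: IH].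
by move=> k; exact: H.
Qed.

(** A smooth function that is positive exactly on []a, b[]; its values stay below 1, which bounds
    the displacement in the variation. *)
Definition bump (a b x : R) : R := flat 0 (x - a) * flat 0 (b - x).

Lemma flat0_ge0 x : 0 <= flat 0 x.
Proof. by rewrite /flat; case: ifP => // _; rewrite expr0 mul1r expR_ge0. Qed.

Lemma flat0_le1 x : flat 0 x <= 1.
Proof.
rewrite /flat; case: ifPn => // x0; rewrite expr0 mul1r -expR0 ler_expR oppr_le0.
by rewrite invr_ge0 ltW.
Qed.

Lemma bump_ge0 a b x : 0 <= bump a b x.
Proof. by rewrite mulr_ge0 // flat0_ge0. Qed.

Lemma bump_le1 a b x : bump a b x <= 1.
Proof. by rewrite mulr_ile1 ?flat0_ge0 ?flat0_le1. Qed.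

Lemma bump_gt0 a b x : a < x < b -> 0 < bump a b x.
Proof.
move=> /andP[ax xb]; rewrite /bump /flat !subr_gt0 ax xb !expr0 !mul1r.
by rewrite mulr_gt0 // expR_gt0.
Qed.

Lemma bump_out a b x : ~~ (a < x < b) -> bump a b x = 0.
Proof.
rewrite negb_and /bump /flat !subr_gt0 => /orP[/negbTE->|/negbTE->]; by rewrite ?mul0r ?mulr0.
Qed.

Lemma bump_smooth a b : smooth_on setT (bump a b).
Proof.
move=> k; apply: Ck_onM; first exact: approachableT.
- apply: (@Ck_on_affine R R^o R^o R^o k setT (flat 0) (fun x => x - a) id).
  + exact: approachableT.
  + by move=> x; apply: cvgB; [exact: cvg_id|exact: cvg_cst].
  + by move=> h v x; rewrite addrA.
  + exact: flat_smooth.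
- apply: (@Ck_on_affine R R^o R^o R^o k setT (flat 0) (fun x => b - x) -%R).
  + exact: approachableT.
  + by move=> x; apply: cvgB; [exact: cvg_cst|exact: cvg_id].
  + by move=> h v x; rewrite scalerN opprD addrCA.
  + exact: flat_smooth.
Qed.

End bump.

Lemma Ck_on_fst (R : realType) (A : set (R * R)) k : approachable A -> Ck_on k A (fst : R * R -> R).
Proof.
move=> gA; have c1 : {within A, continuous (fst : R * R -> R)}.
  by apply: continuous_subspaceT => p; exact: cvg_fst.
case: k => [|k]; first by split.
apply: (@Ck_onS _ _ _ _ _ _ (fun v _ : R * R => v.1)) => //.
  move=> v x _; apply/has_deriveP => e e0; exists 1 => // h _ _ _ /=.
  by rewrite addrK subrr normr0 mulr_ge0 // ltW.
by move=> v; exact: Ck_on_cst.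
Qed.

(** * Variation of a curve inside a chart *)

Section variation.
Context {R : realType} {n : nat} (Q : manifold R n).
Local Notation rV := ('rV[R]_n).
Local Notation I01 := (@closed_unit R).
Local Notation rfr := (row_frame (R := R) n).
Variables (c : unit_interval R -> Q) (phi : chart R n Q) (a b : R) (d : rV).
Hypothesis sc : smooth_curve c.
Hypothesis mphi : max_atlas phi.
Hypothesis a0 : 0 < a.
Hypothesis b1 : b < 1.
Hypothesis abphi : forall t : R, a <= t <= b -> dom phi (c (clamp t)).

(** The case distinction is essential: off []a, b[] the curve may leave the chart, where [coord phi]
    and [point phi] carry no information. *)
Definition bump_variation (s : R) (u : unit_interval R) : Q :=
  if a < sval u < b then point phi (coord phi (c u) + (s * bump a b (sval u)) *: d)
  else c u.

(** The chart image is open and the arc over [[a, b]] is compact, so one radius serves for all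
    times; outside [[a, b]] the property is vacuous. *)
Lemma chart_tube : exists2 r, 0 < r & forall t x, I01 t -> a <= t <= b ->
  `|x - coord phi (c (clamp t))| < r -> img phi x.
Proof.
have [] := @unit_tube R (fun r t => a <= t <= b -> forall x,
  `|x - coord phi (c (clamp t))| < r -> img phi x).
- move=> r r' t /andP[_ rr'] H abt x xr; apply: H => //; exact: lt_le_trans rr'.
- move=> t0 It0; have [abt0|abt0] := pselect (a <= t0 <= b); last first.
    have [t0a|at0] := ltP t0 a.
      exists (a - t0); first by rewrite subr_gt0.
      move=> t _; rewrite ltr_norml => /andP[_ h] /andP[h' _]; lra.
    have bt0 : b < t0 by rewrite ltNge; apply/negP => tb; apply: abt0; rewrite at0.
    exists (t0 - b); first by rewrite subr_gt0.
    move=> t _; rewrite ltr_norml => /andP[h _] /andP[_ h']; lra.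
  have [rD CD] := smooth_into_chart sc mphi.
  set D := chart_dom _ _ _ in rD CD.
  have Dt0 : D t0 by split=> //; exact: abphi.
  have oI := @img_open _ _ _ phi.
  have Ix : img phi (coord phi (c (clamp t0))) by exists (c (clamp t0)) => //; exact: abphi.
  have /nbhs_ballP [r /= r0 Hr] := open_nbhs_nbhs (conj oI Ix).
  have /subspace_continuousP /(_ _ Dt0) /cvgrPdist_lt := Ck_on_cont (CD 0).
  have r2 : 0 < r / 2 by rewrite divr_gt0.
  move=> /(_ _ r2) H.
  have H' : \forall t \near t0, D t -> `|coord phi (c (clamp t0)) - coord phi (c (clamp t))| < r / 2.
    exact: H.
  move: H' => /nbhs_ballP[r1 /= r10 Hr1].
  exists (Num.min r1 (r / 2)); first by rewrite lt_min r10.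
  move=> t It; rewrite lt_min => /andP[tr _] abt x; rewrite lt_min => /andP[_ xr].
  apply: Hr; rewrite -ball_normE /ball_ /=.
  have Dt : D t by split=> //; exact: abphi.
  have h1 := Hr1 t; rewrite -ball_normE /ball_ /= distrC in h1; have {}h1 := h1 tr Dt.
  rewrite (_ : _ - x = (coord phi (c (clamp t0)) - coord phi (c (clamp t)))
     - (x - coord phi (c (clamp t)))); last by rewrite opprB addrA subrK.
  apply: le_lt_trans (ler_normB _ _) _.
  by rewrite [ltRHS](_ : r = r / 2 + r / 2); [exact: ltrD|field].
by move=> r r0 H; exists r => // t x It abt; exact: H.
Qed.

Lemma bump_variation_smooth : exists2 e, 0 < e &
  [/\ smooth_family e bump_variation,
      (forall u, bump_variation 0 u = c u),
      (forall s u, ~~ (a < sval u < b) -> bump_variation s u = c u) &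
      forall s t, - e < s < e -> I01 t -> dom phi (c (clamp t)) ->
        dom phi (bump_variation s (clamp t)) /\
        coord phi (bump_variation s (clamp t)) =
        coord phi (c (clamp t)) + (s * bump a b t) *: d].
Proof.
have [r r0 Hr] := chart_tube.
have N0 : 0 < `|d| + 1 by rewrite ltr_wpDl.
(* As the bump is at most 1, [|s| < e] keeps the displaced point within [r] of the curve, hence in
   the chart image. *)
pose e := r / (`|d| + 1); have e0 : 0 < e by rewrite divr_gt0.
have Vout s u : ~~ (a < sval u < b) -> bump_variation s u = c u.
  by rewrite /bump_variation => /negbTE->.
have Vin s t : - e < s < e -> I01 t -> dom phi (c (clamp t)) ->
    dom phi (bump_variation s (clamp t)) /\
    coord phi (bump_variation s (clamp t)) = coord phi (c (clamp t)) + (s * bump a b t) *: d.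
  move=> se It pt; have [abt|abt] := boolP (a < t < b); last first.
    by rewrite Vout ?(sval_clamp It) // bump_out // mulr0 scale0r addr0.
  rewrite /bump_variation (sval_clamp It) abt.
  have [q pq <-] : img phi (coord phi (c (clamp t)) + (s * bump a b t) *: d).
    apply: (Hr t) => //; first by case/andP: abt => *; rewrite !ltW.
    rewrite addrAC subrr add0r normrZ normrM (ger0_norm (bump_ge0 _ _ _)).
    apply: (@le_lt_trans _ _ (`|s| * `|d|)).
      by apply: ler_wpM2r => //; rewrite ler_piMr // bump_le1.
    have se' : `|s| < e by rewrite ltr_norml.
    apply: (@le_lt_trans _ _ (`|s| * (`|d| + 1))); first by apply: ler_wpM2l => //; rewrite lerDl.
    by rewrite -ltr_pdivlMr.
  by rewrite coordK.
exists e => //; split=> //; last first.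
  move=> u; rewrite /bump_variation; case: ifPn => // abu.
  rewrite mul0r scale0r addr0 coordK //; rewrite -(clampK u); apply: abphi.
  by case/andP: abu => *; rewrite !ltW.
apply: smooth_into_local; first exact: approachable_strip.
move=> [s0 t0] [/= s0e It0].
(* Where the curve is in the chart, the coordinate formula holds nearby, also off the support since
   the bump is 0 there. Otherwise [t0] lies outside [[a, b]] and the family is constant in [s] near
   that time. *)
have [pt0|npt0] := pselect (dom phi (c (clamp t0))).
  have [rD CD] := smooth_into_chart sc mphi.
  set D := chart_dom _ _ _ in rD CD.
  have rS := time_relopen e rD; set S := [set _ | _] in rS.
  exists S, phi; split=> //.
  - by move=> [s t] [[/= se It] [_ pt]]; have [] := Vin s t se It pt.
  - have gS : approachable S by apply: approachable_relopen rS (@approachable_strip R e).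
    have gI := approachable_unit (R := R).
    move=> k; apply: (@Ck_on_eq _ _ _ _ _ (fun p : R * R => coord phi (c (clamp p.2)) + (p.1 * bump a b p.2) *: d)).
      by move=> [s t] [[/= se It] [_ pt]]; have [_ ->] := Vin s t se It pt.
    have liftD (W : normedModType R) (f : R -> W) : Ck_on k D f -> Ck_on k S (fun p : R * R => f p.2).
      move=> Cf; have CC := Ck_on_time rD Cf.
      apply: Ck_on_relopen CC.
      apply: relopen_sub (relopenI (strip_relopen e) _) _ _.
      + by apply: relopen_comp rD => p; exact: cvg_snd.
      + by move=> p [_].
      + by case: rD => + _ p => /(_ p.2).
    apply: Ck_onD => //; first exact: (liftD _ _ (CD k)).
    apply: Ck_on_scaler => //; apply: Ck_onM => //.
      exact: Ck_on_fst.
    apply: (liftD R^o); apply: Ck_on_relopen rD _; apply: (@Ck_on_sub _ _ _ _ setT) => //.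
      exact: approachableT.
    exact: bump_smooth.
have nab : ~ (a <= t0 <= b) by move=> /abphi.
pose O := [set t : R | t < a] `|` [set t : R | b < t].
have oO : open O by apply: openU; [exact: open_lt|exact: open_gt].
have Ot0 : O t0.
  have [|at0] := ltP t0 a; first by left.
  by right; rewrite /= ltNge; apply/negP => tb; apply: nab; rewrite at0.
have [mchi ct0] := chart_atP (c (clamp t0)); set chi := chart_at _ in mchi ct0.
have [rD CD] := smooth_into_chart sc mchi.
set D := chart_dom _ _ _ in rD CD.
have rDO : relopen I01 (D `&` O).
  by apply: relopen_trans rD _; exact: relopenIo.
have rS := time_relopen e rDO; set S := [set _ | _] in rS.
have outO t : O t -> ~~ (a < t < b).
  by rewrite negb_and -!leNgt => -[/= /ltW->|/= /ltW->]; rewrite ?orbT.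
exists S, chi; split=> //.
- by move=> [s t] [[/= se It] [[_ ct] Ot]]; rewrite Vout // (sval_clamp It) outO.
- move=> k; apply: (@Ck_on_eq _ _ _ _ _ (fun p : R * R => coord chi (c (clamp p.2)))).
    by move=> [s t] [[/= se It] [_ Ot]]; rewrite Vout // (sval_clamp It) outO.
  have Ck : Ck_on k (D `&` O) (fun u => coord chi (c (clamp u))).
    by apply: Ck_on_relopen (CD k); exact: relopenIo.
  apply: Ck_on_relopen (Ck_on_time rDO Ck).
  apply: relopen_sub (relopenI (strip_relopen e) _) _ _.
  + by apply: relopen_comp rDO => p; exact: cvg_snd.
  + by move=> p [_].
  + by case: rDO => + _ p => /(_ p.2).
Qed.

End variation.

(** * First variation and the Herglotz equations *)

Section linearity.
Context {R : realType} (E F : normedModType R) (I J : finType) (fr : frame E I) (fr' : frame F J).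

Lemma derive_in_coord (V : normedModType R) (A : set V) (g : V -> F) x v j : approachable A ->
  A x -> Ck_on 1 A g ->
  derive_in A (fun y => fcoord fr' j (g y)) x v = fcoord fr' j (derive_in A g x v).
Proof.
move=> gA Ax Cg; apply: approachable_lim => //; apply: has_derive_coord.
exact: (Ck_on_has Cg Ax).
Qed.

Lemma derive_in_linear (B : set E) (f : E -> F) p (a : R) u v : open B -> Ck_on 1 B f -> B p ->
  derive_in B f p (a *: u + v) = a *: derive_in B f p u + derive_in B f p v.
Proof.
move=> oB Cf Bp; have gB := approachable_open oB.
rewrite -[LHS](fcoordK fr') -[RHS](fcoordK fr'); apply: eq_bigr => j _; congr (_ *: _).
have Cj : Ck_on 1 B (fun y => fcoord fr' j (f y)) by exact: Ck_on_coord.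
rewrite fcoord_linear -!(derive_in_coord _ _ gB Bp Cf) !(derive_in_sum fr oB _ Cj Bp).
rewrite mulr_sumr -big_split /=; apply: eq_bigr => i _.
by rewrite fcoord_linear mulrDl mulrA.
Qed.

End linearity.

(** Only the values along two lines matter, so functions on different spaces can be compared; this
    serves to compare local representatives in two charts. *)
Lemma derive_eq_along (R : realType) (V V' W : normedModType R) (f : V -> W) (g : V' -> W) a l b m :
  (forall h : R, f (h *: l + a) = g (h *: m + b)) -> 'D_l f a = 'D_m g b.
Proof.
move=> fg; rewrite /derive.
suff -> : (fun h : R => h^-1 *: ((f \o shift a) (h *: l) - f a)) =
  (fun h : R => h^-1 *: ((g \o shift b) (h *: m) - g b)) by [].
apply/funext => h; congr (_ *: (_ - _)); first exact: fg.
by have := fg 0; rewrite !scale0r !add0r.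
Qed.

(** * Herglotz defect, momentum pairing and the variation of the action *)

Section first_variation.
Context {R : realType} {n : nat} (Q : manifold R n).
Local Notation rV := ('rV[R]_n).
Local Notation E := (rV * rV * R)%type.
Local Notation I01 := (@closed_unit R).
Local Notation rfr := (row_frame (R := R) n).
Local Notation jfr := (jet_frame (R := R) n).
Variables (L : tangent Q -> R -> R).
Hypothesis smoothL : smooth_lagrangian L.

Local Notation e_ i := (delta_mx ord0 i : rV).

Definition along phi (c : unit_interval R -> Q) (zc : unit_interval R -> R) (u : unit_interval R) : E :=
  (coord phi (c u), curve_derive (fun w => coord phi (c w)) u, zc u).

Definition momentum phi c zc (i : 'I_n) (u : unit_interval R) : R :=
  'D_((0, e_ i, 0) : E) (local_rep L phi) (along phi c zc u).

Definition force phi c zc (i : 'I_n) (u : unit_interval R) : R :=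
  'D_((e_ i, 0, 0) : E) (local_rep L phi) (along phi c zc u).

Definition slope phi c zc (u : unit_interval R) : R :=
  'D_((0, 0, 1) : E) (local_rep L phi) (along phi c zc u).

(** The component [H_i] of the overview in the chart [phi], as a function of a real time. *)
Definition defect phi c zc (i : 'I_n) (t : R) : R :=
  derive_in I01 (fun u => momentum phi c zc i (clamp u)) t 1
  - force phi c zc i (clamp t) - momentum phi c zc i (clamp t) * slope phi c zc (clamp t).

Lemma herglotz_defect c zc : herglotz L (c, zc) <->
  forall phi, max_atlas phi -> forall t, I01 t -> dom phi (c (clamp t)) ->
    forall i, defect phi c zc i t = 0.
Proof.
have dE phi i t : I01 t -> defect phi c zc i t = curve_derive (momentum phi c zc i) (clamp t)
    - force phi c zc i (clamp t) - momentum phi c zc i (clamp t) * slope phi c zc (clamp t).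
  by move=> It; rewrite /defect /curve_derive (sval_clamp It).
split=> H phi mphi t.
- move=> It pt i; have E1 : curve_derive (momentum phi c zc i) (clamp t)
    - force phi c zc i (clamp t) = momentum phi c zc i (clamp t) * slope phi c zc (clamp t).
    exact: (H phi mphi (clamp t) pt i).
  by rewrite (dE _ _ _ It) E1 subrr.
- move=> pt i; have := H phi mphi (sval t) (svalI t); rewrite clampK => /(_ pt i).
  by rewrite (dE _ _ _ (svalI t)) clampK => /subr0_eq.
Qed.

Section along_curve.
Variables (c : unit_interval R -> Q) (zc : unit_interval R -> R) (phi : chart R n Q).
Hypothesis sc : smooth_curve c.
Hypothesis szc : smooth_function zc.
Hypothesis mphi : max_atlas phi.
Local Notation D := (chart_dom I01 (fun u => c (clamp u)) phi).
Local Notation Lp := (local_rep L phi).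

Lemma along_dom_relopen : relopen I01 D.
Proof. by have [] := smooth_into_chart sc mphi. Qed.

Lemma along_dom_approachable : approachable D.
Proof. exact: approachable_relopen along_dom_relopen (@approachable_unit R). Qed.

Lemma along_smooth : smooth_on D (fun u => along phi c zc (clamp u)).
Proof.
have [rD CD] := smooth_into_chart sc mphi.
move=> k; apply: Ck_on_jet; first exact: along_dom_approachable.
- exact: CD.
- apply: Ck_on_eq (Ck_on_derive (1 : R) (CD k.+1)) => u Du.
  rewrite /curve_derive sval_clamp; last by case: Du.
  exact: derive_in_relopen.
- exact: (Ck_on_relopen rD (szc k)).
Qed.

Lemma along_jet_dom u : D u -> jet_dom phi (along phi c zc (clamp u)).
Proof. by move=> [_ pu]; exists (c (clamp u)). Qed.

Lemma partial_along_smooth (l : E) :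
  smooth_on D (fun u => 'D_l Lp (along phi c zc (clamp u))).
Proof.
move=> k; have oB := @jet_dom_open R n Q phi.
exact: (Ck_on_lagrangian oB along_dom_approachable (smooth_partial oB (smoothL mphi) l)
  along_jet_dom (along_smooth k)).
Qed.

Lemma momentum_derive i u : D u ->
  has_derive I01 (fun u => momentum phi c zc i (clamp u)) u 1
    (derive_in I01 (fun u => momentum phi c zc i (clamp u)) u 1).
Proof.
move=> Du; have rD := along_dom_relopen.
rewrite -(has_derive_relopen _ _ _ rD Du) -(derive_in_relopen _ _ rD Du).
exact: (Ck_on_has (partial_along_smooth ((0, e_ i, 0) : E) 1) Du).
Qed.

Lemma defect_cont i : {within D, continuous (defect phi c zc i)}.
Proof.
have rD := along_dom_relopen; have gD := along_dom_approachable.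
apply: (@cont_eq _ _ _ _ (fun t =>
  derive_in D (fun u => momentum phi c zc i (clamp u)) t 1
  - force phi c zc i (clamp t) - momentum phi c zc i (clamp t) * slope phi c zc (clamp t))).
  by move=> t Dt; rewrite (derive_in_relopen _ _ rD Dt).
have C1 := Ck_on_derive (1 : R) (partial_along_smooth ((0, e_ i, 0) : E) 1).
have C2 := partial_along_smooth ((e_ i, 0, 0) : E) 0.
have C3 := partial_along_smooth ((0, e_ i, 0) : E) 0.
have C4 := partial_along_smooth ((0, 0, 1) : E) 0.
have neg (f : R -> R) : {within D, continuous f} -> {within D, continuous (fun t => - f t)}.
  by move=> cf t; apply: cvgN; exact: cf.
apply: cont_in_add; [apply: cont_in_add|apply: neg; apply: cont_in_mul].
- exact: Ck_on_cont C1.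
- apply: neg; exact: Ck_on_cont C2.
- exact: Ck_on_cont C3.
- exact: Ck_on_cont C4.
Qed.

End along_curve.

Section variation_formula.
Variables (q0 q1 : Q) (z0 : R).
Hypothesis solvable : forall c, Omega q0 q1 c -> exists z, is_solution L z0 c z.
Variables (e : R) (F : R -> unit_interval R -> Q).
Hypothesis e0 : 0 < e.
Hypothesis sF : smooth_family e F.
Hypothesis OF : forall s, - e < s < e -> Omega q0 q1 (F s).
Local Notation zF := (fun p : R * R => Zmap L z0 (F p.1) (clamp p.2)).
Local Notation c := (F 0).
Local Notation zc := (Zmap L z0 (F 0)).

Lemma zero_in_strip : - e < 0 < e. Proof. by rewrite oppr_lt0 e0. Qed.

Lemma base_smooth : smooth_curve c.
Proof. exact: smooth_family_curve sF zero_in_strip. Qed.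

Definition lag_z (t : R) : R := 'D_1 (fun x : R => L (velocity c (clamp t)) x) (zc (clamp t)).

Definition variation_vec phi (t : R) : rV :=
  derive_in (strip e) (family_pos F phi) (0, t) (1, 0).

(* The pairing <L_qdot, xi> does not depend on the chart, see
   [momentum_pairing_chart]; here it is computed in a chart that varies with [t],
   to have it on all of [0, 1]. *)
Definition momentum_pairing (t : R) : R :=
  let phi := chart_at (c (clamp t)) in
  'D_((0, variation_vec phi t, 0) : E) (local_rep L phi) (along phi c zc (clamp t)).

Lemma lag_z_cont : {within I01, continuous lag_z}.
Proof.
have [_ _ cGz] := family_lag_cont smoothL sF.
have cz : {within I01, continuous (fun u => zc (clamp u))}.
  apply: Ck_on_cont (_ : Ck_on 0 _ _).
  exact: (Zmap_smooth smoothL solvable (OF zero_in_strip) 0).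
exact: (cont_graph zero_in_strip cGz cz).
Qed.

Section in_chart.
Variable phi : chart R n Q.
Hypothesis mphi : max_atlas phi.
Local Notation Lp := (local_rep L phi).
Local Notation D := (chart_dom I01 (fun u => c (clamp u)) phi).
Local Notation A := (family_dom e F phi).

Lemma base_family_dom u : D u -> A (0, u).
Proof. by move=> [Iu pu]; split=> //; split=> //; exact: zero_in_strip. Qed.

Lemma variation_vecE u : D u -> variation_vec phi u = derive_in A (family_pos F phi) (0, u) (1, 0).
Proof.
move=> Du; symmetry; apply: derive_in_relopen; first exact: family_dom_relopen.
exact: base_family_dom.
Qed.

Lemma base_jet u : D u -> family_jet e F phi (0, u, zc (clamp u)) = along phi c zc (clamp u).
Proof.
move=> Du; rewrite /along (family_curve_derive sF mphi (base_family_dom Du)) //.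
Qed.

Lemma pairing_sum u : D u ->
  'D_((0, variation_vec phi u, 0) : E) Lp (along phi c zc (clamp u)) =
  \sum_i variation_vec phi u ord0 i * momentum phi c zc i (clamp u).
Proof.
move=> Du; exact: (derive_jet_vel (@jet_dom_open R n Q phi) (smoothL mphi) _ (along_jet_dom zc Du)).
Qed.

Lemma lag_z_chart u : D u -> lag_z u = slope phi c zc (clamp u).
Proof.
move=> Du; have H := family_lag_z_chart smoothL sF mphi (zc (clamp u)) (base_family_dom Du).
by rewrite (base_jet Du) in H; exact: H.
Qed.

Lemma lag_s_chart u : D u -> family_lag_s L F (0, u, zc (clamp u)) =
  \sum_i variation_vec phi u ord0 i * force phi c zc i (clamp u) +
  \sum_i derive_in A (family_vel e F phi) (0, u) (1, 0) ord0 i * momentum phi c zc i (clamp u).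
Proof.
move=> Du; have H := family_lag_s_chart smoothL sF mphi (zc (clamp u)) (base_family_dom Du).
rewrite (base_jet Du) in H; apply: (etrans H); rewrite (variation_vecE Du).
exact: (derive_jet_pair (@jet_dom_open R n Q phi) (smoothL mphi) _ _ (along_jet_dom zc Du)).
Qed.

End in_chart.

(** The pairing differentiates [L] in the fibre direction, with position and [z] fixed. There a
    change of charts acts linearly on velocities, so it maps the line of differentiation to the
    corresponding line. *)
Lemma momentum_pairing_chart phi t : max_atlas phi -> I01 t -> dom phi (c (clamp t)) ->
  momentum_pairing t =
  'D_((0, variation_vec phi t, 0) : E) (local_rep L phi) (along phi c zc (clamp t)).
Proof.
move=> mphi It pt; rewrite /momentum_pairing; set q := c (clamp t).
have [mchi ct] := chart_atP q; set chi := chart_at q in mchi ct *.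
have oO : open (coord chi @` (dom chi `&` dom phi)) by apply: overlap_open; exact: dom_open.
have Oq : (coord chi @` (dom chi `&` dom phi)) (coord chi q) by exists q.
have CT := transition_smooth mchi mphi 1.
have vE : variation_vec phi t = 'D_(variation_vec chi t) (transition chi phi) (coord chi q).
  apply: (derive_change (A := strip e) (f := family_map F)) => //.
  - exact: approachable_strip.
  - by split=> //; exact: zero_in_strip.
have uE : curve_derive (fun w => coord phi (c w)) (clamp t) =
   'D_(curve_derive (fun w => coord chi (c w)) (clamp t)) (transition chi phi) (coord chi q).
  rewrite /curve_derive (sval_clamp It).
  by apply: (derive_change (A := I01) (f := fun u => c (clamp u))) => //;
    [exact: approachable_unit|exact: base_smooth].
rewrite /along uE vE; set v := curve_derive _ _; set xi := variation_vec chi t.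
suff H (h : R) : local_rep L chi (h *: ((0, xi, 0) : E) + (coord chi q, v, zc (clamp t))) =
  local_rep L phi (h *: ((0, 'D_xi (transition chi phi) (coord chi q), 0) : E) +
    (coord phi q, 'D_v (transition chi phi) (coord chi q), zc (clamp t))).
  exact: derive_eq_along.
rewrite !jet_scale !jet_add !scaler0 !add0r /local_rep /fst /snd (coordK ct) (coordK pt).
congr L; rewrite (tvec_change _ mchi mphi ct pt); congr tvec.
rewrite -!(derive_in_open _ _ oO Oq).
exact: (derive_in_linear rfr rfr _ _ _ oO CT Oq).
Qed.

(** Applies at the end points of any variation and, for a bump variation, at every time off the
    support. *)
Lemma pairing_zero t : I01 t -> (forall s, - e < s < e -> F s (clamp t) = c (clamp t)) ->
  forall phi, variation_vec phi t = 0.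
Proof.
move=> It Ft phi; apply: approachable_lim.
- exact: approachable_strip.
- by split=> //; exact: zero_in_strip.
- apply/has_deriveP => eps eps0; exists 1 => // h h0 _; rewrite pairZD mulr0 mulr1 addr0 add0r.
  move=> -[/= he _]; rewrite /family_pos /family_map /= (Ft _ he) subrr scaler0 subrr normr0.
  by rewrite mulr_ge0 // ltW.
Qed.

Lemma momentum_pairing_zero t : I01 t -> (forall s, - e < s < e -> F s (clamp t) = c (clamp t)) ->
  momentum_pairing t = 0.
Proof.
move=> It Ft; have [mchi ct] := chart_atP (c (clamp t)).
rewrite (momentum_pairing_chart mchi It ct) pairing_sum //.
by rewrite big1 // => i _; rewrite (pairing_zero It Ft) mxE mul0r.
Qed.

Lemma momentum_pairing_derive phi t : max_atlas phi -> I01 t -> dom phi (c (clamp t)) ->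
  has_derive I01 momentum_pairing t 1
   (\sum_i (variation_vec phi t ord0 i * derive_in I01 (fun u => momentum phi c zc i (clamp u)) t 1 +
      (derive_in (family_dom e F phi) (family_vel e F phi) (0, t) (1, 0)) ord0 i *
         momentum phi c zc i (clamp t))).
Proof.
move=> mphi It pt.
have sc := base_smooth; have szc := Zmap_smooth smoothL solvable (OF zero_in_strip).
have rD := along_dom_relopen sc mphi; set D := chart_dom _ _ _ in rD.
have Dt : D t by [].
rewrite -(has_derive_relopen _ _ _ rD Dt).
apply: (@has_derive_eq _ _ _ _ (fun u => \sum_i variation_vec phi u ord0 i * momentum phi c zc i (clamp u))) => //.
  move=> u Du; apply: (etrans (esym (pairing_sum mphi Du))).
  by case: (Du) => Iu pu; exact: (esym (momentum_pairing_chart mphi Iu pu)).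
rewrite (has_derive_relopen _ _ _ rD Dt).
apply: has_derive_sum => i _.
pose A := family_dom e F phi.
have rA := family_dom_relopen sF mphi; have gA := family_dom_approachable sF mphi.
have CA := family_pos_smooth sF mphi; have CV := family_vel_smooth sF mphi.
have A0 u : D u -> A (0, u) by exact: base_family_dom.
pose pos_i p := family_pos F phi p ord0 i.
have Cpos : smooth_on A pos_i by move=> k; exact: (Ck_on_coord rfr i gA (CA k)).
have xiE u : D u -> variation_vec phi u ord0 i = derive_in A pos_i (0, u) (1, 0).
  by move=> Du; rewrite variation_vecE // (derive_in_coord rfr _ i gA (A0 _ Du) (CA 1)).
have velE p : A p -> family_vel e F phi p ord0 i = derive_in A pos_i p (0, 1).
  by move=> Ap; rewrite (derive_in_coord rfr _ i gA Ap (CA 1)).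
(* The [s]-derivative of the velocity is the time derivative of [xi]: here the mixed partials are
   exchanged, also at times 0 and 1. *)
have vsE : derive_in A (family_vel e F phi) (0, t) (1, 0) ord0 i =
    derive_in A (fun p => derive_in A pos_i p (1, 0)) (0, t) (0, 1).
  rewrite (mixed_partials rA (A0 _ Dt) (Cpos 2)).
  apply: (etrans (esym (derive_in_coord rfr _ i gA (A0 _ Dt) (CV 1)))).
  apply: derive_in_eq; last exact: A0.
  by move=> p Ap; rewrite /= velE.
rewrite -/A vsE addrC.
apply: has_deriveM; last exact: momentum_derive.
rewrite -(has_derive_relopen _ _ _ rD Dt).
apply: (@has_derive_eq _ _ _ _ (fun u => derive_in A pos_i (0, u) (1, 0))) => //.
  by move=> u Du; rewrite xiE.
rewrite (has_derive_relopen _ _ _ rD Dt).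
apply: (@has_derive_slice R e 0 t _ A (fun p => derive_in A pos_i p (1, 0)) _ zero_in_strip rA (A0 _ Dt)).
exact: (Ck_on_has (Ck_on_derive ((1, 0) : R * R) (Cpos 2)) (A0 _ Dt)).
Qed.

Lemma first_variation : exists y : R -> R, [/\ y 0 = 0,
  is_derive (0 : R) (1 : R) (fun s => contact_action L z0 (F s)) (y 1) &
  forall phi t, max_atlas phi -> I01 t -> dom phi (c (clamp t)) ->
    has_derive I01 y t 1 (lag_z t * y t - \sum_i variation_vec phi t ord0 i * defect phi c zc i t)].
Proof.
have [cG cGs cGz] := family_lag_cont smoothL sF.
have Hz s t : - e < s < e -> I01 t ->
    has_derive I01 (fun t => zF (s, t)) t 1 (family_lag L F (s, t, zF (s, t))).
  move=> se It; exact: (solution_curve (Zmap_solution solvable (OF se)) It).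
have z0E s : - e < s < e -> zF (s, 0) = z0.
  by move=> se /=; case: (Zmap_solution solvable (OF se)).
have [w2 Hw2] := @variation_exists R e (family_lag L F) (family_lag_s L F) (family_lag_z L F)
  cGs cGz zF Hz.
have [w0 Hw] := Hw2 0 zero_in_strip; pose w t := w2 (0, t).
have dGz q : slab e q -> is_derive q.2 (1 : R) (fun x => family_lag L F (q.1, x)) (family_lag_z L F q).
  case: q => p x Sp; have [phi mphi Ap] := family_dom_cover F Sp.
  by have [d _] := family_lag_derive_z smoothL sF mphi x Ap; exact: DeriveDef.
have dGs q : slab e q -> is_derive q.1.1 (1 : R) (fun s => family_lag L F (s, q.1.2, q.2)) (family_lag_s L F q).
  case: q => p x Sp; have [phi mphi Ap] := family_dom_cover F Sp.
  by have [d _] := family_lag_derive_s smoothL sF mphi x Ap; exact: DeriveDef.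
have Hwz := @solution_has_derive R e (family_lag L F) (family_lag_s L F) (family_lag_z L F)
  cG cGs cGz dGz dGs zF z0 Hz z0E 0 1 w zero_in_strip w0 Hw (@unit1 R).
have end0 s : - e < s < e -> F s (clamp 0) = c (clamp 0).
  by move=> se; have [_ -> _] := OF se; have [_ -> _] := OF zero_in_strip.
have end1 s : - e < s < e -> F s (clamp 1) = c (clamp 1).
  by move=> se; have [_ _ ->] := OF se; have [_ _ ->] := OF zero_in_strip.
exists (fun t => w t - momentum_pairing t); split.
- by rewrite /w w0 momentum_pairing_zero ?subr0 //; exact: unit0.
- rewrite momentum_pairing_zero ?subr0 //; last exact: unit1.
  have S01 : strip e (0, 1) by split; [exact: zero_in_strip|exact: unit1].
  have H := has_derive_fst (relopen_refl (strip e)) S01 Hwz.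
  have H2 : is_derive (0 : R) (1 : R) (fun s => zF (s, 1) - z0) (w 1).
    apply/has_derive_is_derive; rewrite -[w 1]subr0.
    apply: has_deriveB; [exact/has_derive_is_derive|exact: has_derive_cst].
  apply: near_eq_is_derive H2; apply: filterS (near_strip e0) => s se.
  by rewrite /contact_action; case: (Zmap_solution solvable (OF se)) => ->.
move=> phi t mphi It pt.
have := has_deriveB (Hw t It) (momentum_pairing_derive mphi It pt).
have Dt : chart_dom I01 (fun u => c (clamp u)) phi t by [].
have At := base_family_dom Dt.
have zE : zF (0, t) = zc (clamp t) by [].
have lzE : family_lag_z L F (0, t, zF (0, t)) = lag_z t by [].
have lz2 := lag_z_chart mphi Dt.
have lsE : family_lag_s L F (0, t, zF (0, t)) = _ := lag_s_chart mphi Dt.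
rewrite -/(w t) lzE lsE.
congr has_derive.
rewrite (momentum_pairing_chart mphi It pt) (pairing_sum mphi Dt) mulrBr mulr_sumr.
(* The terms with the derivative of [xi] cancel, in place of an integration by parts; the part of
   [L_z w] that comes from the pairing supplies the product of momentum and slope in the defect. *)
rewrite -addrA; rewrite -[RHS]addrA; congr (_ + _).
rewrite -big_split /= -!sumrB -sumrN -sumrN -big_split /=; apply: eq_bigr => i _.
by rewrite /defect lz2; ring.
Qed.

End variation_formula.
End first_variation.

(** * Linear equations with a forcing term of constant sign *)

Section linear_inhomogeneous.
Context {R : realType}.
Local Notation I01 := (@closed_unit R).

Lemma mean_value_unit (f l : R -> R) (a b : R) :
  (forall t, I01 t -> has_derive I01 f t 1 (l t)) -> I01 a -> I01 b ->
  exists2 u, I01 u & f b - f a = (b - a) * l u.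
Proof.
move=> H Ia Ib.
have seg (u : R) : I01 u -> I01 (u *: (b - a) + a).
  have uE : u *: (b - a) = u * (b - a) by [].
  move=> /andP[u0 u1]; case/andP: Ia => a0 a1; case/andP: Ib => b0 b1; rewrite uE.
  have h1 : 0 <= u * b by rewrite mulr_ge0.
  have h2 : 0 <= (1 - u) * a by rewrite mulr_ge0 // subr_ge0.
  have h3 : u * b <= u by rewrite ler_piMr.
  have h4 : (1 - u) * a <= 1 - u by rewrite ler_piMr // subr_ge0.
  by apply/andP; split; lra.
have [u u01] : exists2 u : R, 0 < u < 1 &
    f (1 *: (b - a) + a) - f (0 *: (b - a) + a) = (b - a) * l (u *: (b - a) + a).
  apply: (@MVT01 R (fun u : R => f (u *: (b - a) + a)) (fun u => (b - a) * l (u *: (b - a) + a))).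
  move=> u Iu; apply: (@has_derive_seg R R^o R^o I01) => //.
  have := has_derive_dir (c := b - a) (H _ (seg _ Iu)).
  by rewrite /GRing.scale /= mulr1.
rewrite scale1r scale0r add0r subrK => ->; exists (u *: (b - a) + a) => //.
by apply: seg; case/andP: u01 => *; rewrite /closed_unit /= !ltW.
Qed.

Lemma integrating_factor (a y g : R -> R) : {within I01, continuous a} ->
  (forall t, I01 t -> has_derive I01 y t 1 (a t * y t - g t)) ->
  exists2 w : R -> R, (forall t, 0 < w t) &
    forall t, I01 t -> has_derive I01 (fun t => w t * y t) t 1 (- (w t * g t)).
Proof.
move=> ca Hy; have [A HA] := primitive ca.
exists (fun t => expR (- A t)) => [t|t It]; first exact: expR_gt0.
have H := has_deriveM (has_derive_outer (has_deriveN (HA _ It)) (is_derive_expR _)) (Hy _ It).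
by move: H; congr has_derive; ring.
Qed.

Lemma linear_homogeneous (a y : R -> R) : {within I01, continuous a} -> y 0 = 0 ->
  (forall t, I01 t -> has_derive I01 y t 1 (a t * y t)) -> y 1 = 0.
Proof.
move=> ca y0 Hy.
have Hy' t : I01 t -> has_derive I01 y t 1 (a t * y t - 0) by rewrite subr0; exact: Hy.
have [w w0 Hw] := @integrating_factor a y (fun=> 0) ca Hy'.
have [u Iu] := mean_value_unit Hw unit0 unit1.
rewrite y0 !mulr0 subr0 oppr0 mulr0 => /eqP; rewrite mulf_eq0 gt_eqF //=.
by move/eqP.
Qed.

(* With the integrating factor [w], the function [w y] is monotone and vanishes at
   both ends, hence vanishes identically. *)
Lemma linear_forced_zero (a y g : R -> R) (h : R) : {within I01, continuous a} ->
  y 0 = 0 -> y 1 = 0 ->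
  (forall t, I01 t -> has_derive I01 y t 1 (a t * y t - g t)) ->
  (forall t, I01 t -> 0 <= h * g t) -> forall t, I01 t -> h * g t = 0.
Proof.
move=> ca y0 y1 Hy hg t It.
have [w w0 Hw] := integrating_factor ca Hy.
(* The factor [h] carries the sign of [g], so both signs are treated at once: the derivative of
   [h * (w t * y t)] is [- w t * (h * g t)]. *)
have decr u v : I01 u -> I01 v -> u <= v -> h * (w v * y v) <= h * (w u * y u).
  move=> Iu Iv uv; have [r Ir E] := mean_value_unit Hw Iu Iv.
  rewrite -subr_ge0 -mulrBr -opprB E.
  rewrite (_ : h * _ = (v - u) * (w r * (h * g r))); last by ring.
  by apply: mulr_ge0; [rewrite subr_ge0|apply: mulr_ge0; [exact: ltW|exact: hg]].
have zero u : I01 u -> h * (w u * y u) = 0.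
  move=> Iu; apply/eqP; rewrite eq_le; case/andP: (Iu) => u0 u1.
  have h0 := decr _ _ unit0 Iu u0; rewrite y0 !mulr0 in h0.
  have h1 := decr _ _ Iu unit1 u1; rewrite y1 !mulr0 in h1.
  by apply/andP.
have H1 := has_deriveZ (c := h) (Hw _ It).
have gI := @approachable_unit R.
have H0 : has_derive I01 (fun t => h *: (w t * y t)) t 1 0.
  apply: (@has_derive_eq _ _ _ _ (fun=> 0)) => //; last exact: has_derive_cst.
  by move=> u Iu; rewrite /GRing.scale /= zero.
have := approachable_lim gI It H0; rewrite (approachable_lim gI It H1) => /eqP.
rewrite /GRing.scale /= mulrN oppr_eq0 mulrCA mulf_eq0 gt_eqF //= => /eqP.
exact.
Qed.

End linear_inhomogeneous.

Lemma mul_gt0_near (R : realType) (x y : R) : `|y - x| < `|x| -> 0 < x * y.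
Proof.
have [x0|x0|->] := ltgtP x 0; last by rewrite normr0 ltNge normr_ge0.
- by rewrite (ltr0_norm x0) ltr_norml => /andP[_ h]; rewrite nmulr_rgt0 //; lra.
- by rewrite (gtr0_norm x0) ltr_norml => /andP[h _]; rewrite pmulr_rgt0 //; lra.
Qed.

(** * Critical points of the action and the Herglotz equations *)

Section herglotz_equivalence.
Context {R : realType} {n : nat} (Q : manifold R n).
Local Notation rV := ('rV[R]_n).
Local Notation I01 := (@closed_unit R).
Variables (L : tangent Q -> R -> R) (q0 q1 : Q) (z0 : R).
Hypothesis smoothL : smooth_lagrangian L.
Hypothesis solvable : forall c, Omega q0 q1 c -> exists z, is_solution L z0 c z.

Lemma herglotz_critical c : Omega q0 q1 c -> herglotz L (c, Zmap L z0 c) ->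
  critical_point (Omega q0 q1) (@smooth_family R n Q) (contact_action L z0) c.
Proof.
move=> Oc Hc; split=> // e F e0 OF F0 sF; subst c.
have [y [y0 y1 Hy]] := first_variation smoothL solvable e0 sF OF.
move/herglotz_defect : Hc => Hd.
suff y10 : y 1 = 0 by rewrite y10 in y1.
apply: (linear_homogeneous (lag_z_cont smoothL solvable e0 sF OF) y0) => t It.
have [mphi pt] := chart_atP (F 0 (clamp t)).
have := Hy _ t mphi It pt; rewrite big1 ?subr0 // => i _.
by rewrite (Hd _ mphi t It pt) mulr0.
Qed.

(** The interval is placed beside [t0], towards the farther end, so that it avoids 0 and 1 even if
    [t0] is an end point; [d' <= 1/2] prevents reaching the other end. *)
Lemma interior_interval (t0 d : R) : I01 t0 -> 0 < d ->
  exists a b, [/\ 0 < a, a < b, b < 1 & forall t, a <= t <= b -> `|t - t0| < d].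
Proof.
move=> /andP[t00 t01] d0; pose d' := Num.min d 2^-1.
have d'0 : 0 < d' by rewrite lt_min d0 invr_gt0 ltr0n.
have d'd : d' <= d by rewrite ge_min lexx.
have d'2 : d' <= 2^-1 by rewrite ge_min lexx orbT.
have [t2|t2] := leP t0 2^-1.
- exists (t0 + d' / 3), (t0 + d' / 3 * 2); split; try lra.
  by move=> t /andP[h1 h2]; rewrite ltr_norml; apply/andP; split; lra.
- exists (t0 - d' / 3 * 2), (t0 - d' / 3); split; try lra.
  by move=> t /andP[h1 h2]; rewrite ltr_norml; apply/andP; split; lra.
Qed.

Lemma critical_herglotz c : 
  critical_point (Omega q0 q1) (@smooth_family R n Q) (contact_action L z0) c ->
  herglotz L (c, Zmap L z0 c).
Proof.
move=> [Oc Hcrit]; apply/herglotz_defect => phi mphi t0 It0 pt0 i.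
have [sc c0 c1] := Oc; have szc := Zmap_smooth smoothL solvable Oc.
pose H := defect L phi c (Zmap L z0 c) i.
apply/eqP; rewrite -/(H t0); apply/negPn/negP => Ht0.
have rD := along_dom_relopen sc mphi; set D := chart_dom _ _ _ in rD.
have Dt0 : D t0 by [].
have cH : {within D, continuous H} by exact: (defect_cont smoothL sc szc mphi).
have Hpos : 0 < `|H t0| by rewrite normr_gt0.
have [d1 d10 Hd1] := cont_withinP Dt0 cH Hpos.
have [d2 d20 Hd2] : exists2 d, 0 < d & forall t, `|t - t0| < d -> I01 t -> D t.
  have HH : \forall t \near t0, I01 t -> D t by exact: (rD.2 _ Dt0).
  move: HH => /nbhs_ballP[d /= d0 Hd]; exists d => // t td; apply: Hd.
  by rewrite -ball_normE /ball_ /= distrC.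
(* Within [d1] of [t0] the defect keeps its sign, and within [d2] the curve stays in the chart. *)
have dm0 : 0 < Num.min d1 d2 by rewrite lt_min d10.
have [a [b [a0 ab b1 Hab]]] := interior_interval It0 dm0.
have abI (t : R) : a <= t <= b -> I01 t.
  by move=> /andP[at_ tb]; apply/andP; split; lra.
have abD (t : R) : a <= t <= b -> D t.
  move=> abt; apply: Hd2; last exact: abI.
  by apply: lt_le_trans (Hab _ abt) _; rewrite ge_min lexx orbT.
have abphi (t : R) : a <= t <= b -> dom phi (c (clamp t)) by move=> /abD[].
have sgn (t : R) : a <= t <= b -> 0 < H t0 * H t.
  move=> abt; have := Hd1 t (abD _ abt) (lt_le_trans (Hab _ abt) _).
  rewrite ge_min lexx => /(_ isT) Ht.
  exact: mul_gt0_near Ht.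
have [e e0 [sF F0 Fout Fin]] := bump_variation_smooth (delta_mx ord0 i) sc mphi abphi.
set F := bump_variation _ _ _ _ _ in sF F0 Fout Fin.
have F0E : F 0 = c by apply/funext.
have OF s : - e < s < e -> Omega q0 q1 (F s).
  move=> se; split; first exact: (smooth_family_curve sF se).
  - by rewrite Fout ?c0 // (sval_clamp (@unit0 R)) negb_and -!leNgt (ltW a0).
  - by rewrite Fout ?c1 // (sval_clamp (@unit1 R)) negb_and -!leNgt (ltW b1) orbT.
have [y [y0 y1 Hy]] := first_variation smoothL solvable e0 sF OF.
have y10 : y 1 = 0.
  have D1 := Hcrit e F e0 OF F0E sF.
  have v1 := @derive_val _ _ _ _ _ _ _ y1.
  have v2 := @derive_val _ _ _ _ _ _ _ D1.
  exact: (etrans (esym v1) v2).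
(* This is [<H, xi>], set to 0 off []a, b[] because [H] is an expression in the chart [phi], which
   the curve may have left. *)
pose g (t : R) := if a < t < b then bump a b t * H t else 0.
have clag := lag_z_cont smoothL solvable e0 sF OF.
have Hy' t : I01 t -> has_derive I01 y t 1 (lag_z L z0 F t * y t - g t).
  move=> It; rewrite /g; case: ifPn => abt.
    have abt' : a <= t <= b by case/andP: abt => *; rewrite !ltW.
    have := Hy phi t mphi It; rewrite {1}F0E => /(_ (abphi _ abt')).
    rewrite (_ : \sum_j _ = bump a b t * H t) //.
    have -> : variation_vec e F phi t = bump a b t *: delta_mx ord0 i.
      apply: approachable_lim; first exact: approachable_strip.
        by split=> //; exact: zero_in_strip.
      apply/has_deriveP => eps eps0; exists 1 => // h h0 _; rewrite pairZD mulr0 mulr1 addr0 add0r.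
      move=> -[/= he _]; rewrite /family_pos /family_map /=.
      rewrite (Fin _ _ he It (abphi _ abt')).2 F0E scalerA [X in X - _]addrAC subrr add0r subrr normr0.
      by rewrite mulr_ge0 // ltW.
    rewrite (bigD1 i) //= !mxE !eqxx mulr1 F0E big1 ?addr0 // => j ji.
    by rewrite !mxE (negbTE ji) andbF mulr0 mul0r.
  (* Off the support the family does not move, so [xi] vanishes and any chart at this time will
     do. *)
  have Ft s : - e < s < e -> F s (clamp t) = F 0 (clamp t).
    by move=> _; rewrite F0E Fout // (sval_clamp It).
  have [mchi ct] := chart_atP (F 0 (clamp t)).
  have := Hy _ t mchi It ct; rewrite big1 // => j _.
  by rewrite (pairing_zero e0 It Ft) mxE mul0r.
have gpos t : I01 t -> 0 <= H t0 * g t.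
  move=> It; rewrite /g; case: ifPn => [abt|_]; last by rewrite mulr0.
  have abt' : a <= t <= b by case/andP: abt => *; rewrite !ltW.
  by rewrite mulrCA mulr_ge0 ?bump_ge0 // ltW // sgn.
have abm : a < (a + b) / 2 < b by apply/andP; split; lra.
have abm' : a <= (a + b) / 2 <= b by case/andP: abm => *; rewrite !ltW.
(* At the midpoint of []a, b[] both the bump and [H t0 * H t] are positive, against the vanishing of
   [H t0 * g t]. *)
have := linear_forced_zero clag y0 y10 Hy' gpos (abI _ abm').
rewrite /g abm mulrCA => /eqP; rewrite mulf_eq0 gt_eqF ?bump_gt0 //=.
by rewrite gt_eqF // sgn.
Qed.

End herglotz_equivalence.

Theorem mainTheorem1 (R : realType) (n : nat) (Q : manifold R n)
    (L : tangent Q -> R -> R) (q0 q1 : Q) (z0 : R)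
    (smoothL : smooth_lagrangian L)
    (solvable : forall c, Omega q0 q1 c -> exists z, is_solution L z0 c z) :
  [/\ [/\ set_bij (Omega q0 q1) (Omega_N L q0 q1 z0) (IdZ L z0),
          forall cb : bar_curve Q, Omega_N L q0 q1 z0 cb ->
            Omega q0 q1 cb.1 /\ IdZ L z0 cb.1 = cb,
          forall c, Omega q0 q1 c -> (IdZ L z0 c).1 = c &
          forall c, Omega q0 q1 c ->
            bar_action (IdZ L z0 c) = contact_action L z0 c],
      forall cb : bar_curve Q, Omega_N L q0 q1 z0 cb ->
        (critical_point (Omega_N L q0 q1 z0) (@smooth_bar_family R n Q)
           (@bar_action R n Q) cb <->
         critical_point (Omega q0 q1) (@smooth_family R n Q)
           (contact_action L z0) cb.1) &
      forall cb : bar_curve Q, Omega_N L q0 q1 z0 cb ->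
        (critical_point (Omega_N L q0 q1 z0) (@smooth_bar_family R n Q)
           (@bar_action R n Q) cb <->
         herglotz L cb)].
Proof.
split.
- split.
  + exact: IdZ_bij.
  + move=> cb Ncb; split; last exact: Omega_N_IdZ Ncb.
    by have [] := Omega_N_solution Ncb.
  + by [].
  + by move=> c Oc; exact: (bar_action_Omega_N smoothL solvable (IdZ_Omega_N smoothL solvable Oc)).
- by move=> cb Ncb; exact: critical_Omega_N.
- move=> cb Ncb; have E := Omega_N_IdZ smoothL solvable Ncb.
  have [Oc _] := Omega_N_solution Ncb.
  (* Both implications are proved for the curve [(c, Zmap L z0 c)], which by [E] is the given
     one. *)
  apply: (iff_trans (critical_Omega_N smoothL solvable Ncb)); split.
    by move/(critical_herglotz smoothL solvable); rewrite -/(IdZ L z0 cb.1) E.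
  by move=> Hh; apply: (herglotz_critical smoothL solvable Oc); rewrite -/(IdZ L z0 cb.1) E.
Qed.
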